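(* Let $\mu$ be a translation bounded measure on $G$, let $\mathcal{A}$ be a van Hove sequence on $G$, and assume that the autocorrelation $\gamma$ of $\mu$ with respect to $\mathcal{A}$ exists. Then the Fourier transform $\widehat{\gamma}$ is a pure point measure on $\widehat{G}$ if and only if $\mu$ is mean almost periodic with respect to $\mathcal{A}$.
   Context: $G$ is a locally compact (Hausdorff), $\sigma$-compact abelian group with Haar measure $\theta_G$; $|A|=\theta_G(A)$, and $\mathrm{d}t$ denotes integration against $\theta_G$. $\widehat{G}$ is the dual group. $(\tau_t f)(s)=f(s-t)$, $\widetilde g(s)=\overline{g(-s)}$. A measure on $G$ is a (complex) Radon measure, i.e. a continuous linear functional on $C_c(G)$ (inductive topology); $|\mu|$ is its total variation; $\widetilde\mu(g)=\overline{\mu(\widetilde g)}$. $\mu$ is translation bounded if $\sup_{t\in G}|\mu|(t+V)<\infty$ for one (equivalently every) nonempty open relatively compact $V$. $(\mu*\varphi)(t)=\int_G\varphi(t-s)\,\mathrm{d}\mu(s)$ for $\varphi\in C_c(G)$; for translation bounded $\mu$ this function is bounded and uniformly continuous. A van Hove sequence $\mathcal{A}=(A_n)$ is a sequence of relatively compact open sets (of positive measure) with $|\partial^K A_n|/|A_n|\to 0$ for every compact $K\subseteq G$, where $\partial^K A=\big(\overline{A+K}\cap\overline{A^c}\big)\cup\big(\overline{A^c-K}\cap\overline{A}\big)$. The autocorrelation $\gamma$ of $\mu$ with respect to $\mathcal{A}$ is the vague limit of $\frac{1}{|A_n|}\,\mu|_{A_n}*\widetilde{\mu}|_{-A_n}$,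 if it exists. It is positive definite, and its Fourier transform $\widehat\gamma$ is the unique positive measure on $\widehat G$ with $\int_{\widehat G}|\check\varphi|^2\,\mathrm{d}\widehat\gamma=\int_G(\varphi*\widetilde\varphi)\,\mathrm{d}\gamma$ for all $\varphi\in C_c(G)$, where $\check\varphi(\chi)=\int_G\chi(t)\varphi(t)\,\mathrm{d}t$. For locally integrable $f$ put $\|f\|_{\mathsf{B},1,\mathcal{A}}=\limsup_{n}\frac{1}{|A_n|}\int_{A_n}|f(t)|\,\mathrm{d}t$. A translation bounded measure $\mu$ is mean almost periodic with respect to $\mathcal{A}$ if for every $\varphi\in C_c(G)$ and every $\varepsilon>0$ the set $\{t\in G:\|\mu*\varphi-\tau_t(\mu*\varphi)\|_{\mathsf{B},1,\mathcal{A}}<\varepsilon\}$ is relatively dense. A set $P\subseteq G$ is relatively dense if $P+K=G$ for some compact $K$. *)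

(* Defs.v *)
From HB Require Import structures.
From mathcomp Require Import all_boot all_order all_algebra.
From mathcomp Require Import all_classical all_reals all_analysis.
From mathcomp Require Import complex.

Set Implicit Arguments.
Unset Strict Implicit.
Unset Printing Implicit Defensive.

Import Order.TTheory GRing.Theory Num.Theory.
Import numFieldTopology.Exports numFieldNormedType.Exports.

Local Open Scope classical_set_scope.
Local Open Scope ring_scope.

(* [R[i]] has no canonical topology in the libraries: give it the one of its
   modulus. *)
HB.instance Definition _ (R : realType) :=
  NormedModule.copy R[i] (R[i] : numFieldType)^o.

(* [g_sigma_algebraType] asks for a pointed type. *)
HB.instance Definition _ (G : topologicalZmodType) := isPointed.Build G 0.

(* The real-valued modulus; the norm [`|z|] of [R[i]] is [(cmod z)%:C]. *)
Definition cmod (R : realType) (z : R[i]) : R := ComplexField.Normc.normc z.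

Definition sigma_compact (T : topologicalType) : Prop :=
  exists2 K : nat -> set T, forall n, compact (K n) & \bigcup_n K n = setT.

Definition sumset (G : zmodType) (A B : set G) : set G :=
  [set a + b | a in A & b in B].

Definition oppset (G : zmodType) (A : set G) : set G := [set - a | a in A].

Definition relatively_dense (G : topologicalZmodType) (P : set G) : Prop :=
  exists2 K : set G, compact K & sumset P K = setT.

Section PositiveRadonMeasures.
Context {R : realType}.

Definition borel (T : ptopologicalType) := g_sigma_algebraType (@open T).

HB.instance Definition _ (T : ptopologicalType) := Measurable.on (borel T).

Record radon_measure (T : ptopologicalType)
    (nu : {measure set (borel T) -> \bar R}) : Prop := {
  radon_compact : forall K : set T, compact K -> (nu K < +oo)%E ;
  radon_outer : forall B : set (borel T), measurable B ->
    nu B = ereal_inf [set nu U | U in [set U : set T | open U /\ B `<=` U]] ;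
  radon_inner : forall U : set T, open U ->
    nu U = ereal_sup [set nu K | K in [set K : set T | compact K /\ K `<=` U]]
}.

(* The sum over the atoms is tested on relatively compact Borel sets only: a
   Radon measure on a space that is not sigma-compact is determined by these,
   whereas its values on other Borel sets depend on the regularity
   convention. *)
Definition pure_point (T : ptopologicalType)
    (nu : {measure set (borel T) -> \bar R}) : Prop :=
  forall B : set (borel T), measurable B -> precompact (B : set T) ->
    nu B = (\esum_(x in B) nu [set x])%E.

Record haar_measure (G : topologicalZmodType)
    (theta : {measure set (borel G) -> \bar R}) : Prop := {
  haar_radon : radon_measure theta ;
  haar_invariant : forall (t : G) (B : set (borel G)), measurable B ->
    theta [set t + x | x in (B : set G)] = theta B ;
  haar_nonzero : theta setT != 0%E
}.

End PositiveRadonMeasures.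

Section ContinuousFunctions.
Context {R : realType} {G : topologicalZmodType}.

Definition supp (f : G -> R[i]) : set G := closure [set x | f x != 0].

Definition Cc (f : G -> R[i]) : Prop := continuous f /\ compact (supp f).

Definition translate (t : G) (f : G -> R[i]) : G -> R[i] := fun s => f (s - t).

Definition tilde (f : G -> R[i]) : G -> R[i] := fun s => conjc (f (- s)).

Definition cintegral (theta : {measure set (borel G) -> \bar R})
    (f : G -> R[i]) : R[i] :=
  Complex (\int[theta]_(t in setT) complex.Re (f t))%R
          (\int[theta]_(t in setT) complex.Im (f t))%R.

Definition convolution (theta : {measure set (borel G) -> \bar R})
    (f g : G -> R[i]) : G -> R[i] :=
  fun s => cintegral theta (fun t => f t * g (s - t)).

End ContinuousFunctions.

(* Complex Radon measures are functionals on C_c(G). They are encoded as total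
   functions on [G -> R[i]], of which only the values on [Cc] are meaningful. *)
Section ComplexRadonMeasures.
Context {R : realType} {G : topologicalZmodType}.
Local Notation functional := ((G -> R[i]) -> R[i]).
Implicit Types (mu nu : functional) (f g phi : G -> R[i]).

(* Continuity for the inductive limit topology means continuity, for the
   uniform norm, on the functions supported in K, for each compact K. *)
Record complex_radon_measure mu : Prop := {
  cradon_linear : forall (a : R[i]) f g, Cc f -> Cc g ->
    mu (fun x => a * f x + g x) = a * mu f + mu g ;
  cradon_continuous : forall K : set G, compact K ->
    exists a : R, forall f (M : R), Cc f -> supp f `<=` K ->
      (forall x, cmod (f x) <= M) -> cmod (mu f) <= a * M
}.

(* |mu|^*(h) for lower semicontinuous h >= 0. On nonnegative h in C_c(G) it is
   the value at h of the total variation |mu|. *)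
Definition variation mu (h : G -> \bar R) : \bar R :=
  ereal_sup [set (cmod (mu g))%:E | g in
    [set g | Cc g /\ forall x, ((cmod (g x))%:E <= h x)%E]].

(* Upper integral of f >= 0 with respect to |mu|. *)
Definition upper_integral mu (f : G -> \bar R) : \bar R :=
  ereal_inf [set variation mu h | h in
    [set h | lower_semicontinuous h /\ forall x, (f x <= h x)%E]].

Definition variation_set mu (B : set G) : \bar R :=
  upper_integral mu (fun x => (\1_B x)%:E).

Definition translation_bounded mu : Prop :=
  exists V : set G, [/\ open V, V !=set0, precompact V &
    (ereal_sup [set variation_set mu [set (t + x)%R | x in V] | t in setT]
       < +oo)%E].

(* The extension of mu, by density for the seminorm |mu|^*(|f|), to the
   mu-integrable functions (Bourbaki). *)
Definition rintegral mu f : R[i] :=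
  get [set c : R[i] | forall e : R, 0 < e -> exists g, [/\ Cc g,
    (upper_integral mu (fun x => (cmod (f x - g x))%:E) < e%:E)%E &
    cmod (mu g - c) < e]].

Definition restriction mu (B : set G) : functional :=
  fun phi => rintegral mu (fun x => \1_B x * phi x).

Definition tilde_measure mu : functional := fun g => conjc (mu (tilde g)).

Definition convolution_measure mu nu : functional :=
  fun phi => mu (fun s => nu (fun t => phi (s + t))).

Definition convolution_fun mu phi : G -> R[i] :=
  fun t => mu (fun s => phi (t - s)).

End ComplexRadonMeasures.

Section VanHove.
Context {R : realType} {G : topologicalZmodType}.
Variable theta : {measure set (borel G) -> \bar R}.
Implicit Types (A : nat -> set G) (f phi : G -> R[i]).
Implicit Types (mu gamma : (G -> R[i]) -> R[i]).

Definition van_hove_boundary (K B : set G) : set G :=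
  (closure (sumset B K) `&` closure (~` B)) `|`
  (closure (sumset (~` B) (oppset K)) `&` closure B).

Record van_hove A : Prop := {
  van_hove_open : forall n, open (A n) ;
  van_hove_precompact : forall n, precompact (A n) ;
  van_hove_gt0 : forall n, (0 < theta (A n))%E ;
  van_hove_cvg : forall K : set G, compact K ->
    (fun n => theta (van_hove_boundary K (A n)) *
              ((fine (theta (A n)))^-1)%:E)%E @ \oo --> 0%E
}.

Definition autocorrelation A mu gamma : Prop :=
  complex_radon_measure gamma /\
  forall phi, Cc phi ->
    (fun n => ((fine (theta (A n)))^-1)%:C%C *
       convolution_measure (restriction mu (A n))
         (restriction (tilde_measure mu) (oppset (A n))) phi) @ \oo
    --> gamma phi.

Definition besicovitch A f : \bar R :=
  limn_esup (fun n => (((fine (theta (A n)))^-1)%:E *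
    \int[theta]_(t in A n) (cmod (f t))%:E)%E).

Definition mean_almost_periodic A mu : Prop :=
  forall phi, Cc phi -> forall e : R, 0 < e ->
    relatively_dense [set t : G |
      (besicovitch A (fun s => convolution_fun mu phi s -
         translate t (convolution_fun mu phi) s)%R < e%:E)%E].

End VanHove.

Section Dual.
Variables (R : realType) (G : topologicalZmodType).

Definition character : set {compact-open, G -> R[i]} :=
  [set chi | [/\ continuous (chi : G -> R[i]),
    forall x y, chi (x + y) = chi x * chi y & forall x, `|chi x| = 1]].

Definition dual : Type := set_type character.

HB.instance Definition _ := Topological.on dual.

Lemma character1 : character (fun=> 1).
Proof.
by split=> [x|x y|x]; [exact: cvg_cst | rewrite mulr1 | rewrite normr1].
Qed.

HB.instance Definition _ := isPointed.Build dual (SigSub (mem_set character1)).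

Definition dual_val (chi : dual) : G -> R[i] := set_val chi.

End Dual.

Section FourierTransform.
Context {R : realType} {G : topologicalZmodType}.
Variable theta : {measure set (borel G) -> \bar R}.

Definition inverse_fourier (phi : G -> R[i]) (chi : dual R G) : R[i] :=
  cintegral theta (fun t => dual_val chi t * phi t).

(* [gammahat] is the Fourier transform of [gamma]. *)
Definition fourier_transform (gamma : (G -> R[i]) -> R[i])
    (gammahat : {measure set (borel (dual R G)) -> \bar R}) : Prop :=
  radon_measure gammahat /\
  forall phi, Cc phi ->
    (\int[gammahat]_chi ((cmod (inverse_fourier phi chi)) ^+ 2)%:E < +oo)%E /\
    (\int[gammahat]_(chi in setT) (cmod (inverse_fourier phi chi)) ^+ 2)%:C%C =
      gamma (convolution theta phi (tilde phi)).

End FourierTransform.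

(* Main.v *)
(* For [phi] in C_c(G) and [psi = phi - tau_t phi], the mean over [A_n] of
   [|mu * psi|^2] tends to [gamma (psi * psi~)], which is the spectral defect
     D_phi(t) = int |1 - chi(t)|^2 |phi^(chi)|^2 d gammahat(chi).
   As [mu * psi] is bounded, the L^1 and L^2 means are small together, so mean
   almost periodicity says that all the sets [D_phi < e] are relatively dense.

   If [gammahat] is pure point, then up to a small error D_phi only involves
   finitely many characters, and finitely many characters have relatively dense
   common almost periods.  Conversely, let C be a relatively compact Borel set
   without atoms.  By compactness |phi^|^2 is bounded below on C piecewise, so the
   sets [int_C |1 - chi(t)|^2 d gammahat < e] are relatively dense as well: the
   Fourier transform S of gammahat restricted to C is close to gammahat(C) on a
   relatively dense set, and finitely many translates of |S|^2 have a sum that is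
   bounded below.  By Wiener's lemma |S|^2 has mean 0, whence gammahat(C) = 0.

   Fubini's theorem is only used through Riemann sums, since no countability
   assumption relates the Borel sigma-algebra of a product to those of its
   factors. *)

From Pilot Require Import Defs.
From HB Require Import structures.
From mathcomp Require Import all_boot all_order all_algebra.
From mathcomp Require Import all_classical all_reals all_analysis.
From mathcomp Require Import measurable_realfun complex ring lra.
Import Pilot.Defs.

Set Implicit Arguments.
Unset Strict Implicit.
Unset Printing Implicit Defensive.

Import Order.TTheory GRing.Theory Num.Theory.
Import numFieldTopology.Exports numFieldNormedType.Exports.

Local Open Scope classical_set_scope.
Local Open Scope ring_scope.

(** * Complex numbers and topological groups *)

(** The restriction of [mu] to [A n] is a Bourbaki integral, accessible only through approximation.
    It is therefore replaced by [u mu], where [u] is continuous with compact support and lies below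
    the indicator. For [u mu] the mean-square identity is exact; returning to the restriction costs
    one term controlled by [|mu|(1_A - u)] and one controlled by the measure of the van Hove
    boundary. Translation boundedness enters through a single estimate, a bound on [mu * psi] that
    is uniform over translates. It makes the boundary term vanish in the limit and lets the L^1 and
    L^2 means be compared. The factor [|1 - chi(t)|^2] arises because translating [phi] multiplies
    its transform by a character value. The measure [gammahat] may be infinite, and the dual group
    need not be sigma-compact. One direction therefore works in the open sets where
    [|phi^|^2 > 1/n], which have finite measure because [|phi^|^2] is integrable. The other works
    inside compact sets of characters: these are equicontinuous, so that the Fourier transform of
    the restricted measure is uniformly continuous. *)

Section Modulus.
Context {R : realType}.
Implicit Types (x y z : R[i]).

Lemma normE z : `|z| = (cmod z)%:C%C. Proof. by case: z. Qed.

Lemma cmod_inj_le x (M : R) : (`|x| <= M%:C%C) = (cmod x <= M).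
Proof. by rewrite normE lecR. Qed.

Lemma cmod_inj_lt x (M : R) : (`|x| < M%:C%C) = (cmod x < M).
Proof. by rewrite normE ltcR. Qed.

Lemma cmodD x y : cmod (x + y) <= cmod x + cmod y.
Proof. by rewrite -cmod_inj_le rmorphD /= -!normE ler_normD. Qed.

Lemma cmodN x : cmod (- x) = cmod x.
Proof. by apply: (@complexI R); rewrite -!normE normrN. Qed.

Lemma cmodB x y : cmod (x - y) <= cmod x + cmod y.
Proof. by rewrite -(cmodN y) cmodD. Qed.

Lemma cmodC x y : cmod (x - y) = cmod (y - x).
Proof. by rewrite -cmodN opprB. Qed.

Lemma cmodM x y : cmod (x * y) = cmod x * cmod y.
Proof. by apply: (@complexI R); rewrite rmorphM /= -!normE normrM. Qed.

Lemma cmodV x : cmod x^-1 = (cmod x)^-1.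
Proof.
apply: (@complexI R); rewrite -normE normfV normE.
by rewrite -[RHS]/((real_complex R) (cmod x)^-1) fmorphV.
Qed.

Lemma cmod0 : cmod (0 : R[i]) = 0.
Proof. by apply: (@complexI R); rewrite -normE normr0. Qed.

Lemma cmod1 : cmod (1 : R[i]) = 1.
Proof. by apply: (@complexI R); rewrite -normE normr1. Qed.

Lemma cmod_eq0 x : cmod x = 0 -> x = 0.
Proof. by move=> x0; apply/eqP; rewrite -normr_eq0 normE x0. Qed.

Lemma cmod_ge0 x : 0 <= cmod x.
Proof. by rewrite -lecR -normE normr_ge0. Qed.

Lemma cmodJ x : cmod (conjc x) = cmod x.
Proof. by apply: (@complexI R); rewrite -!normE normcJ. Qed.

Lemma cmodR (a : R) : cmod a%:C%C = `|a|.
Proof. by rewrite /cmod /= expr0n /= addr0 sqrtr_sqr. Qed.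

Lemma sqr_cmod x : cmod x ^+ 2 = complex.Re x ^+ 2 + complex.Im x ^+ 2.
Proof. by case: x => a b; rewrite /cmod /= sqr_sqrtr// addr_ge0 ?sqr_ge0. Qed.

Lemma Re_le_cmod x : `|complex.Re x| <= cmod x.
Proof.
rewrite -(@ler_pXn2r _ 2) ?nnegrE ?cmod_ge0// sqr_cmod real_normK ?num_real//.
by rewrite lerDl sqr_ge0.
Qed.

Lemma Im_le_cmod x : `|complex.Im x| <= cmod x.
Proof.
rewrite -(@ler_pXn2r _ 2) ?nnegrE ?cmod_ge0// sqr_cmod real_normK ?num_real//.
by rewrite lerDr sqr_ge0.
Qed.

Lemma cmod_le_ReIm x : cmod x <= `|complex.Re x| + `|complex.Im x|.
Proof.
rewrite -(@ler_pXn2r _ 2) ?nnegrE ?cmod_ge0 ?addr_ge0// sqr_cmod.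
rewrite sqrrD !real_normK ?num_real// lerD2r lerDl.
by rewrite mulrn_wge0// mulr_ge0.
Qed.

Lemma cmod_dist x y : `|cmod x - cmod y| <= cmod (x - y).
Proof.
rewrite ler_norml; apply/andP; split.
  by have := cmodD (y - x) x; rewrite subrK cmodC; lra.
by have := cmodD (x - y) y; rewrite subrK; lra.
Qed.

Lemma cmod_sqr_dist x y (M : R) : cmod x <= M -> cmod y <= M ->
  `|cmod x ^+ 2 - cmod y ^+ 2| <= 2 * M * cmod (x - y).
Proof.
move=> xM yM; rewrite subr_sqr normrM mulrC ler_pM//; last exact: cmod_dist.
have x0 := cmod_ge0 x; have y0 := cmod_ge0 y.
by rewrite ger0_norm; lra.
Qed.

Lemma mul_conjc_cmod x : x * conjc x = (cmod x ^+ 2)%:C%C.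
Proof. by rewrite -sqr_normc normE rmorphXn. Qed.

(** Balls of [R[i]] have radii in [R[i]]; a positive radius has imaginary part 0, so real radii
    suffice. *)
Lemma cnbhsP (z : R[i]) (P : set R[i]) : nbhs z P <->
  exists2 e : R, 0 < e & forall y, cmod (y - z) < e -> P y.
Proof.
rewrite -nbhs_ballE; split=> [[e /= e0 eP]|[e e0 eP]].
  have [eR e0'] : complex.Im e = 0 /\ 0 < complex.Re e.
    by move: e0; case: (e) => a b /=; rewrite ltcE /= => /andP[/eqP -> ->].
  exists (complex.Re e) => // y yz; apply: eP; rewrite /ball /= distrC normE.
  by rewrite ltcE /= eR eqxx.
exists e%:C%C => [|y]; first by rewrite /= ltcR.
by rewrite /ball /= distrC cmod_inj_lt => /eP.
Qed.

Lemma ccvgP (T : Type) (F : set_system T) (FF : Filter F) (f : T -> R[i]) z :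
  f @ F --> z <-> forall e : R, 0 < e -> \forall t \near F, cmod (f t - z) < e.
Proof.
split=> [fz e e0|H P /cnbhsP[e e0 eP]].
  by apply: (fz [set y | cmod (y - z) < e]); apply/cnbhsP; exists e.
by apply: filterS (H e e0) => t; exact: eP.
Qed.

Lemma conjCM x y : conjc (x * y) = conjc x * conjc y.
Proof. exact: rmorphM. Qed.

Lemma conjCB x y : conjc (x - y) = conjc x - conjc y.
Proof. exact: rmorphB. Qed.

Lemma conjC_sum (I : Type) (s : seq I) (F : I -> R[i]) :
  conjc (\sum_(i <- s) F i) = \sum_(i <- s) conjc (F i).
Proof. exact: rmorph_sum. Qed.

Lemma conjCR (a : R) : conjc a%:C%C = a%:C%C.
Proof. exact: conjc_real. Qed.

End Modulus.

Section ComplexContinuity.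
Context {R : realType}.

Lemma ccontP (T : topologicalType) (f : T -> R[i]) : continuous f <->
  forall x (e : R), 0 < e -> \forall y \near x, cmod (f y - f x) < e.
Proof. by split=> H x; have := H x => /ccvgP; apply. Qed.

(** A local Lipschitz criterion that yields the continuity of sums, products, opposites and
    conjugates. The constants may depend on [x], which is what products require. *)
Lemma ccont_comp2 (T : topologicalType) (f g h : T -> R[i]) :
  continuous f -> continuous g -> (forall x, exists C D : R, 
    \forall y \near x, cmod (h y - h x) <= C * cmod (f y - f x) + D * cmod (g y - g x)) ->
  continuous h.
Proof.
move=> /ccontP cf /ccontP cg H; apply/ccontP => x e e0.
have [C [D HCD]] := H x.
have M0 : 0 < `|C| + `|D| + 1 by rewrite ltr_wpDl// addr_ge0.
have d0 : 0 < e / (`|C| + `|D| + 1) by rewrite divr_gt0.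
near=> y.
have fy : cmod (f y - f x) < e / (`|C| + `|D| + 1) by near: y; exact: cf.
have gy : cmod (g y - g x) < e / (`|C| + `|D| + 1) by near: y; exact: cg.
have hy : cmod (h y - h x) <= C * cmod (f y - f x) + D * cmod (g y - g x).
  by near: y; exact: HCD.
apply: (le_lt_trans hy).
apply: (@le_lt_trans _ _ ((`|C| + `|D|) * (e / (`|C| + `|D| + 1)))).
  rewrite mulrDl; apply: lerD.
    apply: (@le_trans _ _ (`|C| * cmod (f y - f x))).
      by rewrite ler_wpM2r ?cmod_ge0// ler_norm.
    by rewrite ler_wpM2l// ltW.
  apply: (@le_trans _ _ (`|D| * cmod (g y - g x))).
    by rewrite ler_wpM2r ?cmod_ge0// ler_norm.
  by rewrite ler_wpM2l// ltW.
rewrite mulrCA -{2}[e]mulr1 ltr_pM2l// ltr_pdivrMr// mul1r; lra.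
Unshelve. all: by end_near. Qed.

Lemma ccont_cst (T : topologicalType) (c : R[i]) : continuous (fun _ : T => c).
Proof. by move=> x; exact: cvg_cst. Qed.

Lemma ccontD (T : topologicalType) (f g : T -> R[i]) :
  continuous f -> continuous g -> continuous (fun x => f x + g x).
Proof.
move=> cf cg; apply: (ccont_comp2 cf cg) => x; exists 1, 1; near=> y.
by rewrite !mul1r (_ : _ - _ = f y - f x + (g y - g x)) ?cmodD//; ring.
Unshelve. all: by end_near. Qed.

Lemma ccontM (T : topologicalType) (f g : T -> R[i]) :
  continuous f -> continuous g -> continuous (fun x => f x * g x).
Proof.
move=> cf cg; apply: (ccont_comp2 cf cg) => x.
exists (cmod (g x) + 1), (cmod (f x)); near=> y.
have gy : cmod (g y) <= cmod (g x) + 1.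
  have := cmodD (g y - g x) (g x); rewrite subrK.
  suff : cmod (g y - g x) < 1 by lra.
  by near: y; move/ccontP : cg; apply.
rewrite (_ : _ - _ = g y * (f y - f x) + f x * (g y - g x)); last by ring.
by rewrite (le_trans (cmodD _ _))// !cmodM lerD2r ler_wpM2r ?cmod_ge0.
Unshelve. all: by end_near. Qed.

Lemma ccontJ (T : topologicalType) (f : T -> R[i]) :
  continuous f -> continuous (fun x => conjc (f x)).
Proof.
move=> cf; apply: (ccont_comp2 cf cf) => x; exists 1, 0; near=> y.
by rewrite mul1r mul0r addr0 -rmorphB cmodJ.
Unshelve. all: by end_near. Qed.

Lemma ccontN (T : topologicalType) (f : T -> R[i]) :
  continuous f -> continuous (fun x => - f x).
Proof.
move=> cf; apply: (ccont_comp2 cf cf) => x; exists 1, 0; near=> y.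
by rewrite mul1r mul0r addr0 -opprD cmodN.
Unshelve. all: by end_near. Qed.

Lemma ccontB (T : topologicalType) (f g : T -> R[i]) :
  continuous f -> continuous g -> continuous (fun x => f x - g x).
Proof. by move=> cf cg; exact: (ccontD cf (ccontN cg)). Qed.

Lemma ccontR (T : topologicalType) (f : T -> R) :
  continuous f -> continuous (fun x => (f x)%:C%C).
Proof.
move=> cf; apply/ccontP => x e e0.
have /cvgrPdist_lt /(_ e e0) := cf x; apply: filterS => y.
by rewrite -rmorphB cmodR distrC.
Qed.

Lemma cont_cmod (T : topologicalType) (f : T -> R[i]) :
  continuous f -> continuous (fun x => cmod (f x)).
Proof.
move=> /ccontP cf x; apply/cvgrPdist_lt => e e0.
apply: filterS (cf x e e0) => y; rewrite distrC; apply: le_lt_trans.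
exact: cmod_dist.
Qed.

Lemma cont_Re (T : topologicalType) (f : T -> R[i]) :
  continuous f -> continuous (fun x => complex.Re (f x)).
Proof.
move=> /ccontP cf x; apply/cvgrPdist_lt => e e0.
apply: filterS (cf x e e0) => y; rewrite distrC; apply: le_lt_trans.
by rewrite -raddfB Re_le_cmod.
Qed.

Lemma cont_Im (T : topologicalType) (f : T -> R[i]) :
  continuous f -> continuous (fun x => complex.Im (f x)).
Proof.
move=> /ccontP cf x; apply/cvgrPdist_lt => e e0.
apply: filterS (cf x e e0) => y; rewrite distrC; apply: le_lt_trans.
by rewrite -raddfB Im_le_cmod.
Qed.

Lemma cont_sqr (T : topologicalType) (f : T -> R) :
  continuous f -> continuous (fun x => f x ^+ 2).
Proof. by move=> cf x; apply: cvgM; exact: cf. Qed.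

End ComplexContinuity.

Section LocallyCompact.
Context {R : realType} {T : topologicalType}.
Hypotheses (lcT : locally_compact [set: T]) (hT : hausdorff_space T).

(** A locally compact Hausdorff space need not be normal, but its one-point compactification is.
    Urysohn's lemma is applied there, to the image of [K] and the complement of the image of [U]. *)
Lemma compact_separator (K U : set T) : compact K -> open U -> K `<=` U ->
  exists f : T -> R, [/\ continuous f, forall x, 0 <= f x <= 1,
    forall x, K x -> f x = 1 & forall x, ~ U x -> f x = 0].
Proof.
move=> cK oU KU.
pose X := one_point_compactification T.
have hX : hausdorff_space X by exact: one_point_compactification_hausdorff.
have nX : normal_space X.
  by apply: compact_normal => //; exact: one_point_compactification_compact.
have oSU : open (Some @` U : set X).
  exact: one_point_compactification_open_some.
have cont_some : continuous (Some : T -> X).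
  exact: one_point_compactification_some_continuous.
have cSK : closed (Some @` K : set X).
  apply: compact_closed => //; apply: continuous_compact => //.
  exact: continuous_subspaceT.
have := (@normal_separatorP R X).1 nX (~` (Some @` U)) (Some @` K).
move=> /(_ (open_closedC oSU) cSK).
case/(_ _)/(@uniform_separatorP X R) => [|f [cf f01 f0 f1]].
  apply/seteqP; split=> // x [/= nU [y Ky yx]]; apply: nU.
  by exists y => //; exact: KU.
exists (f \o Some); split=> [|x|x Kx|x Ux].
- by move=> x; apply: continuous_comp; [exact: cont_some|exact: cf].
- by have /= := f01 (f (Some x)); rewrite in_itv /=; apply; exists (Some x).
- by apply: f1; exists (Some x) => //; exists x.
- by apply: f0; exists (Some x) => // -[y Uy [yx]]; apply: Ux; rewrite -yx.
Qed.

Lemma compact_nbhs (x : T) : exists2 K, nbhs x K & compact K.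
Proof.
by have [U] := lcT (x := x) I; rewrite withinET => Ux [cU _]; exists U.
Qed.

End LocallyCompact.

Section TopologicalGroup.
Context {G : topologicalZmodType}.

Lemma cont_addl (x : G) : continuous (fun w : G => x + w).
Proof.
move=> w; apply: (@continuous_comp _ _ _ (fun w => (x, w))
  (fun p : G * G => p.1 + p.2)); last exact: add_continuous.
by apply: cvg_pair => /=; [exact: cvg_cst|exact: cvg_id].
Qed.

Lemma cont_addr (x : G) : continuous (fun w : G => w + x).
Proof.
rewrite (_ : (fun w => _) = fun w => x + w); first exact: cont_addl.
by apply/funext => w; rewrite addrC.
Qed.

Lemma cont_opp : continuous (fun w : G => - w).
Proof. exact: opp_continuous. Qed.

Lemma cont_subl (x : G) : continuous (fun w : G => x - w).
Proof.
move=> w; apply: (@continuous_comp _ _ _ (fun w : G => - w) (fun w => x + w)).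
  exact: cont_opp.
exact: cont_addl.
Qed.

Lemma near_addE (x : G) (P : G -> Prop) :
  (\forall w \near 0, P (x + w)) <-> (\forall y \near x, P y).
Proof.
split=> H.
  have h : (fun y => - x + y) @ nbhs x --> (0 : G).
    by have := @cont_addl (- x) x; rewrite /continuous_at addNr.
  have {}H : \forall y \near x, P (x + (- x + y)) by exact: (h _ H).
  by apply: filterS H => y; rewrite addrA subrr add0r.
have h : (fun w => x + w) @ nbhs 0 --> (x : G).
  by have := @cont_addl x 0; rewrite /continuous_at addr0.
exact: (h _ H).
Qed.

Lemma near_oppE (P : G -> Prop) :
  (\forall w \near 0, P w) -> (\forall w \near 0, P (- w)).
Proof.
move=> H; have h : (fun w => - w) @ nbhs 0 --> (0 : G).
  by have := @cont_opp 0; rewrite /continuous_at oppr0.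
exact: (h _ H).
Qed.

Lemma near_split (P : G -> Prop) : (\forall w \near 0, P w) ->
  exists W : set G, [/\ open W, W 0 & forall v w, W v -> W w -> P (v - w)].
Proof.
move=> H; have h : (fun p : G * G => p.1 - p.2) @ nbhs ((0, 0) : G * G) --> (0 : G).
  by have := @sub_continuous G (0, 0); rewrite /continuous_at /= subr0.
have [[A B] /= [A0 B0] AB] := h _ H.
exists (interior (A `&` B)); split; first exact: open_interior.
- exact: (filterI A0 B0).
- by move=> v w /interior_subset[Av _] /interior_subset[_ Bw]; exact: (AB (v, w)).
Qed.

Lemma compact_addl (K : set G) x : compact K -> compact [set x + y | y in K].
Proof.
move=> cK; apply: continuous_compact => //; apply: continuous_subspaceT.
exact: cont_addl.
Qed.

Lemma compact_subl (K : set G) x : compact K -> compact [set x - y | y in K].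
Proof.
move=> cK; apply: continuous_compact => //; apply: continuous_subspaceT.
exact: cont_subl.
Qed.

Lemma compact_opp (K : set G) : compact K -> compact (oppset K).
Proof.
move=> cK; apply: continuous_compact => //; apply: continuous_subspaceT.
exact: cont_opp.
Qed.

Lemma compact_sumset (K L : set G) : compact K -> compact L -> compact (sumset K L).
Proof.
move=> cK cL; have -> : sumset K L = (fun p => p.1 + p.2) @` (K `*` L).
  apply/seteqP; split=> [x [a Ka] [b Lb] <-|x [[a b] [/= Ka Lb] <-]].
    by exists (a, b).
  by exists a => //; exists b.
apply: continuous_compact; last exact: compact_setX.
apply: continuous_subspaceT; exact: add_continuous.
Qed.

Lemma open_addl (U : set G) x : open U -> open [set y | U (x + y)].
Proof. by move=> oU; apply: open_comp => // y _; exact: cont_addl. Qed.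

Lemma open_subl (U : set G) x : open U -> open [set y | U (x - y)].
Proof. by move=> oU; apply: open_comp => // y _; exact: cont_subl. Qed.

Lemma open_shift (U : set G) x : open U -> open [set x + y | y in U].
Proof.
move=> oU; rewrite (_ : [set _ | _ in _] = [set y | U (- x + y)]).
  exact: open_addl.
apply/seteqP; split=> [y [z Uz <-] /=|y /= Uy]; first by rewrite addKr.
by exists (- x + y) => //; rewrite addrA subrr add0r.
Qed.


Lemma compact_shift_cover (K W : set G) : compact K -> nbhs 0 W ->
  exists s : seq G, forall x, K x -> exists2 t, t \in s & W (x - t).
Proof.
move=> cK nW; have := cK; rewrite compact_cover.
move=> /(_ G setT (fun t => [set t + y | y in interior W])).
case=> [t _||D _ KD].
- by apply: open_shift; exact: open_interior.
- by move=> x Kx; exists x => //; exists 0; rewrite ?addr0//; exact: nW.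
exists (finmap.enum_fset D) => x /KD[t /= tD [y Wy <-]]; exists t => //.
by rewrite addrC addKr; exact: interior_subset.
Qed.

End TopologicalGroup.

Section CcTheory.
Context {R : realType} {G : topologicalZmodType}.
Hypotheses (hG : hausdorff_space G).
Implicit Types f g : G -> R[i].

Lemma CcI f K : continuous f -> compact K -> (forall x, ~ K x -> f x = 0) -> Cc f.
Proof.
move=> cf cK fK; split=> //; apply: (subclosed_compact _ cK).
  exact: closed_closure.
rewrite /supp; have /closure_id -> : closed K by exact: compact_closed.
apply: closureS => x /= fx; apply: contrapT => nKx.
by move: fx; rewrite fK ?eqxx.
Qed.

Lemma Cc0 f x : ~ supp f x -> f x = 0.
Proof.
move=> nx; apply/eqP; apply: contrapT => /negP fx; apply: nx.
exact: subset_closure.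
Qed.

Lemma Cc_lin (a : R[i]) f g : Cc f -> Cc g -> Cc (fun x => a * f x + g x).
Proof.
move=> [cf sf] [cg sg]; apply: (@CcI _ (supp f `|` supp g)).
- have H := @ccontM R G (fun=> a) f (@ccont_cst R G a) cf; exact: (ccontD H cg).
- exact: compactU.
- by move=> x /not_orP[/Cc0 -> /Cc0 ->]; rewrite mulr0 addr0.
Qed.

Lemma Cc_cst0 : Cc (fun _ : G => 0 : R[i]).
Proof. by apply: (@CcI _ set0) => //; [exact: ccont_cst|exact: compact0]. Qed.

Lemma CcD f g : Cc f -> Cc g -> Cc (fun x => f x + g x).
Proof.
move=> cf cg; have := Cc_lin 1 cf cg.
by under eq_fun do rewrite mul1r.
Qed.

Lemma CcZ (a : R[i]) f : Cc f -> Cc (fun x => a * f x).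
Proof.
move=> cf; have := Cc_lin a cf Cc_cst0.
by under eq_fun do rewrite addr0.
Qed.

Lemma CcB f g : Cc f -> Cc g -> Cc (fun x => f x - g x).
Proof.
move=> cf cg; have := CcD cf (CcZ (-1) cg).
by under eq_fun do rewrite mulN1r.
Qed.

Lemma CcM f g : Cc f -> continuous g -> Cc (fun x => f x * g x).
Proof.
move=> [cf sf] cg; apply: (CcI _ sf); first exact: (ccontM cf cg).
by move=> x /Cc0 ->; rewrite mul0r.
Qed.

Lemma CcJ f : Cc f -> Cc (fun x => conjc (f x)).
Proof.
move=> [cf sf]; apply: (CcI _ sf); first exact: ccontJ.
by move=> x /Cc0 ->; rewrite rmorph0.
Qed.

Lemma Cc_addl f x : Cc f -> Cc (fun y => f (x + y)).
Proof.
move=> [cf sf]; apply: (@CcI _ [set - x + y | y in supp f]).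
- by move=> y; apply: continuous_comp; [exact: cont_addl|exact: cf].
- exact: compact_addl.
- move=> y ny; apply: Cc0 => sy; apply: ny; exists (x + y) => //.
  by rewrite addKr.
Qed.

Lemma Cc_subl f x : Cc f -> Cc (fun y => f (x - y)).
Proof.
move=> [cf sf]; apply: (@CcI _ [set x - y | y in supp f]).
- by move=> y; apply: continuous_comp; [exact: cont_subl|exact: cf].
- exact: compact_subl.
- move=> y ny; apply: Cc0 => sy; apply: ny; exists (x - y) => //.
  by rewrite opprB addrC subrK.
Qed.

Lemma Cc_addr f x : Cc f -> Cc (fun y => f (y + x)).
Proof.
by move=> /(@Cc_addl f x); under [X in _ -> Cc X]eq_fun do rewrite addrC.
Qed.

Lemma Cc_subr f x : Cc f -> Cc (fun y => f (y - x)).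
Proof. exact: Cc_addr. Qed.

Lemma Cc_tilde f : Cc f -> Cc (tilde f).
Proof.
move=> /(@Cc_subl _ 0)/CcJ; rewrite /tilde.
by under eq_fun do rewrite sub0r.
Qed.

Lemma compact_unif f (K : set G) (e : R) : continuous f -> compact K -> 0 < e ->
  \forall w \near (0 : G), forall x, K x -> cmod (f (x + w) - f x) < e.
Proof.
move=> /ccontP cf /compact_near_coveringP cK e0.
apply: (cK G (nbhs (0 : G)) (fun w x => cmod (f (x + w) - f x) < e)).
move=> x Kx; have e20 : 0 < e / 2 by rewrite divr_gt0.
have h : (fun p : G * G => p.1 + p.2) @ nbhs ((x, 0) : G * G) --> (x : G).
  by have := @add_continuous G (x, 0); rewrite /continuous_at /= addr0.
have [[A B] /= [A0 B0] AB] := h _ (cf x _ e20).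
exists (A `&` [set y | cmod (f y - f x) < e / 2], B) => /=.
  by split => //; apply: filterI => //; exact: cf.
move=> [y w] /= [[Ay fy] Bw].
have /= H := AB (y, w) (conj Ay Bw).
have := cmodD (f (y + w) - f x) (f x - f y); rewrite addrA subrK.
by move: fy; rewrite (cmodC (f y)) => fy; lra.
Qed.

(** If only [x + w] lies in the support, the estimate on the support is used at [x + w] with the
    shift [- w]; hence [w] and [- w] are taken small together. *)
Lemma Cc_unif f (e : R) : Cc f -> 0 < e ->
  \forall w \near (0 : G), forall x, cmod (f (x + w) - f x) < e.
Proof.
move=> [cf sf] e0; have H := compact_unif cf sf e0.
apply: filterS2 H (near_oppE H) => w H1 H2 x.
have [sx|nx] := pselect (supp f x); first exact: H1.
have [sx|nx'] := pselect (supp f (x + w)).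
  by have := H2 _ sx; rewrite addrK cmodC.
by rewrite !Cc0// subr0 cmod0.
Qed.

Lemma compact_bounded f (K : set G) : continuous f -> compact K ->
  exists2 M : R, 0 <= M & forall x, K x -> cmod (f x) <= M.
Proof.
move=> /ccontP cf /compact_near_coveringP cK.
have : \forall M \near +oo%R, K `<=` (fun x => cmod (f x) <= M).
  apply: (cK R +oo%R (fun (M : R) x => cmod (f x) <= M)) => x Kx.
  exists ([set y | cmod (f y - f x) < 1], [set M | cmod (f x) + 1 < M]) => /=.
    by split; [exact: cf|apply: nbhs_pinfty_gt; exact: num_real].
  move=> [y M] /= [fy fM]; have := cmodD (f y - f x) (f x).
  by rewrite subrK; lra.
move=> H; near (pinfty_nbhs R) => M; exists M; last by near: M; exact: H.
by near: M; apply: nbhs_pinfty_ge; exact: num_real.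
Unshelve. all: by end_near. Qed.

Lemma Cc_bounded f : Cc f -> exists2 M : R, 0 <= M & forall x, cmod (f x) <= M.
Proof.
move=> [cf sf]; have [M M0 fM] := compact_bounded cf sf.
exists M => // x; have [/fM//|/Cc0 ->] := pselect (supp f x).
by rewrite cmod0.
Qed.

End CcTheory.

(** * Complex Radon measures and their restrictions *)

(** The sign of [b] is free, so that the constant accumulated in an estimate can be supplied as it
    stands. *)
Lemma ge0_epsilon_le {R : realType} (x y b : R) :
  (forall e : R, 0 < e -> x <= y + b * e) -> x <= y.
Proof.
move=> H; apply/ler_addgt0Pr => e e0.
have b0 : 0 < `|b| + 1 by rewrite ltr_wpDl.
apply: le_trans (H (e / (`|b| + 1)) _) _; first by rewrite divr_gt0.
rewrite lerD2l mulrA ler_pdivrMr// mulrC; apply: ler_wpM2l; first exact: ltW.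
have := ler_norm b; lra.
Qed.

(** The intervals of centre [r n] and radius [d n] meet pairwise, so the supremum of their left end
    points lies in all of them. This gives a limit together with its rate, even when [d] does not
    tend to 0. *)
Lemma approx_limit {R : realType} (r d : nat -> R) :
  (forall n m, r m - d m <= r n + d n) ->
  exists c : R, forall n, `|c - r n| <= d n.
Proof.
move=> H; pose S := [set r n - d n | n in setT].
have S0 : S !=set0 by exists (r 0%N - d 0%N), 0%N.
have ubS n : ubound S (r n + d n) by move=> _ [m _ <-]; exact: H.
exists (sup S) => n; rewrite ler_norml; apply/andP; split.
  rewrite lerBrDr addrC; apply: ub_le_sup; last by exists n.
  by exists (r 0%N + d 0%N); exact: ubS.
by rewrite lerBlDr addrC; apply: ge_sup => //; exact: ubS.
Qed.

Lemma capprox_limit {R : realType} (z : nat -> R[i]) (d : nat -> R) :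
  (forall n m, cmod (z m - z n) <= d m + d n) ->
  exists c : R[i], forall n, cmod (c - z n) <= 2 * d n.
Proof.
move=> H.
have [|a Ha] := @approx_limit R (fun n => complex.Re (z n)) d.
  move=> n m; have := le_trans (Re_le_cmod _) (H n m).
  have := ler_norm (complex.Re (z m - z n)); rewrite raddfB /=; lra.
have [|b Hb] := @approx_limit R (fun n => complex.Im (z n)) d.
  move=> n m; have := le_trans (Im_le_cmod _) (H n m).
  have := ler_norm (complex.Im (z m - z n)); rewrite raddfB /=; lra.
exists (Complex a b) => n; apply: le_trans (cmod_le_ReIm _) _.
rewrite !raddfB /=; have := Ha n; have := Hb n; lra.
Qed.

Lemma phase_align {R : realType} (z w : R[i]) :
  exists c : R[i], cmod c = 1 /\ cmod (z + c * w) = cmod z + cmod w.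
Proof.
have [->|w0] := eqVneq w 0.
  by exists 1; rewrite cmod1 mulr0 !addr0 cmod0 addr0.
have [->|z0] := eqVneq z 0.
  by exists 1; rewrite cmod1 mul1r !add0r cmod0 add0r.
have rw0 : cmod w != 0 by apply: contra_neq w0; exact: cmod_eq0.
have rz0 : cmod z != 0 by apply: contra_neq z0; exact: cmod_eq0.
have mz0 : (cmod z)%:C%C != 0 :> R[i] by rewrite -normE normr_eq0.
(* The second factor turns [w] onto the positive axis, the first turns the result into the direction
   of [z]. *)
exists (z / (cmod z)%:C%C * ((cmod w)%:C%C / w)); split.
  rewrite !cmodM !cmodV !cmodR !ger0_norm ?cmod_ge0//.
  by rewrite !mulfV// mulr1.
rewrite -!mulrA mulVf// mulr1.
have -> : z + z * ((cmod z)%:C%C^-1 * (cmod w)%:C%C)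
    = z / (cmod z)%:C%C * (cmod z + cmod w)%:C%C.
  by rewrite rmorphD /=; field.
rewrite !cmodM !cmodV !cmodR !ger0_norm ?addr_ge0 ?cmod_ge0//.
by rewrite mulfV// mul1r.
Qed.

Section RadonFunctional.
Context {R : realType} {G : topologicalZmodType}.
Hypotheses (hG : hausdorff_space G) (lcG : locally_compact [set: G]).
Variable mu : (G -> R[i]) -> R[i].
Hypothesis mu_radon : complex_radon_measure mu.
Implicit Types f g k : G -> R[i].

Lemma radon0 : mu (fun=> 0) = 0.
Proof.
have := cradon_linear mu_radon 1 (Cc_cst0 hG) (Cc_cst0 hG).
under eq_fun do rewrite mulr0 addr0.
by rewrite mul1r => /eqP; rewrite -{1}[mu _]addr0 (inj_eq (addrI _)) eq_sym => /eqP.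
Qed.

Lemma radonD f g : Cc f -> Cc g -> mu (fun x => f x + g x) = mu f + mu g.
Proof.
move=> cf cg; have := cradon_linear mu_radon 1 cf cg.
by rewrite mul1r; under eq_fun do rewrite mul1r.
Qed.

Lemma radonZ a f : Cc f -> mu (fun x => a * f x) = a * mu f.
Proof.
move=> cf; have := cradon_linear mu_radon a cf (Cc_cst0 hG).
by rewrite radon0 addr0; under eq_fun do rewrite addr0.
Qed.

Lemma radonB f g : Cc f -> Cc g -> mu (fun x => f x - g x) = mu f - mu g.
Proof.
move=> cf cg; have := radonD cf (CcZ hG (-1) cg); rewrite radonZ// mulN1r.
by under eq_fun do rewrite mulN1r.
Qed.

Lemma Cc_sum (I : Type) (s : seq I) (F : I -> G -> R[i]) :
  (forall i, Cc (F i)) -> Cc (fun x => \sum_(i <- s) F i x).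
Proof.
move=> cF; elim: s => [|i s IH].
  by under eq_fun do rewrite big_nil; exact: Cc_cst0.
by under eq_fun do rewrite big_cons; exact: CcD.
Qed.

Lemma radon_sum (I : Type) (s : seq I) (F : I -> G -> R[i]) :
  (forall i, Cc (F i)) ->
  mu (fun x => \sum_(i <- s) F i x) = \sum_(i <- s) mu (F i).
Proof.
move=> cF; elim: s => [|i s IH].
  by rewrite big_nil; under eq_fun do rewrite big_nil; exact: radon0.
rewrite big_cons -IH -radonD//; last exact: Cc_sum.
by under eq_fun do rewrite big_cons.
Qed.

Lemma radon_bound (K : set G) : compact K ->
  exists2 a : R, 0 <= a & forall f (M : R), Cc f -> (forall x, ~ K x -> f x = 0) ->
    (forall x, K x -> cmod (f x) <= M) -> 0 <= M -> cmod (mu f) <= a * M.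
Proof.
move=> cK; have [a Ha] := cradon_continuous mu_radon cK.
exists `|a| => // f M cf fK fM M0.
apply: (@le_trans _ _ (a * M)); last by rewrite ler_wpM2r// ler_norm.
apply: Ha => //; last first.
  move=> x; have [/fM//|/fK ->] := pselect (K x).
  by rewrite cmod0.
have /closure_id -> : closed K by exact: compact_closed.
apply: closureS => x /= fx; apply: contrapT => nKx.
by move: fx; rewrite fK ?eqxx.
Qed.

(** Radial shrinking: [k'] is [k] times [1 - e / max(e, |k|)]. At a uniform cost [e] it turns a
    bound [|k| - e < h], available only on an open set, into [|k'| <= h]. *)
Lemma Cc_clip k (e : R) : Cc k -> 0 < e -> exists k', [/\ Cc k',
  forall x, cmod (k x - k' x) <= e, forall x, k x = 0 -> k' x = 0 &
  forall x, cmod (k' x) <= Num.max 0 (cmod (k x) - e)].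
Proof.
move=> ck e0; pose m x := Num.max e (cmod (k x)).
have m0 x : 0 < m x by rewrite /m lt_max e0.
have cm : continuous m.
  move=> x; apply: (@continuous_max _ _ (fun=> e) (fun x => cmod (k x)) x).
    exact: cvg_cst.
  by apply: cont_cmod; exact: ck.1.
have cfac : continuous (fun x => (1 - e / m x)%:C%C : R[i]).
  apply: ccontR => x; apply: cvgB; first exact: cvg_cst.
  apply: cvgM; first exact: cvg_cst.
  by apply: cvgV; [rewrite gt_eqF|exact: cm].
exists (fun x => k x * (1 - e / m x)%:C%C); split.
- exact: CcM.
- move=> x; rewrite -{1}[k x]mulr1 -mulrBr cmodM.
  have -> : 1 - (1 - e / m x)%:C%C = (e / m x)%:C%C :> R[i].
    by rewrite rmorphB rmorph1; ring.
  rewrite cmodR ger0_norm; last by rewrite divr_ge0// ltW.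
  by rewrite mulrCA ler_piMr ?(ltW e0)// ler_pdivrMr// mul1r le_max lexx orbT.
- by move=> x ->; rewrite mul0r.
- move=> x; rewrite cmodM cmodR ger0_norm; last first.
    by rewrite subr_ge0 ler_pdivrMr// mul1r le_max lexx.
  rewrite /m; case: (leP e (cmod (k x))) => ke; last by rewrite divff ?gt_eqF// subrr mulr0 le_max lexx.
  have k0 : 0 < cmod (k x) by lra.
  by rewrite mulrBr mulr1 mulrCA divff ?gt_eqF// mulr1 le_max lexx orbT.
Qed.

Lemma variation_le g h (v : R) : (variation mu h <= v%:E)%E -> Cc g ->
  (forall x, ((cmod (g x))%:E <= h x)%E) -> cmod (mu g) <= v.
Proof.
move=> hv cg gh; rewrite -lee_fin; apply: le_trans hv.
by apply: ereal_sup_ubound; exists g.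
Qed.

Lemma open_lsc_gt (h : G -> \bar R) (r : G -> R) : lower_semicontinuous h ->
  continuous r -> open [set x | ((r x)%:E < h x)%E].
Proof.
move=> lh cr; rewrite openE => x /= rh.
have [a ra ah] : exists2 a : R, r x < a & (a%:E < h x)%E.
  case: (h x) rh => [b| |//].
    by rewrite lte_fin => /midf_lt[ra ab]; exists ((r x + b) / 2).
  by exists (r x + 1); rewrite ?ltrDl// ltry.
have [V nV HV] := lh x a ah.
have H : \forall y \near x, r y < a by apply: (cvgr_lt (r x) (cr x)).
apply: filterS2 nV H => y Vy ry; apply: lt_trans (HV y Vy).
by rewrite lte_fin.
Qed.

(* Splitting [k] by a partition of unity subordinate to [{|k| - e < h}] and
   [{|k| - e < h'}] replaces the subadditivity of the variation. *)
Lemma radon_split_max k (h h' : G -> \bar R) (v v' : R) : Cc k ->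
  lower_semicontinuous h -> lower_semicontinuous h' ->
  (forall x, (0 <= h x)%E) -> (forall x, (0 <= h' x)%E) ->
  (forall x, ((cmod (k x))%:E <= maxe (h x) (h' x))%E) ->
  (variation mu h <= v%:E)%E -> (variation mu h' <= v'%:E)%E ->
  cmod (mu k) <= v + v'.
Proof.
move=> ck lh lh' h0 h0' kh hv hv'.
have [a a0 Ha] := radon_bound ck.2.
apply: (@ge0_epsilon_le _ _ _ (2 * a)) => e e0.
have ccont : continuous (fun x => cmod (k x) - e).
  move=> x; apply: cvgB; last exact: cvg_cst.
  by apply: cont_cmod; exact: ck.1.
pose U := [set x | ((cmod (k x) - e)%:E < h x)%E].
pose U' := [set x | ((cmod (k x) - e)%:E < h' x)%E].
have oU : open U by exact: open_lsc_gt.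
have oU' : open U' by exact: open_lsc_gt.
have UU' x : ~ U' x -> U x.
  move=> nU'; have : ((cmod (k x) - e)%:E < maxe (h x) (h' x))%E.
    by apply: lt_le_trans (kh x); rewrite lte_fin; lra.
  by rewrite lt_max => /orP[//|].
(* What [U'] misses of the support is compact and inside [U]; a Urysohn function [rho] for this pair
   makes [1 - rho] vanish where [k] is nonzero off [U']. *)
have cK : compact (supp k `\` U').
  rewrite setDE; apply: compact_closedI; first exact: ck.2.
  exact: open_closedC.
have [|rho [crho rho01 rho1 rho0]] := @compact_separator R G lcG hG _ U cK oU.
  by move=> x [_ /UU'].
have cr : continuous (fun x => (rho x)%:C%C : R[i]) by exact: ccontR.
have cr' : continuous (fun x => (1 - rho x)%:C%C : R[i]).
  by apply: ccontR => x; apply: cvgB; [exact: cvg_cst|exact: crho].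
have ck1 := CcM hG ck cr; have ck2 := CcM hG ck cr'.
(* Each piece is clipped by [e]: the clipped function is dominated by [H], and the remainder, of
   modulus at most [e] on the support of [k], costs [a * e]. *)
have main (r : G -> R) (H : G -> \bar R) (w : R) :
    Cc (fun x => k x * (r x)%:C%C) -> (forall x, 0 <= r x <= 1) ->
    (forall x, (0 <= H x)%E) -> (variation mu H <= w%:E)%E ->
    (forall x, r x != 0 -> k x != 0 -> ((cmod (k x) - e)%:E < H x)%E) ->
    cmod (mu (fun x => k x * (r x)%:C%C)) <= w + a * e.
  move=> cj r01 H0 Hw kH; have [j [Cj je j0 jm]] := Cc_clip cj e0.
  have -> : mu (fun x => k x * (r x)%:C%C) =
      mu j + mu (fun x => k x * (r x)%:C%C - j x) by rewrite radonB// addrC subrK.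
  apply: le_trans (cmodD _ _) _; apply: lerD.
    apply: variation_le Hw Cj _ => x.
    have [kr0|kr0] := eqVneq (k x * (r x)%:C%C) 0.
      by rewrite j0// cmod0.
    move: kr0; rewrite mulf_eq0 negb_or => /andP[k0 r0].
    have {}r0 : r x != 0 by apply: contraNN r0 => /eqP ->.
    apply: (@le_trans _ _ (Num.max 0 (cmod (k x) - e))%:E); last first.
      rewrite EFin_max ge_max H0 /=; apply: ltW; exact: kH.
    rewrite lee_fin (le_trans (jm x))// ge_max le_max lexx /= le_max lerD2r.
    by rewrite cmodM cmodR ger0_norm ?ler_piMr ?cmod_ge0 ?orbT//; case/andP: (r01 x).
  apply: Ha; [exact: (CcB hG cj Cj)| |by move=> x _; exact: je|exact: ltW].
  by move=> x nx; rewrite (Cc0 nx) mul0r sub0r j0 ?oppr0// (Cc0 nx) mul0r.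
have -> : mu k = mu (fun x => k x * (rho x)%:C%C) + mu (fun x => k x * (1 - rho x)%:C%C).
  rewrite -radonD//; congr mu; apply/funext => x.
  by rewrite -mulrDr -rmorphD /= addrC subrK mulr1.
apply: le_trans (cmodD _ _) _.
have -> : v + v' + 2 * a * e = (v + a * e) + (v' + a * e) by ring.
apply: lerD; [apply: (main _ h)|apply: (main _ h')] => //.
- by move=> x r0 _; apply: contrapT => nU; move: r0; rewrite rho0 ?eqxx.
- by move=> x; have := rho01 x; lra.
- move=> x r0 k0; apply: contrapT => nU'.
  move: r0; rewrite rho1 ?subrr ?eqxx//; split=> //.
  exact: subset_closure.
Qed.

(** Half of a sum is at most the maximum, so the previous bound applies to [k / 2]; this is the
    origin of the factor 2. *)
Lemma radon_split k (h h' : G -> \bar R) (v v' : R) : Cc k ->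
  lower_semicontinuous h -> lower_semicontinuous h' ->
  (forall x, (0 <= h x)%E) -> (forall x, (0 <= h' x)%E) ->
  (forall x, ((cmod (k x))%:E <= h x + h' x)%E) ->
  (variation mu h <= v%:E)%E -> (variation mu h' <= v'%:E)%E ->
  cmod (mu k) <= 2 * v + 2 * v'.
Proof.
move=> ck lh lh' h0 h0' kh hv hv'.
have /= := @radon_split_max (fun x => (2^-1)%:C%C * k x) h h' v v' (CcZ hG _ ck) lh lh' h0 h0'.
rewrite radonZ// cmodM cmodR ger0_norm ?invr_ge0//.
move=> /(_ _ hv hv'); suff H : forall x,
  ((cmod ((2^-1)%:C%C * k x))%:E <= maxe (h x) (h' x))%E by move=> /(_ H); lra.
move=> x; rewrite cmodM cmodR ger0_norm ?invr_ge0//.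
have := kh x; have := h0 x; have := h0' x.
case: (h x) => [b| |]; case: (h' x) => [b'| |] //=; rewrite ?maxye ?maxey ?leey//.
rewrite -EFin_max !lee_fin le_max; case: (leP b b'); lra.
Qed.

End RadonFunctional.

(** * Restrictions of measures through continuous cutoffs *)

Section Cutoff.
Context {R : realType} {G : topologicalZmodType}.
Hypotheses (hG : hausdorff_space G) (lcG : locally_compact [set: G]).

(* [u] is a continuous minorant of the indicator of [A] with
   [|mu|(1_A - u) <= d]. *)
Record cutoff (mu : (G -> R[i]) -> R[i]) (A : set G) (u : G -> R) (d : R) : Prop := {
  cutoff_Cc : Cc (fun x => (u x)%:C%C : R[i]) ;
  cutoff_ge0 : forall x, 0 <= u x ;
  cutoff_le : forall x, u x <= \1_A x ;
  cutoff_variation : (variation mu (fun x => (\1_A x - u x)%:E) <= d%:E)%E }.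

Section FixedMeasure.
Variable mu : (G -> R[i]) -> R[i].
Hypothesis mu_radon : complex_radon_measure mu.
Implicit Types (f g k phi : G -> R[i]) (u : G -> R).

Lemma indic_le1 (A : set G) (x : G) : (\1_A x : R) <= 1.
Proof. by rewrite indicE; case: (x \in A). Qed.

Lemma indic_notin (A : set G) (x : G) : ~ A x -> (\1_A x : R) = 0.
Proof. by move=> nA; rewrite indicE memNset. Qed.

Lemma cutoff_notin A u d x : cutoff mu A u d -> ~ A x -> u x = 0.
Proof.
move=> cu nA; apply/eqP; rewrite eq_le (cutoff_ge0 cu) andbT.
by rewrite (le_trans (cutoff_le cu x))// indic_notin.
Qed.

Lemma cutoff_le1 A u d x : cutoff mu A u d -> u x <= 1.
Proof. by move=> cu; rewrite (le_trans (cutoff_le cu x))// indic_le1. Qed.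

Lemma cutoff_Ccmul A u d phi : cutoff mu A u d -> continuous phi ->
  Cc (fun x => (u x)%:C%C * phi x).
Proof. by move=> cu cp; exact: (CcM hG (cutoff_Cc cu) cp). Qed.

(* Aligning the phases of [g0] and [g], a near-maximiser [g0] of [|mu g|] over
   [|g| <= 1_A] leaves at most [d] for functions bounded by [1_A - |g0|]. *)
Lemma cutoff_exists (A : set G) (d : R) : precompact A -> 0 < d ->
  exists u, cutoff mu A u d.
Proof.
rewrite precompactE => cA d0.
have [a a0 Ha] := radon_bound hG mu_radon cA.
have bnd g : Cc g -> (forall x, cmod (g x) <= \1_A x) -> cmod (mu g) <= a.
  move=> cg gA; rewrite -[a]mulr1; apply: Ha => // x.
    move=> nx; apply: cmod_eq0; apply/eqP; rewrite eq_le cmod_ge0 andbT.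
    rewrite (le_trans (gA x))// indic_notin// => Ax; apply: nx.
    exact: subset_closure.
  by move=> _; rewrite (le_trans (gA x))// indic_le1.
pose S := [set cmod (mu g) | g in [set g | Cc g /\ forall x, cmod (g x) <= \1_A x]].
have hS : has_sup S.
  split; last by exists a => _ [g [cg gA] <-]; exact: bnd.
  exists (cmod (mu (fun=> 0))), (fun=> 0) => //; split; first exact: Cc_cst0.
  by move=> x; rewrite cmod0 indicE.
have [_ [g0 [cg0 g0A] <-] sg0] := sup_adherent d0 hS.
exists (fun x => cmod (g0 x)); split.
- split; first by apply: ccontR; apply: cont_cmod; exact: cg0.1.
  have := cg0.2; rewrite /supp; congr (compact (closure _)).
  apply/seteqP; split=> x /=.
    by apply: contra => /eqP; rewrite -(rmorph0 (real_complex R)) => /complexI/cmod_eq0/eqP.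
  by apply: contra => /eqP ->; rewrite cmod0.
- by move=> x; exact: cmod_ge0.
- exact: g0A.
- apply: ge_ereal_sup => _ [g [cg gA] <-]; rewrite lee_fin.
  have [c [c1 Hc]] := phase_align (mu g0) (mu g).
  have H : cmod (mu g0 + c * mu g) <= sup S.
    apply: ub_le_sup; first exact: hS.2.
    exists (fun x => c * g x + g0 x); last first.
      by rewrite (cradon_linear mu_radon)// addrC.
    split; first exact: (Cc_lin hG c cg cg0).
    move=> x; apply: le_trans (cmodD _ _) _; rewrite cmodM c1 mul1r.
    by have := gA x; rewrite lee_fin; lra.
  by move: H; rewrite Hc; move: sg0; lra.
Qed.

(** The indicator of an open set is lower semicontinuous. This makes the difference an admissible
    majorant in [upper_integral]. *)
Lemma lsc_scale_cutoff A u d (M : R) : open A -> cutoff mu A u d -> 0 < M ->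
  lower_semicontinuous (fun x => (M * (\1_A x - u x))%:E).
Proof.
move=> oA cu M0; apply/lower_semicontinuousP => a.
have cMu : continuous (fun x => M * u x).
  move=> x; apply: cvgM; first exact: cvg_cst.
  exact: (cont_Re (cutoff_Cc cu).1).
have -> : [set x | (a%:E < (M * (\1_A x - u x))%:E)%E] =
    (A `&` [set x | M * u x < M - a]) `|` [set x | M * u x < - a].
  apply/seteqP; split=> x /=; rewrite lte_fin mulrBr.
    rewrite indicE; case: (boolP (x \in A)) => [/set_mem Ax|_]; last first.
      by rewrite mulr0 => H; right; lra.
    by rewrite mulr1 => H; left; split=> //; lra.
  case=> [[Ax H]|H].
    by rewrite indicE mem_set// mulr1; lra.
  have : 0 <= M * (\1_A x : R) by rewrite mulr_ge0 ?(ltW M0)// indicE.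
  lra.
apply: openU; first apply: openI => //.
  exact: (open_comp (fun x _ => cMu x) (@open_lt R (M - a))).
exact: (open_comp (fun x _ => cMu x) (@open_lt R (- a))).
Qed.

Lemma variation_scale_cutoff A u d (M : R) : cutoff mu A u d -> 0 < M ->
  (variation mu (fun x => (M * (\1_A x - u x))%:E) <= (M * d)%:E)%E.
Proof.
move=> cu M0; apply: ge_ereal_sup => _ [g [cg gA] <-]; rewrite lee_fin.
have /= := variation_le (cutoff_variation cu) (CcZ hG (M^-1)%:C%C cg).
rewrite (radonZ hG mu_radon)// cmodM cmodR ger0_norm ?invr_ge0 ?(ltW M0)//.
rewrite ler_pdivrMl//; apply => x.
rewrite cmodM cmodR ger0_norm ?invr_ge0 ?(ltW M0)// lee_fin ler_pdivrMl//.
by have := gA x; rewrite lee_fin.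
Qed.

Lemma cutoff_scale_ge0 A u d (M : R) x : cutoff mu A u d -> 0 < M ->
  (0 <= (M * (\1_A x - u x))%:E)%E.
Proof.
move=> cu M0; rewrite lee_fin mulr_ge0 ?(ltW M0)// subr_ge0.
exact: cutoff_le cu x.
Qed.

Definition is_rintegral f (c : R[i]) := forall e : R, 0 < e -> exists g, [/\ Cc g,
    (upper_integral mu (fun x => (cmod (f x - g x))%:E) < e%:E)%E &
    cmod (mu g - c) < e].

(** Two approximants [g] and [g'] of [f] satisfy [|g - g'| <= h + h'], where [h] and [h'] majorise
    their errors and have small variation; [radon_split] then brings [mu g] and [mu g'] together.
    Uniqueness makes the choice hidden in [rintegral] harmless. *)
Lemma is_rintegral_unique f c c' : is_rintegral f c -> is_rintegral f c' -> c = c'.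
Proof.
move=> H H'; apply/eqP; rewrite -subr_eq0; apply/eqP/cmod_eq0/eqP.
(* The difference of the approximants contributes [4 * e], their distances to [c] and [c']
   contribute [e] each. *)
rewrite eq_le cmod_ge0 andbT; apply: (@ge0_epsilon_le _ _ _ 6) => e e0.
have [g [cg /ereal_inf_lt[_ [h [lh fh] <-] he] ge]] := H e e0.
have [g' [cg' /ereal_inf_lt[_ [h' [lh' fh'] <-] he'] ge']] := H' e e0.
have : cmod (mu (fun x => g x - g' x)) <= 2 * e + 2 * e.
  have h0 x : (0 <= h x)%E by apply: le_trans (fh x); rewrite lee_fin cmod_ge0.
  have h0' x : (0 <= h' x)%E by apply: le_trans (fh' x); rewrite lee_fin cmod_ge0.
  apply: (radon_split hG lcG mu_radon (CcB hG cg cg') lh lh' h0 h0' _ (ltW he) (ltW he')).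
  move=> x; apply: le_trans (leeD (fh x) (fh' x)).
  rewrite -EFinD lee_fin; have := cmodB (f x - g' x) (f x - g x).
  have -> : f x - g' x - (f x - g x) = g x - g' x by ring.
  lra.
rewrite (radonB hG mu_radon)// add0r => H1.
have -> : c - c' = (mu g - mu g') - (mu g - c) + (mu g' - c') by ring.
apply: le_trans (cmodD _ _) _; have := cmodB (mu g - mu g') (mu g - c); lra.
Qed.

Lemma rintegralE f c : is_rintegral f c -> rintegral mu f = c.
Proof.
move=> fc; apply: (@is_rintegral_unique f) => //.
by rewrite /rintegral; case: xgetP => [//|/(_ c)]; apply: contra_notP.
Qed.

Lemma cutoff_indic A u d phi (M : R) x : cutoff mu A u d -> 0 < M ->
  (forall x, A x -> cmod (phi x) <= M) ->
  cmod (\1_A x * phi x - (u x)%:C%C * phi x) <= M * (\1_A x - u x).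
Proof.
move=> cu M0 phiM; have -> : (\1_A x : R[i]) = (\1_A x)%:C%C.
  by rewrite !indicE; case: (x \in A); rewrite ?rmorph1 ?rmorph0.
rewrite -mulrBl -rmorphB cmodM cmodR ger0_norm ?subr_ge0 ?(cutoff_le cu)//.
rewrite mulrC; have [Ax|nAx] := pselect (A x).
  by rewrite ler_wpM2r ?phiM// subr_ge0 (cutoff_le cu).
by rewrite (cutoff_notin cu nAx) indic_notin// subrr !mulr0.
Qed.

Lemma cutoff_dist A u u' d d' phi (M : R) : open A -> cutoff mu A u d ->
  cutoff mu A u' d' -> 0 < M -> continuous phi ->
  (forall x, A x -> cmod (phi x) <= M) ->
  cmod (mu (fun x => (u x)%:C%C * phi x) - mu (fun x => (u' x)%:C%C * phi x))
    <= 2 * (M * d) + 2 * (M * d').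
Proof.
move=> oA cu cu' M0 cphi phiM.
have c1 := cutoff_Ccmul cu cphi; have c2 := cutoff_Ccmul cu' cphi.
rewrite -(radonB hG mu_radon)//.
apply: (radon_split hG lcG mu_radon (CcB hG c1 c2)
  (lsc_scale_cutoff oA cu M0) (lsc_scale_cutoff oA cu' M0) _ _ _
  (variation_scale_cutoff cu M0) (variation_scale_cutoff cu' M0)).
- by move=> x; exact: (cutoff_scale_ge0 x cu M0).
- by move=> x; exact: (cutoff_scale_ge0 x cu' M0).
move=> x; rewrite -EFinD lee_fin.
have := cutoff_indic x cu M0 phiM; have := cutoff_indic x cu' M0 phiM.
set p := \1_A x * phi x => H1 H2.
have := cmodD ((u x)%:C%C * phi x - p) (p - (u' x)%:C%C * phi x).
by rewrite addrA subrK (cmodC _ p); lra.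
Qed.

(** Cutoffs [v n] of defect [1/(n+1)] give values [z n] with a limit [c], and the same cutoffs
    witness that [c] is the integral of [\1_A * phi]. Comparing [u] with [v n] and letting [n] grow
    leaves only the error of [u]. It suffices that [phi] is bounded on [A]. *)
Lemma restriction_cutoff A u d phi (M : R) : open A -> precompact A ->
  cutoff mu A u d -> 0 < M -> continuous phi ->
  (forall x, A x -> cmod (phi x) <= M) ->
  cmod (restriction mu A phi - mu (fun x => (u x)%:C%C * phi x)) <= 2 * M * d.
Proof.
move=> oA pA cu M0 cphi phiM.
have /(_ _)/cid-/all_sig[v vP] : forall n, exists v, cutoff mu A v n.+1%:R^-1.
  by move=> n; exact: cutoff_exists.
pose z n := mu (fun x => (v n x)%:C%C * phi x).
have [|c Hc] := @capprox_limit R z (fun n => 2 * (M * n.+1%:R^-1)).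
  by move=> n m; exact: (cutoff_dist oA (vP m) (vP n) M0 cphi phiM).
have arch (e : R) : 0 < e -> exists n, 2 * (2 * (M * n.+1%:R^-1)) < e.
  move=> e0; have e1 : 0 < e / (4 * M) by rewrite divr_gt0// mulr_gt0.
  have [n _ Hn] := near_infty_natSinv_lt (PosNum e1).
  exists n; have := Hn n (leqnn n); rewrite /= ltr_pdivlMr ?mulr_gt0//.
  by move: (n.+1%:R^-1) => a; congr (_ < _); ring.
have -> : restriction mu A phi = c.
  apply: rintegralE => e e0; have [n ne] := arch e e0.
  have n0 : (0 : R) < n.+1%:R^-1 by rewrite invr_gt0.
  exists (fun x => (v n x)%:C%C * phi x); split.
  - exact: cutoff_Ccmul (vP n) cphi.
  - apply: (@le_lt_trans _ _ (M * n.+1%:R^-1)%:E); last first.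
      by rewrite lte_fin; move: (mulr_gt0 M0 n0) ne; move: (M * _) => q; lra.
    apply: le_trans (variation_scale_cutoff (vP n) M0).
    apply: ereal_inf_lbound; eexists; last reflexivity.
    split; first exact: (lsc_scale_cutoff oA (vP n) M0).
    by move=> x; rewrite lee_fin; exact: cutoff_indic.
  - by rewrite cmodC; apply: le_lt_trans (Hc n) _.
apply: (@ge0_epsilon_le _ _ _ 2) => e e0; have [n ne] := arch e e0.
have := cutoff_dist oA (vP n) cu M0 cphi phiM.
have := cmodD (c - z n) (z n - mu (fun x => (u x)%:C%C * phi x)).
rewrite addrA subrK; have := Hc n; rewrite -/(z n).
have : 0 <= M * n.+1%:R^-1 by rewrite mulr_ge0 ?(ltW M0)// invr_ge0.
by move: ne; move: (M * n.+1%:R^-1) => q; lra.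
Qed.

End FixedMeasure.

Lemma tilde_radon (mu : (G -> R[i]) -> R[i]) : complex_radon_measure mu ->
  complex_radon_measure (tilde_measure mu).
Proof.
move=> rmu; split=> [a f g cf cg|K cK].
  rewrite /tilde_measure.
  have -> : tilde (fun x => a * f x + g x) = fun x => conjc a * tilde f x + tilde g x.
    by apply/funext => x; rewrite /tilde rmorphD rmorphM.
  rewrite (cradon_linear rmu)//; [|exact: Cc_tilde..].
  by rewrite rmorphD rmorphM /= conjcK.
have [a a0 Ha] := radon_bound hG rmu (compact_opp cK).
exists a => f M cf fK fM.
have M0 : 0 <= M by apply: le_trans (fM 0); exact: cmod_ge0.
rewrite /tilde_measure cmodJ; apply: Ha => //.
- exact: Cc_tilde.
- move=> x nx; rewrite /tilde (@Cc0 _ _ f) ?rmorph0// => sx; apply: nx.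
  by exists (- x); [exact: fK|rewrite opprK].
- by move=> x _; rewrite /tilde cmodJ.
Qed.

Lemma cutoff_tilde (mu : (G -> R[i]) -> R[i]) A u d : complex_radon_measure mu -> cutoff mu A u d ->
  cutoff (tilde_measure mu) (oppset A) (fun x => u (- x)) d.
Proof.
move=> rmu cu.
have opE x : (\1_(oppset A) x : R) = \1_A (- x).
  rewrite !indicE; congr (nat_of_bool _)%:R; apply/idP/idP => /set_mem.
    by case=> y Ay <-; rewrite opprK mem_set.
  by move=> Ax; apply/mem_set; exists (- x); rewrite ?opprK.
split=> [|x|x|].
- have := Cc_subl hG 0 (cutoff_Cc cu).
  by under eq_fun do rewrite sub0r.
- exact: (cutoff_ge0 cu).
- by rewrite opE; exact: (cutoff_le cu).
- apply: ge_ereal_sup => _ [g [cg gA] <-]; rewrite lee_fin /tilde_measure cmodJ.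
  apply: variation_le (cutoff_variation cu) (Cc_tilde hG cg) _ => x.
  by have := gA (- x); rewrite opE opprK /tilde cmodJ.
Qed.

End Cutoff.

(** * Riemann sums and Haar measure *)

Section BorelMeasures.
Context {R : realType} {T : ptopologicalType}.

Lemma borel_open (U : set T) : open U -> measurable (U : set (borel T)).
Proof. by move=> oU; apply: sub_sigma_algebra. Qed.

Lemma borel_closed (U : set T) : closed U -> measurable (U : set (borel T)).
Proof.
move=> cU; rewrite -(setCK U); apply: measurableC; apply: borel_open.
exact: closed_openC.
Qed.

Lemma borel_compact (K : set T) : hausdorff_space T -> compact K ->
  measurable (K : set (borel T)).
Proof. by move=> hT cK; apply: borel_closed; exact: compact_closed. Qed.

Lemma borel_set1 (x : T) : hausdorff_space T -> measurable ([set x] : set (borel T)).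
Proof. by move=> hT; apply: borel_compact => //; exact: compact_set1. Qed.

Lemma borel_finite (F : set T) : hausdorff_space T -> finite_set F ->
  measurable (F : set (borel T)).
Proof.
move=> hT finF; have -> : F = \bigcup_(x in F) [set x].
  by apply/seteqP; split=> [x Fx|x [y Fy ->]//]; exists x.
by apply: fin_bigcup_measurable => // x _; exact: borel_set1.
Qed.

Lemma measure_finite (nu : {measure set (borel T) -> \bar R}) (F : set T) :
  hausdorff_space T -> finite_set F -> (\sum_(x \in F) nu [set x] = nu F)%E.
Proof.
move=> hT finF; have F1 : \bigcup_(x in F) [set x] = F.
  by apply/seteqP; split=> [x [y Fy ->]//|x Fx]; exists x.
rewrite -[in RHS]F1 measure_fin_bigcup//; last by move=> x _; exact: borel_set1.
by move=> x y _ _ [z [-> ->]].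
Qed.

Lemma cont_measurable (D : set (borel T)) (f : T -> R) : continuous f ->
  measurable_fun D (f : borel T -> R).
Proof.
move=> cf mD; apply: (measurability _ (RGenOInfty.measurableE R)) => //.
move=> /= _ [_ [a ->] <-]; apply: measurableI => //; apply: borel_open.
by apply: open_comp => [x _|]; [exact: cf|exact: interval_open].
Qed.

End BorelMeasures.

Lemma van_hove_boundary_measurable (G : topologicalZmodType) (K B : set G) :
  measurable (van_hove_boundary K B : set (borel G)).
Proof.
by apply: measurableU; apply: measurableI; apply: borel_closed; exact: closed_closure.
Qed.

Section BoundedIntegrals.
Context d {R : realType} {X : measurableType d} {nu : {measure set X -> \bar R}}.
Implicit Types (B D : set X) (f g : X -> R).

Lemma bounded_integrable B f (M : R) : measurable B -> (nu B < +oo)%E ->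
  measurable_fun B f -> (forall x, B x -> `|f x| <= M) ->
  nu.-integrable B (EFin \o f).
Proof.
move=> mB nB mf fM; apply: measurable_bounded_integrable => //.
exists M; split; first exact: num_real.
by move=> N MN x Bx /=; rewrite (le_trans (fM x Bx))// ltW.
Qed.

Lemma bounded_Rintegral B f (M : R) : measurable B -> (nu B < +oo)%E ->
  measurable_fun B f -> (forall x, B x -> `|f x| <= M) ->
  `|\int[nu]_(x in B) f x| <= M * fine (nu B).
Proof.
move=> mB nB mf fM; have intf := bounded_integrable mB nB mf fM.
apply: le_trans (le_normr_Rintegral mB intf) _.
rewrite -Rintegral_cst//; apply: le_Rintegral => //.
  apply: (@bounded_integrable _ _ M) => //; first exact: measurableT_comp.
  by move=> x Bx; rewrite normr_id fM.
by apply: (@bounded_integrable _ _ `|M|) => //; exact: measurable_cst.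
Qed.

Lemma Rintegral_dist B f g (M e : R) : measurable B -> (nu B < +oo)%E ->
  measurable_fun B f -> measurable_fun B g ->
  (forall x, B x -> `|f x| <= M) -> (forall x, B x -> `|g x| <= M) ->
  (forall x, B x -> `|f x - g x| <= e) ->
  `|\int[nu]_(x in B) f x - \int[nu]_(x in B) g x| <= e * fine (nu B).
Proof.
move=> mB nB mf mg fM gM fg.
rewrite -RintegralB//; [|exact: bounded_integrable fM|exact: bounded_integrable gM].
by apply: bounded_Rintegral => //; exact: measurable_funB.
Qed.

Lemma Rintegral_support B f : (forall x, ~ B x -> f x = 0) ->
  \int[nu]_(x in setT) f x = \int[nu]_(x in B) f x.
Proof.
move=> fB; rewrite [RHS]Rintegral_mkcond; apply: eq_Rintegral => x _.
by rewrite patchE; case: ifPn => // /negP; rewrite inE => /fB.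
Qed.

Lemma Rintegral_sum_seq B (I : eqType) (s : seq I) (F : I -> X -> R) : measurable B ->
  (forall i, i \in s -> nu.-integrable B (EFin \o F i)) ->
  nu.-integrable B (EFin \o fun x => \sum_(i <- s) F i x) /\
  \int[nu]_(x in B) (\sum_(i <- s) F i x) = \sum_(i <- s) \int[nu]_(x in B) F i x.
Proof.
move=> mB; elim: s => [_|i s IH iF].
  have -> : (fun x => \sum_(i <- [::]) F i x) = fun=> 0.
    by apply/funext => x; rewrite big_nil.
  split; first exact: integrable0.
  by rewrite Rintegral_cst// mul0r big_nil.
have [IH1 IH2] : nu.-integrable B (EFin \o fun x => \sum_(i <- s) F i x) /\
  \int[nu]_(x in B) (\sum_(i <- s) F i x) = \sum_(i <- s) \int[nu]_(x in B) F i x.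
  by apply: IH => j js; apply: iF; rewrite inE js orbT.
have iFi : nu.-integrable B (EFin \o F i) by apply: iF; rewrite inE eqxx.
have -> : (fun x => \sum_(j <- i :: s) F j x) = fun x => F i x + \sum_(j <- s) F j x.
  by apply/funext => x; rewrite big_cons.
split; last by rewrite RintegralD// IH2 big_cons.
exact: integrableD iFi IH1.
Qed.

End BoundedIntegrals.

Section RiemannSums.
Context {R : realType} {G : topologicalZmodType}.
Variable theta : {measure set (borel G) -> \bar R}.

(* The nodes [p.2] and weights [p.1] come from a partition of [B] into finitely
   many Borel sets that are small of order [W]. *)
Lemma riemann_sum (W : set G) (B K : set G) : nbhs (0 : G) W ->
  measurable (B : set (borel G)) -> (theta B < +oo)%E -> compact K -> B `<=` K ->
  exists s : seq (R * G), [/\ forall p, p \in s -> 0 <= p.1 /\ B p.2,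
    \sum_(p <- s) p.1 = fine (theta B) &
    forall (f : G -> R) (M e : R), measurable_fun (B : set (borel G)) f ->
      (forall x, B x -> `|f x| <= M) ->
      (forall x t, B x -> B t -> W (x - t) -> `|f x - f t| <= e) ->
      `|\int[theta]_(x in B) f x - \sum_(p <- s) p.1 * f p.2| <= e * fine (theta B)].
Proof.
move=> nW mB tB cK BK; have [V [oV V0 VW]] := near_split nW.
have nV : nbhs (0 : G) V by exact: open_nbhs_nbhs.
have [ts tsK] := compact_shift_cover cK nV.
have {tsK} : forall x, B x -> exists2 t, t \in ts & V (x - t).
  by move=> x /BK /tsK.
(* Each step cuts the cell of [B] inside [t + V] off; two points of a cell differ by an element of
   [W] because [V - V] lies in [W]. *)
elim: ts B mB tB {K cK BK} => [|t ts IH] B mB tB Bts.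
  have -> : B = set0 by apply/seteqP; split=> // x /Bts[].
  exists [::]; split=> //; first by rewrite big_nil measure0.
  move=> f M e _ _ _.
  by rewrite big_nil Rintegral_set0 subrr normr0 measure0 mulr0.
pose C := [set x | V (x - t)].
have oC : open C.
  have -> : C = [set x | V (- t + x)] by apply/seteqP; split=> x; rewrite /C /= addrC.
  exact: open_addl.
have mC : measurable (C : set (borel G)) by exact: borel_open.
have mBC : measurable (B `&` C : set (borel G)) by exact: measurableI.
have mBD : measurable (B `\` C : set (borel G)) by exact: measurableD.
have tBC : (theta (B `&` C) < +oo)%E.
  by apply: le_lt_trans tB; apply: le_measure => //; rewrite ?inE.
have tBD : (theta (B `\` C) < +oo)%E.
  by apply: le_lt_trans tB; apply: le_measure => //; rewrite ?inE//; exact: subDsetl.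
have [|s [s0 sB Hs]] := IH (B `\` C) mBD tBD.
  move=> x [Bx nCx]; have [u] := Bts x Bx.
  by rewrite inE => /orP[/eqP ->//|us Vu]; exists u.
have BE : B = (B `&` C) `|` (B `\` C) by rewrite setUIDK.
have disj : [disjoint B `&` C & B `\` C].
  by apply/disj_setPS => x [[_ ?] [_ ?]].
have tE : fine (theta B) = fine (theta (B `&` C)) + fine (theta (B `\` C)).
  rewrite {1}BE measureU// ?fineD ?ge0_fin_numE//.
  exact/disj_set2P.
(* An empty cell offers no node; it is skipped, and [B] is unchanged. *)
have [[b [Bb Cb]]|/nonemptyPn BC0] := pselect ((B `&` C) !=set0); last first.
  have BD : B `\` C = B by rewrite BE BC0 set0U setDDl setUid.
  by rewrite BD in s0 sB Hs; exists s.
exists ((fine (theta (B `&` C)), b) :: s); split.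
- move=> p; rewrite inE => /orP[/eqP ->|/s0[p0 [Bp _]]] //=.
- by rewrite big_cons sB tE.
- move=> f M e mf fM fe; rewrite big_cons /= tE mulrDr.
  have intf := bounded_integrable mB tB mf fM.
  have -> : \int[theta]_(x in B) f x =
      \int[theta]_(x in B `&` C) f x + \int[theta]_(x in B `\` C) f x.
    by rewrite {1}BE Rintegral_setU// -BE.
  rewrite opprD addrACA (le_trans (ler_normD _ _))//; apply: lerD; last first.
    apply: (Hs f M) => //.
    + by apply: measurable_funS mf => //; exact: subDsetl.
    + by move=> x [/fM].
    + by move=> x u [Bx _] [Bu _]; exact: fe.
  rewrite [X in _ - X]mulrC -Rintegral_cst//.
  apply: (@Rintegral_dist _ _ _ _ _ _ _ M) => //.
  + by apply: measurable_funS mf => //; exact: subIsetl.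
  + by move=> x [/fM].
  + by move=> x _; exact: fM.
  + move=> x [Bx Cx]; apply: fe => //.
    by have := VW _ _ Cx Cb; rewrite opprB addrA subrK.
Qed.

End RiemannSums.

(** * Exchanging integrals through Riemann sums *)

Section Swap.
Context {R : realType} {G : topologicalZmodType}.
Variable theta : {measure set (borel G) -> \bar R}.
Context d {X : measurableType d} {nu : {measure set X -> \bar R}}.
Variables (B K : set G) (C : set X) (H : G -> X -> R) (M : R).
Hypotheses (mB : measurable (B : set (borel G))) (tB : (theta B < +oo)%E)
  (cK : compact K) (BK : B `<=` K) (mC : measurable C) (nC : (nu C < +oo)%E)
  (HM : forall t x, B t -> C x -> `|H t x| <= M)
  (mH1 : forall t, B t -> measurable_fun C (H t))
  (mH2 : forall x, C x -> measurable_fun (B : set (borel G)) (H ^~ x))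
  (Hunif : forall e : R, 0 < e -> exists2 W : set G, nbhs (0 : G) W &
    forall t t' x, B t -> B t' -> W (t - t') -> C x -> `|H t x - H t' x| <= e).

(** The nodes depend only on [B] and on the common modulus of uniformity. One family therefore
    serves all sections [H ^~ x] at once, and also a function [h] that inherits the modulus by
    integration over [C]. *)
Let riemann (e : R) : 0 < e -> exists s : seq (R * G),
  [/\ forall p, p \in s -> 0 <= p.1 /\ B p.2, \sum_(p <- s) p.1 = fine (theta B),
    forall x, C x -> `|\int[theta]_(t in B) H t x - \sum_(p <- s) p.1 * H p.2 x|
      <= e * fine (theta B) &
    forall h : G -> R, measurable_fun (B : set (borel G)) h ->
      (exists N, forall t, B t -> `|h t| <= N) ->
      (forall t t', B t -> B t' -> (forall x, C x -> `|H t x - H t' x| <= e) ->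
        `|h t - h t'| <= e * fine (nu C)) ->
      `|\int[theta]_(t in B) h t - \sum_(p <- s) p.1 * h p.2|
        <= e * fine (nu C) * fine (theta B)].
Proof.
move=> e0; have [W nW HW] := Hunif e0.
have [s [s0 sB Hs]] := riemann_sum nW mB tB cK BK.
exists s; split=> // [x Cx|h mh [N hN] hh].
  apply: (Hs _ M) => //; first exact: mH2.
    by move=> t Bt; exact: HM.
  by move=> t t' Bt Bt' Wt; exact: HW.
apply: (Hs _ N) => // t t' Bt Bt' Wt; apply: hh => // x Cx.
exact: HW.
Qed.

Let sum_int (s : seq (R * G)) : (forall p, p \in s -> 0 <= p.1 /\ B p.2) ->
  nu.-integrable C (EFin \o fun x => \sum_(p <- s) p.1 * H p.2 x) /\
  \int[nu]_(x in C) (\sum_(p <- s) p.1 * H p.2 x) =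
    \sum_(p <- s) p.1 * \int[nu]_(x in C) H p.2 x.
Proof.
move=> s0.
have iH p : p \in s -> nu.-integrable C (EFin \o H p.2).
  move=> /s0[_ Bp]; apply: (bounded_integrable mC nC (mH1 Bp)) => x Cx.
  exact: HM.
have [|h1 ->] := @Rintegral_sum_seq _ _ _ nu C _ s (fun p x => p.1 * H p.2 x) mC.
  by move=> p ps; exact: (integrableZl mC p.1 (iH p ps)).
split=> //; rewrite big_seq [RHS]big_seq; apply: eq_bigr => p ps.
by rewrite RintegralZl//; exact: iH.
Qed.

(** The inner integral is a pointwise limit of Riemann sums whose nodes do not depend on [x], that
    is, of finite combinations of the measurable functions [H t]. *)
Lemma swap_measurable : measurable_fun C (fun x => \int[theta]_(t in B) H t x).
Proof.
have H0 (n : nat) : 0 < n.+1%:R^-1 :> R by rewrite invr_gt0.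
have /(_ _)/cid-/all_sig[s Hs] := fun n => riemann (H0 n).
apply: (@measurable_fun_cvg _ _ _ _ (fun n x => \sum_(p <- s n) p.1 * H p.2 x)).
  move=> n; have [s0 _ _ _] := Hs n.
  by have [/measurable_int/measurable_EFinP] := sum_int s0.
move=> x Cx; apply/cvgrPdist_lt => e e0.
have e1 : 0 < e / (fine (theta B) + 1) by rewrite divr_gt0// ltr_wpDl// fine_ge0.
near=> n; have [_ _ + _] := Hs n => /(_ x Cx)/le_lt_trans; apply.
apply: (@le_lt_trans _ _ (n.+1%:R^-1 * (fine (theta B) + 1))).
  by rewrite ler_wpM2l ?invr_ge0// lerDl.
rewrite -ltr_pdivlMr ?ltr_wpDl ?fine_ge0//.
by near: n; exact: (near_infty_natSinv_lt (PosNum e1)).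
Unshelve. all: by end_near. Qed.

(* Riemann sums over [B] replace Fubini's theorem: [H] need not be measurable for
   the product of the two Borel sigma-algebras. *)
Lemma swap_integrals :
  measurable_fun (B : set (borel G)) (fun t => \int[nu]_(x in C) H t x) ->
  \int[nu]_(x in C) \int[theta]_(t in B) H t x =
  \int[theta]_(t in B) \int[nu]_(x in C) H t x.
Proof.
move=> mh; apply/eqP; rewrite -subr_eq0 -normr_le0.
apply: (@ge0_epsilon_le _ _ _ (2 * fine (theta B) * fine (nu C))) => e e0.
have [s [s0 sB s1 s2]] := riemann e0; have [sI sE] := sum_int s0.
have hM t : B t -> `|\int[nu]_(x in C) H t x| <= M * fine (nu C).
  by move=> Bt; apply: bounded_Rintegral => // [|x Cx]; [exact: mH1|exact: HM].
have := s2 _ mh (ex_intro _ _ hM) _; rewrite -sE => /(_ _)/wrap[|b2].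
  move=> t t' Bt Bt' HH; apply: (@Rintegral_dist _ _ _ _ _ _ _ M) => //.
  - exact: mH1.
  - exact: mH1.
  - by move=> x; exact: HM.
  - by move=> x; exact: HM.
have b1 : `|\int[nu]_(x in C) \int[theta]_(t in B) H t x -
    \int[nu]_(x in C) (\sum_(p <- s) p.1 * H p.2 x)| <= e * fine (theta B) * fine (nu C).
  apply: (@Rintegral_dist _ _ _ _ _ _ _ (M * fine (theta B))) => //.
  - exact: swap_measurable.
  - by have /measurable_int/measurable_EFinP := sI.
  - by move=> x Cx; apply: bounded_Rintegral => // [|t Bt]; [exact: mH2|exact: HM].
  - move=> x Cx; rewrite -sB mulr_sumr (le_trans (ler_norm_sum _ _ _))//.
    rewrite big_seq [leRHS]big_seq; apply: ler_sum => p /s0[p0 Bp].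
    by rewrite normrM ger0_norm// mulrC ler_wpM2r// HM.
move: b1 b2; set u := \int[nu]_(x in C) _; set v := \int[nu]_(x in C) _.
set w := \int[theta]_(t in B) _ => b1 b2.
have -> : u - w = (u - v) - (w - v) by ring.
rewrite (le_trans (ler_normB _ _))// add0r.
by rewrite (le_trans (lerD b1 b2))//; lra.
Qed.

End Swap.

Section Bump.
Context {R : realType} {G : topologicalZmodType}.
Hypotheses (hG : hausdorff_space G) (lcG : locally_compact [set: G]).

Lemma bump (x : G) (V : set G) : nbhs x V -> exists f : G -> R, [/\
  Cc (fun x => (f x)%:C%C : R[i]), forall y, 0 <= f y <= 1, f x = 1 &
  forall y, ~ V y -> f y = 0].
Proof.
move=> nV; have [K nK cK] := compact_nbhs lcG x.
have [||f [cf f01 f1 f0]] := @compact_separator R G lcG hG _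
    (interior (V `&` K)) (@compact_set1 _ x) _.
- exact: open_interior.
- by move=> _ ->; exact: filterI.
exists f; split=> // [||y nVy]; last by apply: f0 => /interior_subset[].
  apply: (CcI hG (ccontR cf) cK) => y nKy.
  by rewrite f0 ?rmorph0// => /interior_subset[].
exact: f1.
Qed.

End Bump.

Section Haar.
Context {R : realType} {G : topologicalZmodType}.
Hypotheses (hG : hausdorff_space G) (lcG : locally_compact [set: G])
  (scG : sigma_compact G).
Variable theta : {measure set (borel G) -> \bar R}.
Hypothesis theta_haar : haar_measure theta.
Implicit Types (f g : G -> R) (B K : set G).

Lemma haar_compact K : compact K -> (theta K < +oo)%E.
Proof. exact: (radon_compact (haar_radon theta_haar)). Qed.

Lemma haar_precompact B : measurable (B : set (borel G)) -> precompact B ->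
  (theta B < +oo)%E.
Proof.
move=> mB; rewrite precompactE => cB; apply: le_lt_trans (haar_compact cB).
apply: le_measure; rewrite ?inE//; last exact: subset_closure.
by apply: borel_closed; exact: closed_closure.
Qed.

Lemma shift_measurable (t : G) :
  measurable_fun setT ((fun x => t + x) : borel G -> borel G).
Proof.
apply: (@measurability _ _ (borel G) (borel G) setT _ (@open G)) => //.
by move=> _ [U oU <-]; rewrite setTI; apply: borel_open; exact: open_addl.
Qed.

Lemma haar_preimage (t : G) B : measurable (B : set (borel G)) ->
  theta [set x | B (t + x)] = theta B.
Proof.
move=> mB; rewrite -(haar_invariant theta_haar (- t) mB); congr (theta _).
apply/seteqP; split=> x /= => [Bx|[y By <-]]; last by rewrite addrA subrr add0r.
by exists (t + x) => //; rewrite addKr.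
Qed.

Lemma haar_shift_integral (t : G) f : measurable_fun setT (f : borel G -> R) ->
  theta.-integrable setT (EFin \o (fun x => f (t + x))) ->
  \int[theta]_(x in setT) f (t + x) = \int[theta]_(x in setT) f x.
Proof.
move=> mf intf; congr fine.
have mEf : measurable_fun setT (EFin \o f : borel G -> \bar R) by apply/measurable_EFinP.
have := @integral_pushforward _ _ _ _ R _ (shift_measurable t) theta setT (EFin \o f) mEf.
rewrite preimage_setT => <- //.
apply: eq_measure_integral; first exact: shift_measurable.
move=> ? A mA _ /=; by rewrite /pushforward -[RHS](haar_preimage t mA).
Qed.

(** Finitely many translates of [U] cover any compact set. If [U] were null, all compact sets would
    be null, hence by sigma-compactness the whole group. *)
Lemma haar_open_gt0 (U : set G) : open U -> U !=set0 -> (0 < theta U)%E.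
Proof.
move=> oU [x0 Ux0]; rewrite lt0e measure_ge0 andbT; apply/negP => /eqP U0.
have shift0 t : theta [set x | U (x0 + (x - t))] = 0%E.
  rewrite -U0 -[RHS](haar_preimage (x0 - t) (borel_open oU)).
  by congr (theta _); apply/seteqP; split=> x /=; rewrite addrAC addrA.
have nU : nbhs (0 : G) [set w | U (x0 + w)].
  by apply/near_addE; exact: open_nbhs_nbhs.
have mS t : measurable ([set x | U (x0 + (x - t))] : set (borel G)).
  apply: borel_open; have := open_addl (x0 - t) oU.
  by congr (open _); apply/seteqP; split=> x /=; rewrite addrAC addrA.
have K0 K : compact K -> theta K = 0%E.
  move=> cK; have [ts tsK] := compact_shift_cover cK nU.
  have : K `<=` \big[setU/set0]_(t <- ts) [set x | U (x0 + (x - t))].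
    move=> x /tsK[t tts Ux]; rewrite -bigcup_seq; exists t => //=.
  move=> KS; apply/eqP; rewrite eq_le measure_ge0 andbT.
  have mU : measurable (\big[setU/set0]_(t <- ts) [set x | U (x0 + (x - t))] : set (borel G)).
    exact: bigsetU_measurable.
  apply: (@le_trans _ _ (theta (\big[setU/set0]_(t <- ts) [set x | U (x0 + (x - t))]))).
    by apply: le_measure => //; rewrite inE//; exact: borel_compact.
  elim: ts {tsK KS mU} => [|t ts IH]; first by rewrite big_nil measure0.
  have mS' : measurable (\big[setU/set0]_(t <- ts) [set x | U (x0 + (x - t))] : set (borel G)).
    exact: bigsetU_measurable.
  rewrite big_cons (le_trans (measureU2 theta (mS t) mS'))//.
  have h0 : (theta [set x | U (x0 + (x - t))%R] <= 0)%E by rewrite shift0.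
  by have := leeD h0 IH; rewrite adde0.
have [Ks cKs KsT] := scG; have := haar_nonzero theta_haar; rewrite -KsT => /eqP; apply.
apply/negligibleP; first by apply: bigcupT_measurable => n; exact: borel_compact.
apply: negligible_bigcup => n; apply/negligibleP; first exact: borel_compact.
exact: K0.
Qed.

Lemma Ccr_integrable f K : continuous f -> compact K -> (forall x, ~ K x -> f x = 0) ->
  theta.-integrable setT (EFin \o f).
Proof.
move=> cf cK fK; have mK := borel_compact hG cK.
have [M M0 fM] := compact_bounded (ccontR cf) cK.
have : theta.-integrable K (EFin \o f).
  apply: (@bounded_integrable _ _ _ _ _ _ M) => //; first exact: haar_compact.
    exact: cont_measurable.
  by move=> x Kx; rewrite -cmodR fM.
move=> /(integrable_mkcond _ mK); congr (_.-integrable _ _).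
apply/funext => x; rewrite patchE; case: ifPn => //= /negP.
by rewrite inE => /fK ->.
Qed.

End Haar.

Section HaarInversion.
Context {R : realType} {G : topologicalZmodType}.
Hypotheses (hG : hausdorff_space G) (lcG : locally_compact [set: G])
  (scG : sigma_compact G).
Variable theta : {measure set (borel G) -> \bar R}.
Hypothesis theta_haar : haar_measure theta.
Implicit Types (f g : G -> R) (B K : set G).

Definition Ccr f := Cc (fun x => (f x)%:C%C : R[i]).

Lemma Ccr_cont f : Ccr f -> continuous f.
Proof. by move=> cf; exact: (cont_Re cf.1). Qed.

Lemma Ccr0 f x : Ccr f -> ~ supp (fun x => (f x)%:C%C : R[i]) x -> f x = 0.
Proof. by move=> cf /(@Cc0 R G (fun x => (f x)%:C%C)) /(congr1 (@complex.Re R)). Qed.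

Lemma Ccr_int f : Ccr f -> theta.-integrable setT (EFin \o f).
Proof.
move=> cf; apply: (Ccr_integrable hG theta_haar (Ccr_cont cf) cf.2) => x.
exact: Ccr0.
Qed.

Lemma CcrI f K : continuous f -> compact K -> (forall x, ~ K x -> f x = 0) -> Ccr f.
Proof.
move=> cf cK fK; apply: (CcI hG (ccontR cf) cK) => x nK.
by rewrite fK.
Qed.

Lemma Ccr_Re (h : G -> R[i]) : Cc h -> Ccr (fun x => complex.Re (h x)).
Proof.
by move=> ch; apply: (CcrI (cont_Re ch.1) ch.2) => x /Cc0 ->.
Qed.

Lemma Ccr_Im (h : G -> R[i]) : Cc h -> Ccr (fun x => complex.Im (h x)).
Proof.
by move=> ch; apply: (CcrI (cont_Im ch.1) ch.2) => x /Cc0 ->.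
Qed.

Lemma Ccr_unif f (e : R) : Ccr f -> 0 < e ->
  \forall w \near (0 : G), forall x, `|f (x + w) - f x| < e.
Proof.
move=> cf e0; apply: filterS (Cc_unif cf e0) => w H x.
by have := H x; rewrite -rmorphB cmodR.
Qed.

Lemma Ccr_bounded f : Ccr f -> exists2 M : R, 0 <= M & forall x, `|f x| <= M.
Proof.
move=> cf; have [M M0 H] := Cc_bounded cf.
by exists M => // x; have := H x; rewrite cmodR.
Qed.

Lemma Ccr_addl f x : Ccr f -> Ccr (fun y => f (x + y)).
Proof. by move=> cf; exact: (Cc_addl hG x cf). Qed.

Lemma Ccr_subl f x : Ccr f -> Ccr (fun y => f (x - y)).
Proof. by move=> cf; exact: (Cc_subl hG x cf). Qed.

Lemma haar_shift f t : Ccr f ->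
  \int[theta]_(x in setT) f (t + x) = \int[theta]_(x in setT) f x.
Proof.
move=> cf; apply: (haar_shift_integral theta_haar).
  by apply: cont_measurable; exact: Ccr_cont.
exact: (Ccr_int (Ccr_addl t cf)).
Qed.

Lemma haar_swap (F : G -> G -> R) (K L : set G) (M : R) : compact K -> compact L ->
  (forall x y, ~ K x -> F x y = 0) -> (forall x y, ~ L y -> F x y = 0) ->
  (forall x y, `|F x y| <= M) -> (forall x, continuous (F x)) ->
  (forall e : R, 0 < e ->
    \forall w \near (0 : G), forall x y, `|F (x + w) y - F x y| < e) ->
  \int[theta]_(y in setT) \int[theta]_(x in setT) F x y =
  \int[theta]_(x in setT) \int[theta]_(y in setT) F x y.
Proof.
move=> cK cL FK FL FM cF Funif.
have cF' y : continuous (F ^~ y).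
  move=> x; apply/cvgrPdist_lt => e e0; apply/near_addE.
  by apply: filterS (Funif e e0) => w /(_ x y); rewrite distrC.
have mK := borel_compact hG cK; have mL := borel_compact hG cL.
have tK := haar_compact theta_haar cK; have tL := haar_compact theta_haar cL.
under eq_Rintegral => y _ do rewrite (@Rintegral_support _ R (borel G) theta K _ (fun x => FK x y)).
under [RHS]eq_Rintegral => x _ do rewrite (@Rintegral_support _ R (borel G) theta L _ (FL x)).
rewrite (@Rintegral_support _ R (borel G) theta L); last first.
  move=> y nL; under eq_Rintegral do rewrite FL//.
  by rewrite Rintegral_cst// mul0r.
rewrite [RHS](@Rintegral_support _ R (borel G) theta K); last first.
  move=> x nK; under eq_Rintegral do rewrite FK//.
  by rewrite Rintegral_cst// mul0r.
apply: (@swap_integrals R G theta _ (borel G) theta K K L F M) => //.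
- by move=> x Kx; exact: cont_measurable.
- by move=> y Ly; exact: cont_measurable.
- move=> e e0; exists [set w | forall x y, `|F (x + w) y - F x y| < e].
    exact: Funif.
  move=> t t' x _ _ /= H _; have := H t' x; rewrite (addrC t') subrK => /ltW; exact.
- apply: cont_measurable => x; apply/cvgrPdist_lt => e e0; apply/near_addE.
  have e1 : 0 < e / (fine (theta L) + 1) by rewrite divr_gt0// ltr_wpDl// fine_ge0.
  apply: filterS (Funif _ e1) => w H.
  apply: (@le_lt_trans _ _ (e / (fine (theta L) + 1) * fine (theta L))).
    apply: (@Rintegral_dist _ _ _ _ _ _ _ M) => //.
    + exact: cont_measurable.
    + exact: cont_measurable.
    + by move=> y _; rewrite distrC ltW.
  rewrite mulrAC -[ltRHS]mulr1 -mulrA ltr_pM2l// ltr_pdivrMr ?ltr_wpDl ?fine_ge0//.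
  by rewrite mul1r ltrDl.
Qed.

Lemma haar_pos_fun : exists2 f, Ccr f & 0 < \int[theta]_(x in setT) f x.
Proof.
have [f [cf f01 f1 _]] := @bump R G hG lcG 0 setT (@filterT _ _ _).
exists f => //; have cf' := Ccr_cont cf.
have [U [oU U0 UU]] : exists U : set G, [/\ open U, U !=set0 &
    forall x, U x -> 2^-1 <= f x].
  exists (f @^-1` [set y | 2^-1 < y]); split.
  - by apply: open_comp => [x _|]; [exact: cf'|exact: open_gt].
  - by exists 0; rewrite /= f1 invf_lt1// ltr1n.
  - by move=> x /= /ltW.
have mU := borel_open oU.
rewrite fine_gt0//; apply/andP; split; last first.
  by exact: (integrable_lty measurableT (Ccr_int cf)).
apply: (@lt_le_trans _ _ (\int[theta]_(x in U) (2^-1)%:E)%E).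
  rewrite integral_cst// mule_gt0// ?lte_fin ?invr_gt0//.
  exact: (haar_open_gt0 hG scG theta_haar).
apply: (@le_trans _ _ (\int[theta]_(x in U) (f x)%:E)%E).
  apply: ge0_le_integral => //.
  by apply/measurable_EFinP; exact: cont_measurable.
apply: ge0_subset_integral => //.
  by apply/measurable_EFinP; exact: cont_measurable.
by move=> x _; rewrite lee_fin; case/andP: (f01 x).
Qed.

(* With [I] the Haar integral and [f'(x) = f(- x)], integrating
   [f x * g (x - y)] first over [y] gives [I f * I g'], and after [x -> x + y] it
   gives [I f * I g]. *)
Lemma haar_inversion g : Ccr g ->
  \int[theta]_(x in setT) g (- x) = \int[theta]_(x in setT) g x.
Proof.
move=> cg; have [f cf If] := haar_pos_fun.
pose Sf := supp (fun x => (f x)%:C%C : R[i]); pose Sg := supp (fun x => (g x)%:C%C : R[i]).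
pose L := sumset Sf (oppset Sg).
have cL : compact L by apply: compact_sumset; [exact: cf.2|apply: compact_opp; exact: cg.2].
have [Mf Mf0 fM] := Ccr_bounded cf; have [Mg Mg0 gM] := Ccr_bounded cg.
have fgM a b : `|f a * g b| <= Mf * Mg by rewrite normrM ler_pM.
have cgo : Ccr (fun x => g (- x)).
  by have := Ccr_subl 0 cg; under eq_fun do rewrite sub0r.
have fg_unif (e : R) : 0 < e -> \forall w \near (0 : G), forall a b a' b',
    (a' = a + w) -> (b' = b + w) -> `|f a' * g b' - f a * g b| < e.
  move=> e0; have M1 : 0 < Mf + Mg + 1 by lra.
  have e1 : 0 < e / (Mf + Mg + 1) by rewrite divr_gt0.
  apply: filterS2 (Ccr_unif cf e1) (Ccr_unif cg e1) => w H1 H2 a b _ _ -> ->.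
  have -> : f (a + w) * g (b + w) - f a * g b =
     f (a + w) * (g (b + w) - g b) + (f (a + w) - f a) * g b by ring.
  apply: (@le_lt_trans _ _ ((Mf + Mg) * (e / (Mf + Mg + 1)))).
    rewrite (le_trans (ler_normD _ _))// !normrM mulrDl [X in _ + X]mulrC.
    by apply: lerD; apply: ler_pM => //; exact: ltW.
  rewrite mulrCA -[ltRHS]mulr1 ltr_pM2l// ltr_pdivrMr// mul1r; lra.
have e1 : \int[theta]_(y in setT) \int[theta]_(x in setT) (f x * g (x - y)) =
    (\int[theta]_(x in setT) f x) * \int[theta]_(x in setT) g (- x).
  rewrite (@haar_swap (fun x y => f x * g (x - y)) Sf L (Mf * Mg)) //.
  - transitivity (\int[theta]_(x in setT) (f x * \int[theta]_(z in setT) g (- z))).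
      apply: eq_Rintegral => x _; rewrite RintegralZl//; last first.
        exact: (Ccr_int (Ccr_subl x cg)).
      congr (_ * _); rewrite -(haar_shift (- x) cgo); apply: eq_Rintegral => y _.
      by rewrite opprD opprK.
    by rewrite RintegralZr//; exact: Ccr_int.
  - exact: cf.2.
  - by move=> x y /(Ccr0 cf) ->; rewrite mul0r.
  - move=> x y nL; have [sf|/(Ccr0 cf) ->] := pselect (Sf x); last by rewrite mul0r.
    rewrite (Ccr0 cg) ?mulr0// => sg; apply: nL; exists x => //.
    by exists (- (x - y)); [exists (x - y)|rewrite opprB addrC subrK].
  - move=> x y; apply: cvgM; first exact: cvg_cst.
    exact: (Ccr_cont (Ccr_subl x cg)).
  - move=> e e0; apply: filterS (fg_unif e e0) => w H x y.
    by apply: H => //; rewrite addrAC.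
have e2 : \int[theta]_(y in setT) \int[theta]_(x in setT) (f (x + y) * g x) =
    (\int[theta]_(x in setT) f x) * \int[theta]_(x in setT) g x.
  rewrite (@haar_swap (fun x y => f (x + y) * g x) Sg L (Mf * Mg)) //.
  - transitivity (\int[theta]_(x in setT) ((\int[theta]_(z in setT) f z) * g x)).
      apply: eq_Rintegral => x _; rewrite RintegralZr ?haar_shift//.
      exact: (Ccr_int (Ccr_addl x cf)).
    by rewrite RintegralZl//; exact: Ccr_int.
  - exact: cg.2.
  - by move=> x y /(Ccr0 cg) ->; rewrite mulr0.
  - move=> x y nL; have [sg|/(Ccr0 cg) ->] := pselect (Sg x); last by rewrite mulr0.
    rewrite (Ccr0 cf) ?mul0r// => sf; apply: nL; exists (x + y) => //.
    by exists (- x); [exists x|rewrite addrAC subrr add0r].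
  - move=> x y; apply: cvgM; last exact: cvg_cst.
    exact: (Ccr_cont (Ccr_addl x cf)).
  - move=> e e0; apply: filterS (fg_unif e e0) => w H x y.
    by apply: H => //; rewrite addrAC.
apply: (mulfI (lt0r_neq0 If)); rewrite -e1 -e2; apply: eq_Rintegral => y _.
have cfg : Ccr (fun x => f x * g (x - y)).
  have := CcM hG cf (Cc_subr hG y cg).1.
  by under eq_fun do rewrite -rmorphM.
by rewrite -(haar_shift y cfg); apply: eq_Rintegral => x _; rewrite addrC addrK.
Qed.

End HaarInversion.

(** * Translation bounded measures *)

Section TranslationBounded.
Context {R : realType} {G : topologicalZmodType}.
Hypotheses (hG : hausdorff_space G) (lcG : locally_compact [set: G]).
Variable mu : (G -> R[i]) -> R[i].
Hypotheses (mu_radon : complex_radon_measure mu) (mu_bounded : translation_bounded mu).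

Lemma variation_set_le (V : set G) (b M : R) g : (variation_set mu V < b%:E)%E -> 0 < M ->
  Cc g -> (forall x, ~ V x -> g x = 0) -> (forall x, cmod (g x) <= M) ->
  cmod (mu g) <= M * b.
Proof.
move=> Vb M0 cg gV gM; rewrite -[X in X <= _]mul1r -(divff (lt0r_neq0 M0)) -mulrA.
rewrite ler_wpM2l ?(ltW M0)//.
have [_ [h [_ Vh] <-] hb] := ereal_inf_lt Vb.
have := variation_le (ltW hb) (CcZ hG (M^-1)%:C%C cg).
rewrite (radonZ hG mu_radon)// cmodM cmodR ger0_norm ?invr_ge0 ?(ltW M0)//; apply => x.
apply: le_trans (Vh x); rewrite lee_fin cmodM cmodR ger0_norm ?invr_ge0 ?(ltW M0)//.
rewrite ler_pdivrMl//; have [Vx|nVx] := pselect (V x).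
  by rewrite indicE mem_set// mulr1.
by rewrite gV// cmod0 mulr_ge0 ?(ltW M0)// indicE.
Qed.

(* A partition of unity on the support of [psi], subordinate to translates of
   the set [V] of the definition, is itself translated along with [psi]. *)
Lemma translates_bounded (psi : G -> R[i]) : Cc psi -> exists2 C : R, 0 < C &
  forall w (r : G -> R[i]), continuous r -> (forall s, cmod (r s) <= 1) ->
    cmod (mu (fun s => r s * psi (s - w))) <= C.
Proof.
move=> cpsi; have [V [oV [v Vv] pV supV]] := mu_bounded.
have [b b0 Vb] : exists2 b : R, 0 < b &
    forall t, (variation_set mu [set (t + x)%R | x in V] < b%:E)%E.
  move: supV; set S := ereal_sup _ => Sfin.
  have SV t : (variation_set mu [set (t + x)%R | x in V] <= S)%E.
    by apply: ereal_sup_ubound; exists t.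
  exists (Num.max 0 (fine S) + 1); first by rewrite ltr_wpDl// le_max lexx.
  move=> t; apply: le_lt_trans (SV t) _.
  move: Sfin; case: S {SV} => [s _|//|_]; last exact: ltNyr.
  by rewrite /= lte_fin ltr_pwDr// le_max lexx orbT.
have [f [cf f01 f1 f0]] := @bump R G hG lcG v V (open_nbhs_nbhs (conj oV Vv)).
have cf' := Ccr_cont cf.
(* Doubling and truncating makes [g] equal to 1 on a whole neighbourhood of 0, not just at 0. *)
pose g x := Num.min 1 (2 * f (v + x)).
have g01 x : 0 <= g x <= 1.
  rewrite /g ge_min lexx /= andbT le_min ler01 /= mulr_ge0//.
  by case/andP: (f01 (v + x)).
have cg : continuous g.
  move=> x; apply: (@continuous_min _ _ (fun=> 1) (fun x => 2 * f (v + x)) x).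
    exact: cvg_cst.
  apply: cvgM; first exact: cvg_cst.
  by apply: continuous_comp; [exact: cont_addl|exact: cf'].
have nW : nbhs (0 : G) [set x | g x = 1].
  have h : \forall x \near (0 : G), 2^-1 < f (v + x).
    apply/(near_addE v (fun y => 2^-1 < f y)); apply: (cvgr_gt (f v) (cf' v)).
    by rewrite f1 invf_lt1// ltr1n.
  apply: filterS h => x fx; rewrite /= /g; apply/min_idPl.
  by rewrite -ler_pdivrMl// mulr1 ltW.
have [ts Hts] := compact_shift_cover cpsi.2 nW.
have [M0 M00 psiM0] := Cc_bounded cpsi; pose M := M0 + 1.
have Mp : 0 < M by rewrite ltr_wpDl.
have psiM x : cmod (psi x) <= M by rewrite (le_trans (psiM0 x))// lerDl.
(* One term [M * b] per shift in [ts]; the successor keeps the constant positive when [ts] is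
   empty. *)
exists (M * b * (size ts).+1%:R) => [|w r cr r1].
  by rewrite !mulr_gt0.
(* The statement is generalised for the induction on [ts]: multiplying by [1 - g] removes the points
   handled by one shift and keeps the bound [M]. *)
suff H (k : G -> R[i]) : Cc k -> (forall s, cmod (k s) <= M) ->
    (forall s, k s != 0 -> exists2 t, t \in ts & g (s - w - t) = 1) ->
    cmod (mu k) <= M * b * (size ts)%:R.
  have Ck := CcM hG (Cc_subr hG w cpsi) cr.
  have -> : (fun s => r s * psi (s - w)) = fun s => psi (s - w) * r s.
    by apply/funext => s; rewrite mulrC.
  apply: le_trans (H _ Ck _ _) _.
  - by move=> s; rewrite cmodM -[leRHS]mulr1 ler_pM ?cmod_ge0.
  - move=> s ks; apply: Hts; apply: contrapT => /Cc0 p0.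
    by move: ks; rewrite p0 mul0r eqxx.
  - by rewrite ler_wpM2l ?mulr_ge0 ?ler_nat// ltW.
move: {Hts} ts k; elim=> [|t ts IH] k Ck kM kt.
  have -> : k = fun=> 0.
    by apply/funext => s; apply/eqP; apply: contrapT => /negP /kt[].
  by rewrite (radon0 hG mu_radon) cmod0 mulr0.
have cgt : continuous (fun s => (g (s - w - t))%:C%C : R[i]).
  apply: ccontR => s; have -> : (fun s => g (s - w - t)) = g \o (fun s => s + (- w - t)).
    by apply/funext => x; rewrite /= addrA.
  by apply: continuous_comp; [exact: cont_addr|exact: cg].
have cgt' : continuous (fun s => 1 - (g (s - w - t))%:C%C : R[i]).
  exact: (ccontB (@ccont_cst R G 1) cgt).
have C1 := CcM hG Ck cgt; have C2 := CcM hG Ck cgt'.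
have -> : mu k = mu (fun s => k s * (g (s - w - t))%:C%C) +
    mu (fun s => k s * (1 - (g (s - w - t))%:C%C)).
  rewrite -(radonD mu_radon C1 C2); congr mu; apply/funext => s.
  by rewrite -mulrDr addrC subrK mulr1.
rewrite [leRHS](_ : _ = M * b + M * b * (size ts)%:R); last first.
  by rewrite -[(size (t :: ts))%:R]natr1 /=; ring.
apply: le_trans (cmodD _ _) _; apply: lerD.
  (* If [g (s - w - t)] is nonzero then [v + (s - w - t)] is in [V], that is, [s] is in the
     translate of [V] by [w + t - v]. *)
  apply: (variation_set_le (Vb (w + t - v)) Mp C1) => s.
    move=> nV; have -> : g (s - w - t) = 0; last by rewrite rmorph0 mulr0.
    rewrite /g f0 ?mulr0; first by apply/min_idPr.
    move=> Vs; apply: nV; exists (v + (s - w - t)) => //.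
    by rewrite addrA subrK -[s - w - t]addrA -opprD addrC subrK.
  rewrite cmodM -[leRHS]mulr1 ler_pM ?cmod_ge0// cmodR.
  by have := g01 (s - w - t) => /andP[? ?]; rewrite ger0_norm.
apply: (IH _ C2) => s.
  rewrite cmodM -[leRHS]mulr1 ler_pM ?cmod_ge0// -(rmorph1 (real_complex R)) -rmorphB cmodR.
  by have := g01 (s - w - t) => /andP[? ?]; rewrite ger0_norm; lra.
rewrite mulf_eq0 negb_or => /andP[/kt[u]]; rewrite inE => /orP[/eqP ->|uts gu _].
  by move=> ->; rewrite rmorph1 subrr eqxx.
by exists u.
Qed.

End TranslationBounded.

(** * Complex Haar integrals and autoconvolutions *)

Section ComplexIntegral.
Context {R : realType} {G : topologicalZmodType}.
Hypotheses (hG : hausdorff_space G) (lcG : locally_compact [set: G])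
  (scG : sigma_compact G).
Variable theta : {measure set (borel G) -> \bar R}.
Hypothesis theta_haar : haar_measure theta.
Implicit Types (f g : G -> R[i]) (B K : set G).

Lemma cintD f g : Cc f -> Cc g ->
  cintegral theta (fun x => f x + g x) = cintegral theta f + cintegral theta g.
Proof.
move=> cf cg; rewrite /cintegral.
under eq_Rintegral do rewrite raddfD /=.
under [X in Complex _ X]eq_Rintegral do rewrite raddfD /=.
rewrite !RintegralD//.
- exact: (Ccr_int hG theta_haar (Ccr_Im hG cf)).
- exact: (Ccr_int hG theta_haar (Ccr_Im hG cg)).
- exact: (Ccr_int hG theta_haar (Ccr_Re hG cf)).
- exact: (Ccr_int hG theta_haar (Ccr_Re hG cg)).
Qed.

Lemma cintZ (a : R[i]) f : Cc f ->
  cintegral theta (fun x => a * f x) = a * cintegral theta f.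
Proof.
move=> cf; have iR := Ccr_int hG theta_haar (Ccr_Re hG cf).
have iI := Ccr_int hG theta_haar (Ccr_Im hG cf).
have iZ (r : R) (h : G -> R) : theta.-integrable setT (EFin \o h) ->
  theta.-integrable setT (EFin \o (fun x => r * h x)).
  by move=> ih; exact: (integrableZl measurableT r ih).
case: a => a b; rewrite /cintegral.
have -> : (fun x => complex.Re (Complex a b * f x)) =
    fun x => a * complex.Re (f x) - b * complex.Im (f x).
  by apply/funext => x; case: (f x).
have -> : (fun x => complex.Im (Complex a b * f x)) =
    fun x => a * complex.Im (f x) + b * complex.Re (f x).
  by apply/funext => x; case: (f x).
rewrite RintegralB//; [|exact: iZ|exact: iZ].
rewrite RintegralD//; [|exact: iZ|exact: iZ].
by rewrite !RintegralZl.
Qed.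

Lemma cintB f g : Cc f -> Cc g ->
  cintegral theta (fun x => f x - g x) = cintegral theta f - cintegral theta g.
Proof.
move=> cf cg; have := cintD cf (CcZ hG (-1) cg); rewrite cintZ// mulN1r => <-.
by congr cintegral; apply/funext => x; rewrite mulN1r.
Qed.

Lemma cint_shift f t : Cc f ->
  cintegral theta (fun x => f (t + x)) = cintegral theta f.
Proof.
move=> cf; rewrite /cintegral.
rewrite (haar_shift hG theta_haar t (Ccr_Re hG cf)).
by rewrite (haar_shift hG theta_haar t (Ccr_Im hG cf)).
Qed.

Lemma cint_inversion f : Cc f ->
  cintegral theta (fun x => f (- x)) = cintegral theta f.
Proof.
move=> cf; rewrite /cintegral.
rewrite (haar_inversion hG lcG scG theta_haar (Ccr_Re hG cf)).
by rewrite (haar_inversion hG lcG scG theta_haar (Ccr_Im hG cf)).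
Qed.

(** The factor 2 comes from estimating the real and imaginary parts separately. *)
Lemma cint_bound f K (M : R) : Cc f -> compact K -> (forall x, ~ K x -> f x = 0) ->
  (forall x, K x -> cmod (f x) <= M) ->
  cmod (cintegral theta f) <= 2 * M * fine (theta K).
Proof.
move=> cf cK fK fM; have mK := borel_compact hG cK.
have tK := haar_compact theta_haar cK.
rewrite /cintegral (@Rintegral_support _ R (borel G) theta K); last first.
  by move=> x /fK ->.
rewrite (@Rintegral_support _ R (borel G) theta K (fun t => complex.Im (f t))); last first.
  by move=> x /fK ->.
apply: le_trans (cmod_le_ReIm _) _ => /=.
rewrite -mulrA mulr_natl mulr2n; apply: lerD; apply: bounded_Rintegral => //.
- by apply: cont_measurable; exact: cont_Re cf.1.
- by move=> x Kx; rewrite (le_trans (Re_le_cmod _))// fM.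
- by apply: cont_measurable; exact: cont_Im cf.1.
- by move=> x Kx; rewrite (le_trans (Im_le_cmod _))// fM.
Qed.

Definition riemann_nodes (W B : set G) (s : seq (R * G)) :=
  [/\ forall p, p \in s -> 0 <= p.1 /\ B p.2,
    \sum_(p <- s) p.1 = fine (theta B) &
    forall (f : G -> R) (M e : R), measurable_fun (B : set (borel G)) f ->
      (forall x, B x -> `|f x| <= M) ->
      (forall x t, B x -> B t -> W (x - t) -> `|f x - f t| <= e) ->
      `|\int[theta]_(x in B) f x - \sum_(p <- s) p.1 * f p.2| <= e * fine (theta B)].

Lemma compact_nodes W K : nbhs (0 : G) W -> compact K ->
  exists s, riemann_nodes W K s.
Proof.
move=> nW cK.
exact: (riemann_sum nW (borel_compact hG cK) (haar_compact theta_haar cK) cK).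
Qed.

Lemma cint_riemann W K s f (e : R) : riemann_nodes W K s -> Cc f -> compact K ->
  (forall x, ~ K x -> f x = 0) ->
  (forall x t, K x -> K t -> W (x - t) -> cmod (f x - f t) <= e) ->
  cmod (cintegral theta f - \sum_(p <- s) (p.1)%:C%C * f p.2) <= 2 * e * fine (theta K).
Proof.
move=> [_ _ Hs] cf cK fK fe; have [M _ fM] := Cc_bounded cf.
rewrite /cintegral (@Rintegral_support _ R (borel G) theta K); last first.
  by move=> x /fK ->.
rewrite (@Rintegral_support _ R (borel G) theta K (fun t => complex.Im (f t))); last first.
  by move=> x /fK ->.
have ReE : complex.Re (\sum_(p <- s) (p.1)%:C%C * f p.2) =
    \sum_(p <- s) p.1 * complex.Re (f p.2).
  rewrite raddf_sum; apply: eq_bigr => p _.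
  by case: (f p.2) => u v /=; rewrite mul0r subr0.
have ImE : complex.Im (\sum_(p <- s) (p.1)%:C%C * f p.2) =
    \sum_(p <- s) p.1 * complex.Im (f p.2).
  rewrite raddf_sum; apply: eq_bigr => p _.
  by case: (f p.2) => u v /=; rewrite mul0r addr0.
apply: le_trans (cmod_le_ReIm _) _.
rewrite [X in `|X| + _]raddfB [X in _ + `|X|]raddfB /= ReE ImE.
rewrite -mulrA mulr_natl mulr2n; apply: lerD.
  apply: (Hs (fun x => complex.Re (f x)) M e).
  - by apply: cont_measurable; exact: cont_Re cf.1.
  - by move=> x _; rewrite (le_trans (Re_le_cmod _)).
  - by move=> x t Kx Kt Wt; rewrite -raddfB (le_trans (Re_le_cmod _))// fe.
apply: (Hs (fun x => complex.Im (f x)) M e).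
- by apply: cont_measurable; exact: cont_Im cf.1.
- by move=> x _; rewrite (le_trans (Im_le_cmod _)).
- by move=> x t Kx Kt Wt; rewrite -raddfB (le_trans (Im_le_cmod _))// fe.
Qed.

Lemma autoconvolutionE f x : convolution theta f (tilde f) x =
  cintegral theta (fun t => f t * conjc (f (t - x))).
Proof. by rewrite /convolution; congr cintegral; apply/funext => t; rewrite /tilde opprB. Qed.

(** The substitution [t = s - w], by translation and inversion invariance, separates the variables:
    for fixed [w] the integrand is a function of [s] times a function of [v]. *)
Lemma autoconvolution_shift f s v : Cc f ->
  convolution theta f (tilde f) (s - v) =
  cintegral theta (fun w => f (s - w) * conjc (f (v - w))).
Proof.
move=> cf; rewrite autoconvolutionE.
have ch : Cc (fun t => f t * conjc (f (t - (s - v)))).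
  exact: (CcM hG cf (ccontJ (Cc_subr hG (s - v) cf).1)).
rewrite -(cint_shift s ch) -(cint_inversion (Cc_addl hG s ch)).
congr cintegral; apply/funext => w; congr (_ * conjc (f _)).
by rewrite opprB addrC addrA subrK.
Qed.

Lemma Cc_autoconvolution f : Cc f -> Cc (convolution theta f (tilde f)).
Proof.
move=> cf; have [M M0 fM] := Cc_bounded cf.
have cK : compact (supp f) := cf.2.
have Cx x : Cc (fun t => f t * conjc (f (t - x))).
  exact: (CcM hG cf (ccontJ (Cc_subr hG x cf).1)).
apply: (@CcI _ _ hG _ (sumset (supp f) (oppset (supp f)))).
- apply/ccontP => x e e0; apply/near_addE.
  have A0 : 0 <= 2 * M * fine (theta (supp f)) by rewrite !mulr_ge0// fine_ge0.
  have e1 : 0 < e / (2 * M * fine (theta (supp f)) + 1) by rewrite divr_gt0// ltr_wpDl.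
  have := near_oppE (Cc_unif cf e1); apply: filterS => w H.
  rewrite !autoconvolutionE -cintB//.
  apply: (@le_lt_trans _ _ (2 * (M * (e / (2 * M * fine (theta (supp f)) + 1))) *
      fine (theta (supp f)))).
    apply: cint_bound => //; first exact: (CcB hG (Cx _) (Cx _)).
      by move=> t /Cc0 ->; rewrite !mul0r subrr.
    move=> t _; rewrite -mulrBr cmodM ler_pM ?cmod_ge0// -rmorphB cmodJ ltW//.
    by have := H (t - x); rewrite opprD addrA.
  set q := _ + 1; have -> : 2 * (M * (e / q)) * fine (theta (supp f)) =
    e * ((2 * M * fine (theta (supp f))) / q) by ring.
  rewrite -[ltRHS]mulr1 ltr_pM2l// ltr_pdivrMr ?ltr_wpDl// mul1r /q; lra.
- by apply: compact_sumset => //; exact: compact_opp.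
- move=> x nx; rewrite autoconvolutionE.
  have -> : (fun t => f t * conjc (f (t - x))) = fun=> 0.
    apply/funext => t; have [st|/Cc0 ->] := pselect (supp f t); last by rewrite mul0r.
    rewrite (@Cc0 _ _ f (t - x)) ?rmorph0 ?mulr0// => sx; apply: nx; exists t => //.
    by exists (- (t - x)); [exists (t - x)|rewrite opprB addrC subrK].
  by rewrite /cintegral /= !Rintegral_cst// !mul0r.
Qed.

End ComplexIntegral.

(** * The mean square of a convolution *)

Section WeightedFunctional.
Context {R : realType} {G : topologicalZmodType}.
Hypotheses (hG : hausdorff_space G) (lcG : locally_compact [set: G])
  (scG : sigma_compact G).
Variable theta : {measure set (borel G) -> \bar R}.
Hypothesis theta_haar : haar_measure theta.
Variable mu : (G -> R[i]) -> R[i].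
Hypothesis mu_radon : complex_radon_measure mu.
Variables (U : G -> R[i]) (K : set G).
Hypotheses (cU : Cc U) (U1 : forall x, cmod (U x) <= 1) (cK : compact K)
  (UK : forall x, ~ K x -> U x = 0).

(** The measure [U mu] has compact support, so that it acts on all continuous functions. *)
Let m f := mu (fun s => U s * f s).

Let cUf f : continuous f -> Cc (fun s => U s * f s).
Proof. by move=> cf; exact: (CcM hG cU cf). Qed.

Let mB f g : continuous f -> continuous g -> m (fun x => f x - g x) = m f - m g.
Proof.
move=> cf cg; rewrite /m -(radonB hG mu_radon (cUf cf) (cUf cg)).
by congr mu; apply/funext => x; rewrite mulrBr.
Qed.

Let m_sum (I : Type) (s : seq I) (c : I -> R[i]) (F : I -> G -> R[i]) :
  (forall i, continuous (F i)) ->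
  m (fun x => \sum_(i <- s) c i * F i x) = \sum_(i <- s) c i * m (F i).
Proof.
move=> cF; rewrite /m.
have -> : (fun x => U x * \sum_(i <- s) c i * F i x) =
    fun x => \sum_(i <- s) c i * (U x * F i x).
  by apply/funext => x; rewrite mulr_sumr; apply: eq_bigr => i _; rewrite mulrCA.
rewrite (radon_sum hG mu_radon); last by move=> i; exact: (CcZ hG (c i) (cUf (cF i))).
by apply: eq_bigr => i _; rewrite (radonZ hG mu_radon)//; exact: cUf.
Qed.

Let m_bound : exists2 a : R, 0 <= a & forall f (N : R), continuous f ->
  (forall x, K x -> cmod (f x) <= N) -> 0 <= N -> cmod (m f) <= a * N.
Proof.
have [a a0 Ha] := radon_bound hG mu_radon cK.
exists a => // f N cf fN N0; apply: (Ha _ _ (cUf cf) _ _ N0).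
  by move=> x /UK ->; rewrite mul0r.
by move=> x Kx; rewrite cmodM -[leRHS]mul1r ler_pM ?cmod_ge0// fN.
Qed.

Let cont_sum (I : Type) (s : seq I) (F : I -> G -> R[i]) :
  (forall i, continuous (F i)) -> continuous (fun x => \sum_(i <- s) F i x).
Proof.
move=> cF; elim: s => [|i s IH].
  have -> : (fun x => \sum_(i <- [::]) F i x) = fun=> 0.
    by apply/funext => x; rewrite big_nil.
  exact: ccont_cst.
have -> : (fun x => \sum_(j <- i :: s) F j x) = fun x => F i x + \sum_(j <- s) F j x.
  by apply/funext => x; rewrite big_cons.
exact: (ccontD (cF i) IH).
Qed.

Lemma weighted_cont (phi : G -> R[i]) : Cc phi ->
  continuous (fun s => m (fun v => phi (s - v))).
Proof.
move=> cphi; have [a a0 Ha] := m_bound.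
apply/ccontP => s e e0; apply/near_addE.
have e1 : 0 < e / (a + 1) by rewrite divr_gt0// ltr_wpDl.
apply: filterS (Cc_unif cphi e1) => w H.
rewrite -mB; [|exact: (Cc_subl hG (s + w) cphi).1|exact: (Cc_subl hG s cphi).1].
apply: (@le_lt_trans _ _ (a * (e / (a + 1)))).
  apply: (Ha) => [|x _|]; last exact: ltW.
    by apply: ccontB; [exact: (Cc_subl hG (s + w) cphi).1|exact: (Cc_subl hG s cphi).1].
  by rewrite ltW//; have := H (s - x); rewrite addrAC.
rewrite mulrCA -[ltRHS]mulr1 ltr_pM2l// ltr_pdivrMr ?ltr_wpDl// mul1r; lra.
Qed.

Lemma weighted_cont_sub (psi : G -> R[i]) : Cc psi ->
  continuous (fun w => m (fun s => psi (s - w))).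
Proof.
move=> cpsi; have cg : Cc (fun x => psi (- x)).
  by have := Cc_subl hG 0 cpsi; under eq_fun do rewrite sub0r.
have := weighted_cont cg.
have -> // : (fun s => m (fun v => psi (- (s - v)))) = fun w => m (fun s => psi (s - w)).
by apply/funext => w; congr m; apply/funext => s; rewrite opprB.
Qed.

Lemma weighted_Ccr (psi : G -> R[i]) : Cc psi ->
  Ccr (fun w => cmod (m (fun s => psi (s - w))) ^+ 2).
Proof.
move=> cpsi; apply: (@CcrI _ _ hG _ (sumset K (oppset (supp psi)))).
- move=> w; apply: cvgM; exact: (cont_cmod (weighted_cont_sub cpsi)).
- by apply: compact_sumset => //; apply: compact_opp; exact: cpsi.2.
- move=> w nw; rewrite /m.
  have -> : (fun s => U s * psi (s - w)) = fun=> 0.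
    apply/funext => s; have [Ks|/UK ->] := pselect (K s); last by rewrite mul0r.
    rewrite (@Cc0 _ _ psi (s - w)) ?mulr0// => ss; apply: nw; exists s => //.
    by exists (- (s - w)); [exists (s - w)|rewrite opprB addrC subrK].
  by rewrite (radon0 hG mu_radon) cmod0 expr0n.
Qed.

(** For the Riemann sum [Phie] of the autoconvolution the identity is algebra: a node [w]
    contributes its weight times [m(psi(. - w))] times the conjugate of that value. The errors of
    both passages to the limit are uniform, because [m] is bounded for the supremum norm on [K]. *)
Lemma weighted_fubini (psi : G -> R[i]) : Cc psi ->
  mu (fun s => U s * conjc (mu (fun v => U v *
    conjc (convolution theta psi (tilde psi) (s - v))))) =
  (\int[theta]_(w in setT) cmod (mu (fun s => U s * psi (s - w))) ^+ 2)%:C%C.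
Proof.
move=> cpsi; have [M M0 psiM] := Cc_bounded cpsi.
have [a a0 Ha] := m_bound.
set Phi := convolution theta psi (tilde psi).
have cPhi : Cc Phi by exact: (Cc_autoconvolution hG theta_haar cpsi).
pose L := sumset K (oppset (supp psi)).
have cL : compact L by apply: compact_sumset => //; apply: compact_opp; exact: cpsi.2.
have psiL s w : K s -> ~ L w -> psi (s - w) = 0.
  move=> Ks nL; apply: Cc0 => ss; apply: nL; exists s => //.
  by exists (- (s - w)); [exists (s - w)|rewrite opprB addrC subrK].
pose F w := cmod (m (fun s => psi (s - w))) ^+ 2.
have cF : Ccr F by exact: weighted_Ccr.
have cpsiw w : continuous (fun s => psi (s - w)) by exact: (Cc_subr hG w cpsi).1.
rewrite -/(F _) [LHS]/(m (fun s => conjc (m (fun v => conjc (Phi (s - v)))))).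
have cI : continuous (fun s => conjc (m (fun v => conjc (Phi (s - v))))).
  by apply: ccontJ; exact: (weighted_cont (CcJ hG cPhi)).
apply/eqP; rewrite -subr_eq0; apply/eqP/cmod_eq0/eqP.
rewrite eq_le cmod_ge0 andbT.
(* The first summand pays for replacing [Phi] by [Phie] under both applications of [m], the second
   for replacing the integral of [F] by its Riemann sum. *)
apply: (@ge0_epsilon_le _ _ _ (a * (a * (4 * M * fine (theta L))) +
  2 * (a * M) * a * fine (theta L))) => e e0; rewrite add0r.
have nW := near_oppE (Cc_unif cpsi e0).
have [s_ nodes] := compact_nodes hG theta_haar nW cL.
have we w w' s : (forall x, cmod (psi (x - (w - w')) - psi x) < e) ->
    cmod (psi (s - w) - psi (s - w')) <= e.
  by move=> H; have := H (s - w'); rewrite opprB addrA subrK => /ltW.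
pose Phie s v := \sum_(p <- s_) (p.1)%:C%C * (psi (s - p.2) * conjc (psi (v - p.2))).
have Phi_e s v : K s -> cmod (Phi (s - v) - Phie s v) <= 4 * M * fine (theta L) * e.
  move=> Ks; rewrite /Phi (autoconvolution_shift hG lcG scG theta_haar s v cpsi).
  have -> : 4 * M * fine (theta L) * e = 2 * (2 * M * e) * fine (theta L) by ring.
  have Cw : Cc (fun w => psi (s - w) * conjc (psi (v - w))).
    exact: (CcM hG (Cc_subl hG s cpsi) (ccontJ (Cc_subl hG v cpsi).1)).
  apply: (cint_riemann nodes Cw cL).
  - by move=> w nL; rewrite psiL// mul0r.
  - move=> w t _ _ Wt /=.
    have -> : psi (s - w) * conjc (psi (v - w)) - psi (s - t) * conjc (psi (v - t)) =
      psi (s - w) * conjc (psi (v - w) - psi (v - t)) +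
      (psi (s - w) - psi (s - t)) * conjc (psi (v - t)) by rewrite rmorphB; ring.
    rewrite (le_trans (cmodD _ _))// !cmodM !cmodJ.
    have -> : 2 * M * e = M * e + e * M by ring.
    by apply: lerD; apply: ler_pM; rewrite ?cmod_ge0 ?psiM//; exact: we.
have cPhie1 s : continuous (fun v => conjc (Phie s v)).
  apply: ccontJ; apply: cont_sum => p.
  have H := ccontM (@ccont_cst R G (psi (s - p.2))) (ccontJ (cpsiw p.2)).
  exact: (ccontM (@ccont_cst R G (p.1)%:C%C) H).
have cPhis s : continuous (fun v => conjc (Phi (s - v))).
  by apply: ccontJ; exact: (Cc_subl hG s cPhi).1.
have mPhie s : conjc (m (fun v => conjc (Phie s v))) =
    \sum_(p <- s_) ((p.1)%:C%C * conjc (m (fun v => psi (v - p.2)))) * psi (s - p.2).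
  have -> : (fun v => conjc (Phie s v)) =
      fun v => \sum_(p <- s_) ((p.1)%:C%C * conjc (psi (s - p.2))) * psi (v - p.2).
    apply/funext => v; rewrite /Phie conjC_sum; apply: eq_bigr => p _.
    by rewrite !conjCM conjcK conjCR mulrA.
  rewrite (m_sum _ _ (fun p => cpsiw p.2)) conjC_sum; apply: eq_bigr => p _.
  by rewrite !conjCM conjcK conjCR; ring.
have cIe : continuous (fun s => conjc (m (fun v => conjc (Phie s v)))).
  under eq_fun do rewrite mPhie.
  apply: cont_sum => p; exact: (ccontM (@ccont_cst R G _) (cpsiw p.2)).
have mmPhie : m (fun s => conjc (m (fun v => conjc (Phie s v)))) =
    (\sum_(p <- s_) p.1 * F p.2)%:C%C.
  under [X in m X]eq_fun do rewrite mPhie.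
  rewrite (m_sum _ _ (fun p => cpsiw p.2)) rmorph_sum; apply: eq_bigr => p _.
  by rewrite -mulrA [X in _ * X]mulrC mul_conjc_cmod -rmorphM.
have t0 : 0 <= fine (theta L) by rewrite fine_ge0.
have E1 : cmod (m (fun s => conjc (m (fun v => conjc (Phi (s - v))))) -
    (\sum_(p <- s_) p.1 * F p.2)%:C%C) <= a * (a * (4 * M * fine (theta L) * e)).
  rewrite -mmPhie -(mB cI cIe); apply: (Ha).
  - exact: (ccontB cI cIe).
  - move=> s Ks; rewrite -conjCB cmodJ -(mB (cPhis s) (cPhie1 s)); apply: (Ha).
    + exact: (ccontB (cPhis s) (cPhie1 s)).
    + by move=> v _; rewrite -conjCB cmodJ; exact: Phi_e.
    + by rewrite !mulr_ge0// ltW.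
  - by rewrite !mulr_ge0// ltW.
have E2 : `|\int[theta]_(w in setT) F w - \sum_(p <- s_) p.1 * F p.2| <=
    2 * (a * M) * (a * e) * fine (theta L).
  have FL w : ~ L w -> F w = 0.
    move=> nL; rewrite /F /m; have -> : (fun s => U s * psi (s - w)) = fun=> 0.
      apply/funext => s; have [Ks|/UK ->] := pselect (K s); last by rewrite mul0r.
      by rewrite psiL// mulr0.
    by rewrite (radon0 hG mu_radon) cmod0 expr0n.
  have mM w : cmod (m (fun s => psi (s - w))) <= a * M.
    by apply: (Ha _ _ (cpsiw w) _ M0) => s _; exact: psiM.
  rewrite (@Rintegral_support _ R (borel G) theta L)//.
  have [_ _ Hs] := nodes; apply: (Hs _ ((a * M) ^+ 2)).
  - by apply: cont_measurable; exact: Ccr_cont.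
  - move=> w _; rewrite ger0_norm ?sqr_ge0// lerXn2r ?nnegrE ?cmod_ge0//.
    by rewrite mulr_ge0.
  - move=> w t _ _ Wt; apply: le_trans (cmod_sqr_dist (mM w) (mM t)) _.
    rewrite ler_wpM2l ?mulr_ge0// -(mB (cpsiw w) (cpsiw t)); apply: (Ha); last exact: ltW.
      exact: (ccontB (cpsiw w) (cpsiw t)).
    by move=> s _; exact: we.
set u := m _ in E1 *; set v := _%:C%C in E1.
have -> : u - (\int[theta]_(w in setT) F w)%:C%C =
  (u - v) - (\int[theta]_(w in setT) F w - \sum_(p <- s_) p.1 * F p.2)%:C%C.
  by rewrite rmorphB /v; ring.
apply: le_trans (cmodB _ _) _; rewrite cmodR.
by apply: le_trans (lerD E1 E2) _; lra.
Qed.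

End WeightedFunctional.

(** * The autocorrelation of one window *)

Section FiniteAutocorrelation.
Context {R : realType} {G : topologicalZmodType}.
Hypotheses (hG : hausdorff_space G) (lcG : locally_compact [set: G])
  (scG : sigma_compact G).
Variable theta : {measure set (borel G) -> \bar R}.
Hypothesis theta_haar : haar_measure theta.
Variable mu : (G -> R[i]) -> R[i].
Hypothesis mu_radon : complex_radon_measure mu.
Variable A : set G.
Hypotheses (oA : open A) (pA : precompact A).

Let cA : compact (closure A). Proof. by move: pA; rewrite precompactE. Qed.

Let conv_A phi :=
  convolution_measure (restriction mu A) (restriction (tilde_measure mu) (oppset A)) phi.

Lemma open_oppset : open (oppset A).
Proof.
have -> : oppset A = [set y | A (0 - y)]; last exact: open_subl.
apply/seteqP; split=> [_ [x Ax <-] /=|y /= Ay]; first by rewrite sub0r opprK.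
by exists (0 - y) => //; rewrite sub0r opprK.
Qed.

Lemma precompact_oppset : precompact (oppset A).
Proof.
exists (oppset (closure A)); first by move=> _ [x Ax <-]; exists x => //; exact: subset_closure.
have := compact_opp cA; split=> //; exact: compact_closed.
Qed.

Lemma cutoff_closure u d x : cutoff mu A u d -> ~ closure A x -> (u x)%:C%C = 0 :> R[i].
Proof.
move=> cu nA; rewrite (cutoff_notin cu)// => Ax; apply: nA.
exact: subset_closure.
Qed.

Lemma cutoff_cmod_le1 u d x : cutoff mu A u d -> cmod ((u x)%:C%C : R[i]) <= 1.
Proof. by move=> cu; rewrite cmodR ger0_norm ?(cutoff_ge0 cu)// (cutoff_le1 x cu). Qed.

(** The inner restriction is replaced first, uniformly in [s]. The inner function [Gs] is then a
    uniform limit of continuous functions and bounded, which is what replacing the outer restriction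
    requires. As every cutoff of small defect is allowed, the defect can be decreased further
    afterwards. *)
Lemma restricted_convolution_approx (phi : G -> R[i]) (eta : R) : Cc phi -> 0 < eta ->
  exists2 d0 : R, 0 < d0 & forall u d, cutoff mu A u d -> 0 <= d <= d0 ->
    cmod (conv_A phi - mu (fun s => (u s)%:C%C * conjc (mu (fun v => (u v)%:C%C *
      conjc (phi (s - v)))))) <= eta.
Proof.
move=> cphi eta0; have [M' M'0 phiM'] := Cc_bounded cphi; pose M := M' + 1.
have M0 : 0 < M by rewrite ltr_wpDl.
have phiM x : cmod (phi x) <= M by rewrite (le_trans (phiM' x))// lerDl.
have [a a0 Ha] := radon_bound hG mu_radon cA.
pose Gs s := restriction (tilde_measure mu) (oppset A) (fun t => phi (s + t)).
pose Gu (u : G -> R) s := conjc (mu (fun v => (u v)%:C%C * conjc (phi (s - v)))).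
have cGu u d : cutoff mu A u d -> continuous (Gu u).
  move=> cu; apply: ccontJ.
  exact: (weighted_cont hG mu_radon (cutoff_Cc cu) (fun x => cutoff_cmod_le1 x cu) cA
    (fun x => @cutoff_closure u d x cu) (CcJ hG cphi)).
have GuM u d s : cutoff mu A u d -> cmod (Gu u s) <= a * M.
  move=> cu; rewrite cmodJ; have cc : continuous (fun v => conjc (phi (s - v))).
    by apply: ccontJ; exact: (Cc_subl hG s cphi).1.
  apply: (Ha _ _ (cutoff_Ccmul hG cu cc)); last exact: ltW.
    by move=> x /(cutoff_closure cu) ->; rewrite mul0r.
  move=> x _; rewrite cmodM cmodJ -[leRHS]mul1r ler_pM ?cmod_ge0 ?(cutoff_cmod_le1 x cu)//.
have GGu u d s : cutoff mu A u d -> cmod (Gs s - Gu u s) <= 2 * M * d.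
  move=> cu; have := restriction_cutoff hG lcG (tilde_radon hG mu_radon)
    open_oppset precompact_oppset (cutoff_tilde hG mu_radon cu) M0 (Cc_addl hG s cphi).1 (fun x _ => phiM (s + x)).
  rewrite -/(Gs s).
  suff -> : tilde_measure mu (fun x => (u (- x))%:C%C * phi (s + x)) = Gu u s by [].
  rewrite /tilde_measure /Gu; congr (conjc (mu _)); apply/funext => v.
  by rewrite /tilde opprK conjCM conjCR.
have cGs : continuous Gs.
  (* With this defect [Gs] and [Gu u] differ by at most [e / 4] at each of the two points, leaving
     [e / 2] for the variation of [Gu u]. *)
  apply/ccontP => s e e0; have d0 : 0 < e / (8 * M) by rewrite divr_gt0// mulr_gt0.
  have [u cu] := cutoff_exists hG mu_radon pA d0.
  have e2 : 0 < e / 2 by rewrite divr_gt0.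
  have /ccontP /(_ s _ e2) := cGu u _ cu; apply: filterS => y H.
  have := GGu u _ y cu; have := GGu u _ s cu.
  have -> : 2 * M * (e / (8 * M)) = e / 4 by field; rewrite gt_eqF.
  have := cmodD (Gs y - Gu u y) (Gu u y - Gu u s - (Gs s - Gu u s)).
  have := cmodB (Gu u y - Gu u s) (Gs s - Gu u s).
  have -> : Gs y - Gu u y + (Gu u y - Gu u s - (Gs s - Gu u s)) = Gs y - Gs s by ring.
  lra.
have [u1 cu1] := cutoff_exists hG mu_radon pA (@ltr01 R).
have GsM s : cmod (Gs s) <= a * M + 2 * M.
  have := GGu _ _ s cu1; have := GuM _ _ s cu1.
  by have := cmodD (Gs s - Gu u1 s) (Gu u1 s); rewrite subrK; lra.
have N0 : 0 < a * M + 2 * M by rewrite ltr_wpDl ?mulr_ge0 ?(ltW M0)// mulr_gt0.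
(* The coefficient of [d] in the outer error, that in the inner error, and 1 for positivity. *)
pose C := 2 * (a * M + 2 * M) + a * (2 * M) + 1.
have aM : 0 <= a * M by rewrite mulr_ge0// ltW.
have C0 : 0 < C by rewrite /C; have := mulr_ge0 a0 (ltW M0); lra.
exists (eta / C) => [|u d cu /andP[d0 dC]]; first by rewrite divr_gt0.
have := restriction_cutoff hG lcG mu_radon oA pA cu N0 cGs (fun x _ => GsM x).
rewrite -/(conv_A phi) -[restriction mu A Gs]/(conv_A phi) => B1.
have B2 : cmod (mu (fun s => (u s)%:C%C * Gs s) - mu (fun s => (u s)%:C%C * Gu u s)) <=
    a * (2 * M * d).
  rewrite -(radonB hG mu_radon (cutoff_Ccmul hG cu cGs) (cutoff_Ccmul hG cu (cGu _ _ cu))).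
  apply: (Ha _ _ (CcB hG (cutoff_Ccmul hG cu cGs) (cutoff_Ccmul hG cu (cGu _ _ cu)))).
  - by move=> x /(cutoff_closure cu) ->; rewrite !mul0r subrr.
  - move=> x _; rewrite -mulrBr cmodM -[leRHS]mul1r ler_pM ?cmod_ge0//.
      exact: cutoff_cmod_le1 cu.
    exact: GGu.
  - by rewrite !mulr_ge0// ltW.
have := cmodD (conv_A phi - mu (fun s => (u s)%:C%C * Gs s))
  (mu (fun s => (u s)%:C%C * Gs s) - mu (fun s => (u s)%:C%C * Gu u s)).
rewrite addrA subrK => /le_trans; apply; apply: le_trans (lerD B1 B2) _.
have -> : 2 * (a * M + 2 * M) * d + a * (2 * M * d) = (C - 1) * d by rewrite /C; ring.
apply: (@le_trans _ _ (C * d)); first by rewrite ler_wpM2r//; lra.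
by rewrite mulrC -ler_pdivlMr.
Qed.

Variable psi : G -> R[i].
Hypothesis cpsi : Cc psi.
Variable C : R.
Hypotheses (C0 : 0 < C) (HC : forall w (r : G -> R[i]), continuous r ->
  (forall s, cmod (r s) <= 1) -> cmod (mu (fun s => r s * psi (s - w))) <= C).

Let S := supp psi.
(** Both signs are needed: [S] detects a [w] in [A] from which [psi (_ - w)] reaches outside [A],
    and [- S] a [w] outside [A] from which it reaches inside. *)
Let Q := S `|` oppset S.
Let B := van_hove_boundary Q A.
Let F (u : G -> R) w := cmod (mu (fun s => (u s)%:C%C * psi (s - w))) ^+ 2.
Let H w := cmod (mu (fun s => psi (s - w))) ^+ 2.

(** When [w] varies in a compact neighbourhood [K], all translates of [psi] are supported in the
    compact set [supp psi + K], on which [mu] has one bound. *)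
Lemma cont_convolution_sub : continuous (fun w => mu (fun s => psi (s - w))).
Proof.
apply/ccontP => w e e0.
have [K nK cK] := compact_nbhs lcG w.
pose L := sumset (supp psi) K; have cL : compact L by exact: (compact_sumset cpsi.2 cK).
have [a a0 Ha] := radon_bound hG mu_radon cL.
have e1 : 0 < e / (a + 1) by rewrite divr_gt0// ltr_wpDl.
have nW : \forall y \near w, forall x, cmod (psi (x - (y - w)) - psi x) < e / (a + 1).
  apply/near_addE; have := near_oppE (Cc_unif cpsi e1); apply: filterS => v Hv x.
  by rewrite (addrC w) addrK; exact: Hv.
have nw0 : K w by exact: nbhs_singleton.
apply: filterS2 nK nW => y Ky Hy.
have c1 := Cc_subr hG y cpsi; have c2 := Cc_subr hG w cpsi.
rewrite -(radonB hG mu_radon c1 c2).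
have L0 x v : K v -> ~ L x -> psi (x - v) = 0.
  move=> Kv nL; apply: Cc0 => sx; apply: nL; exists (x - v) => //.
  by exists v => //; rewrite subrK.
apply: (@le_lt_trans _ _ (a * (e / (a + 1)))).
  apply: (Ha _ _ (CcB hG c1 c2)); last exact: ltW.
    by move=> x nL; rewrite !L0// subrr.
  by move=> x _; have := Hy (x - w); rewrite opprB addrA subrK => /ltW.
rewrite mulrCA -[ltRHS]mulr1 ltr_pM2l// ltr_pdivrMr ?ltr_wpDl// mul1r; lra.
Qed.

Lemma cont_sqr_convolution : continuous H.
Proof. by move=> w; apply: cvgM; exact: (cont_cmod cont_convolution_sub). Qed.

Let HC1 w : cmod (mu (fun s => psi (s - w))) <= C.
Proof.
have cmod1_le : cmod (1 : R[i]) <= 1 by rewrite cmod1.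
have := HC w (@ccont_cst R G 1) (fun _ => cmod1_le).
by have -> : (fun s => 1 * psi (s - w)) = fun s => psi (s - w) by apply/funext => s; rewrite mul1r.
Qed.

Let HCu u d w : cutoff mu A u d -> cmod (mu (fun s => (u s)%:C%C * psi (s - w))) <= C.
Proof.
move=> cu; apply: (HC w (cutoff_Cc cu).1) => s; exact: cutoff_cmod_le1 cu.
Qed.

Let in_A w s : ~ B w -> A w -> ~ A s -> psi (s - w) = 0.
Proof.
move=> nB Aw nAs; apply: Cc0 => ss; apply: nB; right; split; apply: subset_closure => //.
by exists s => //; exists (w - s); [exists (s - w); [left|rewrite opprB]|rewrite addrC subrK].
Qed.

Let out_A w s : ~ B w -> ~ A w -> A s -> psi (s - w) = 0.
Proof.
move=> nB nAw As; apply: Cc0 => ss; apply: nB; left; split; apply: subset_closure => //.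
exists s => //; exists (w - s); last by rewrite addrC subrK.
by right; exists (s - w) => //; rewrite opprB.
Qed.

Let sqr_le (x : R) : 0 <= x -> x <= C -> `|x ^+ 2| <= C ^+ 2.
Proof.
by move=> x0 xC; rewrite ger0_norm ?sqr_ge0// lerXn2r ?nnegrE ?(ltW C0).
Qed.

(** For [w] in [A] off [B], [psi (_ - w)] lives on [A], so inserting [u] changes the value of [mu]
    by at most [M * d] and its square by [2 * C * (M * d)]. On [B] both integrands lie between 0 and
    [C ^+ 2]; elsewhere both vanish. *)
Lemma boundary_compare u d (M : R) : cutoff mu A u d -> 0 < M ->
  (forall x, cmod (psi x) <= M) -> (theta B < +oo)%E ->
  `|\int[theta]_(w in setT) F u w - \int[theta]_(w in A) H w| <=
    2 * C * (M * d) * fine (theta A) + C ^+ 2 * fine (theta B).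
Proof.
move=> cu M0 psiM tB; have mA : measurable (A : set (borel G)) by exact: borel_open.
have mB : measurable (B : set (borel G)) by exact: van_hove_boundary_measurable.
have tA : (theta A < +oo)%E by exact: (haar_precompact theta_haar mA pA).
have d0 : 0 <= d.
  rewrite -lee_fin; apply: le_trans (cutoff_variation cu).
  apply: ereal_sup_ubound; exists (fun=> 0).
    split=> [|x]; first exact: Cc_cst0.
    by rewrite cmod0 lee_fin subr_ge0 (cutoff_le cu).
  by rewrite (radon0 hG mu_radon) cmod0.
have mAB : measurable (A `\` B : set (borel G)) by exact: measurableD.
have tAB : (theta (A `\` B) <= theta A)%E.
  by apply: le_measure; rewrite ?inE//; exact: subDsetl.
have tAB' : (theta (A `\` B) < +oo)%E by exact: le_lt_trans tA.
pose g w := \1_A w * H w.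
have cF : continuous (F u).
  apply: (@Ccr_cont R G); apply: (weighted_Ccr hG mu_radon (cutoff_Cc cu)
    (fun x => cutoff_cmod_le1 x cu) cA (fun x => @cutoff_closure u d x cu) cpsi).
have mF D : measurable_fun (D : set (borel G)) (F u) by exact: cont_measurable.
have mg D : measurable_fun (D : set (borel G)) g.
  apply: measurable_funM; last exact: (cont_measurable cont_sqr_convolution).
  exact: measurable_indic.
have FM w : `|F u w| <= C ^+ 2 by apply: sqr_le; [exact: cmod_ge0|exact: HCu cu].
have gM w : `|g w| <= C ^+ 2.
  rewrite normrM -[leRHS]mul1r; apply: ler_pM => //.
    by rewrite indicE; case: (w \in A); rewrite ?normr1 ?normr0.
  by apply: sqr_le; [exact: cmod_ge0|exact: HC1].
have F0 w : ~ (A `\` B `|` B) w -> F u w = 0.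
  move=> nE; have nB : ~ B w by move=> Bw; apply: nE; right.
  have nA : ~ A w by move=> Aw; apply: nE; left.
  rewrite /F; have -> : (fun s => (u s)%:C%C * psi (s - w)) = fun=> 0.
    apply/funext => s; have [As|nAs] := pselect (A s).
      by rewrite (out_A nB nA As) mulr0.
    by rewrite (cutoff_notin cu nAs) mul0r.
  by rewrite (radon0 hG mu_radon) cmod0 expr0n.
have g0 w : ~ A w -> g w = 0 by move=> nA; rewrite /g indic_notin// mul0r.
have g0' w : ~ (A `\` B `|` B) w -> g w = 0.
  move=> nE; apply: g0 => Aw; apply: nE.
  by have [Bw|nB] := pselect (B w); [right|left].
have -> : \int[theta]_(w in A) H w = \int[theta]_(w in setT) g w.
  rewrite (@Rintegral_support _ R (borel G) theta A)//; apply: eq_Rintegral => w Aw.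
  by rewrite /g indicE Aw mul1r.
have disj : [disjoint A `\` B & B] by apply/disj_setPS => x [[_ ?] ?].
have tE : (theta (A `\` B `|` B) < +oo)%E.
  by rewrite measureU//; [rewrite lte_add_pinfty|exact/disj_set2P].
have mE : measurable (A `\` B `|` B : set (borel G)) by exact: measurableU.
rewrite (@Rintegral_support _ R (borel G) theta (A `\` B `|` B) (F u))//.
rewrite (@Rintegral_support _ R (borel G) theta (A `\` B `|` B) g)//.
have iF := bounded_integrable mE tE (mF _) (fun x _ => FM x).
have ig := bounded_integrable mE tE (mg _) (fun x _ => gM x).
rewrite (Rintegral_setU mAB mB iF disj) (Rintegral_setU mAB mB ig disj).
rewrite opprD addrACA (le_trans (ler_normD _ _))//; apply: lerD; last first.
  apply: (@Rintegral_dist _ _ _ _ _ _ _ (C ^+ 2)) => // w _.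
  have F1 := FM w; have g1 := gM w.
  have F2 : 0 <= F u w by exact: sqr_ge0.
  have g2 : 0 <= g w by rewrite mulr_ge0 ?sqr_ge0// indicE.
  move: F1 g1; rewrite (ger0_norm F2) (ger0_norm g2) => F1 g1.
  by rewrite ler_norml; apply/andP; split; lra.
apply: (@le_trans _ _ (2 * C * (M * d) * fine (theta (A `\` B)))); last first.
  rewrite ler_wpM2l ?mulr_ge0 ?(ltW C0) ?(ltW M0)//.
  by apply: fine_le => //; rewrite ge0_fin_numE.
apply: (@Rintegral_dist _ _ _ _ _ _ _ (C ^+ 2)) => // w [Aw nB].
rewrite /g indicE mem_set// mul1r.
apply: le_trans (cmod_sqr_dist (HCu w cu) (HC1 w)) _.
rewrite ler_wpM2l ?mulr_ge0 ?(ltW C0)//.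
have c1 := cutoff_Ccmul hG cu (Cc_subr hG w cpsi).1; have c2 := Cc_subr hG w cpsi.
rewrite -(radonB hG mu_radon c1 c2).
apply: (variation_le (variation_scale_cutoff hG mu_radon cu M0) (CcB hG c1 c2)) => x.
rewrite lee_fin.
have -> : (u x)%:C%C * psi (x - w) - psi (x - w) = (u x - 1)%:C%C * psi (x - w).
  by rewrite rmorphB rmorph1 mulrBl mul1r.
rewrite cmodM cmodR ler0_norm ?subr_le0 ?(cutoff_le1 x cu)// opprB mulrC.
have [Ax|nA] := pselect (A x).
  by rewrite indicE mem_set// ler_wpM2r// subr_ge0 (cutoff_le1 x cu).
by rewrite (in_A nB Aw nA) cmod0 mul0r mulr_ge0 ?(ltW M0)// subr_ge0 (cutoff_le cu).
Qed.

(* For [w] off the van Hove boundary [B], the function [psi (_ - w)] is supported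
   in [A] or vanishes on [A]. *)
Lemma finite_autocorrelation : (theta B < +oo)%E ->
  cmod (conv_A (convolution theta psi (tilde psi)) - (\int[theta]_(w in A) H w)%:C%C) <=
    C ^+ 2 * fine (theta B).
Proof.
move=> tB; have [M' M'0 psiM'] := Cc_bounded cpsi; pose M := M' + 1.
have M0 : 0 < M by rewrite ltr_wpDl.
have psiM x : cmod (psi x) <= M by rewrite (le_trans (psiM' x))// lerDl.
have t0 : 0 <= fine (theta A) by rewrite fine_ge0.
apply: (@ge0_epsilon_le _ _ _ (1 + 2 * C * M * fine (theta A))) => e e0.
have [d0 d00 Hd0] := restricted_convolution_approx
  (Cc_autoconvolution hG theta_haar cpsi) e0.
have m0 : 0 < Num.min d0 e by rewrite lt_min d00.
have [u cu] := cutoff_exists hG mu_radon pA m0.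
have /(_ _)/wrap[|E1] := Hd0 u _ cu; first by rewrite (ltW m0) ge_min lexx.
have E2 := boundary_compare cu M0 psiM tB.
rewrite (weighted_fubini hG lcG scG theta_haar mu_radon (cutoff_Cc cu)
  (fun x => cutoff_cmod_le1 x cu) cA (fun x => @cutoff_closure u _ x cu) cpsi) in E1.
rewrite -/(conv_A _) in E1.
have := cmodD (conv_A (convolution theta psi (tilde psi)) -
    (\int[theta]_(w in setT) F u w)%:C%C)
  (\int[theta]_(w in setT) F u w - \int[theta]_(w in A) H w)%:C%C.
rewrite cmodR rmorphB addrA subrK => /le_trans; apply.
apply: le_trans (lerD E1 E2) _.
have : 2 * C * (M * Num.min d0 e) * fine (theta A) <= 2 * C * M * fine (theta A) * e.
  have -> : 2 * C * (M * Num.min d0 e) * fine (theta A) =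
    2 * C * M * fine (theta A) * Num.min d0 e by ring.
  rewrite ler_wpM2l ?ge_min ?lexx ?orbT//.
  by rewrite !mulr_ge0// ltW.
lra.
Qed.

End FiniteAutocorrelation.

Section LimSup.
Context {R : realType}.

Lemma limn_esup_ltW (u : nat -> \bar R) (e : \bar R) : (limn_esup u < e)%E ->
  \forall n \near \oo, (u n < e)%E.
Proof.
rewrite /limn_esup /limf_esup => /ereal_inf_lt[_ [P nP <-] supP].
apply: filterS nP => n Pn; apply: le_lt_trans supP.
by apply: ereal_sup_ubound; exists n.
Qed.

Lemma limn_esup_leW (u : nat -> \bar R) (e : \bar R) :
  (\forall n \near \oo, (u n <= e)%E) -> (limn_esup u <= e)%E.
Proof.
move=> H; rewrite /limn_esup /limf_esup.
apply: (@le_trans _ _ (ereal_sup [set u n | n in [set n | (u n <= e)%E]])).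
  by apply: ereal_inf_lbound; exists [set n | (u n <= e)%E].
by apply: ge_ereal_sup => _ [n un <-].
Qed.

End LimSup.

(** * Mean squares in the van Hove limit *)

Section MeanSquare.
Context {R : realType} {G : topologicalZmodType}.
Hypotheses (hG : hausdorff_space G) (lcG : locally_compact [set: G])
  (scG : sigma_compact G).
Variable theta : {measure set (borel G) -> \bar R}.
Hypothesis theta_haar : haar_measure theta.
Variables (mu : (G -> R[i]) -> R[i]) (A : nat -> set G) (gamma : (G -> R[i]) -> R[i]).
Hypotheses (mu_radon : complex_radon_measure mu) (mu_bounded : translation_bounded mu)
  (A_vh : van_hove theta A) (gammaP : autocorrelation theta A mu gamma).

Lemma van_hove_measurable n : measurable (A n : set (borel G)).
Proof. exact: (borel_open (van_hove_open A_vh n)). Qed.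

Lemma van_hove_lty n : (theta (A n) < +oo)%E.
Proof.
exact: (haar_precompact theta_haar (van_hove_measurable n) (van_hove_precompact A_vh n)).
Qed.

Lemma van_hove_fine_gt0 n : 0 < fine (theta (A n)).
Proof. by rewrite fine_gt0// (van_hove_gt0 A_vh) van_hove_lty. Qed.

Lemma van_hove_boundary_small (K : set G) (e : R) : compact K -> 0 < e ->
  \forall n \near \oo, (theta (van_hove_boundary K (A n)) < +oo)%E /\
    fine (theta (van_hove_boundary K (A n))) < e * fine (theta (A n)).
Proof.
move=> cK e0; have H := van_hove_cvg A_vh cK.
have nb : nbhs (0%E : \bar R) [set x | (x < e%:E)%E].
  by apply: open_nbhs_nbhs; split; [exact: open_ereal_lt_ereal|rewrite /= lte_fin].
have {}H : \forall n \near \oo, (theta (van_hove_boundary K (A n)) *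
  ((fine (theta (A n)))^-1)%:E < e%:E)%E by exact: (H _ nb).
apply: filterS H => n.
have r0 := van_hove_fine_gt0 n; have ri : 0 < (fine (theta (A n)))^-1 by rewrite invr_gt0.
have : (0 <= theta (van_hove_boundary K (A n)))%E by exact: measure_ge0.
case: (theta (van_hove_boundary K (A n))) => [b _| |//].
  by rewrite -EFinM lte_fin ltr_pdivrMr//= => ->; rewrite ltry.
(* An infinite boundary would make the quotient infinite, so its finiteness for large [n] is part of
   what the convergence gives. *)
by move=> _; rewrite gt0_mulye ?lte_fin.
Qed.

Definition mean_square (psi : G -> R[i]) n := (fine (theta (A n)))^-1 *
  \int[theta]_(w in A n) cmod (mu (fun s => psi (s - w))) ^+ 2.

Lemma mean_square_cvg (psi : G -> R[i]) : Cc psi ->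
  mean_square psi n @[n --> \oo] -->
    complex.Re (gamma (convolution theta psi (tilde psi))).
Proof.
move=> cpsi; have [C C0 HC] := translates_bounded hG lcG mu_radon mu_bounded cpsi.
have cPhi := Cc_autoconvolution hG theta_haar cpsi.
pose Q := supp psi `|` oppset (supp psi).
have cQ : compact Q by apply: compactU; [exact: cpsi.2|exact: (compact_opp cpsi.2)].
apply/cvgrPdist_lt => e e0; have e2 : 0 < e / 2 by rewrite divr_gt0.
have e3 : 0 < e / (2 * C ^+ 2) by rewrite divr_gt0// mulr_gt0// exprn_gt0.
have /ccvgP /(_ _ e2) N1 := gammaP.2 _ cPhi.
have N2 := van_hove_boundary_small cQ e3.
apply: filterS2 N1 N2 => n; set r := fine (theta (A n)) => H1 [tB tBr].
have r0 : 0 < r by exact: van_hove_fine_gt0.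
have H2 := finite_autocorrelation hG lcG scG theta_haar mu_radon (van_hove_open A_vh n)
  (van_hove_precompact A_vh n) cpsi C0 HC tB.
move: H1 H2; set z := convolution_measure _ _ _; set c := gamma _ => H1 H2.
rewrite -[mean_square psi n]/(complex.Re (mean_square psi n)%:C%C) -raddfB.
apply: le_lt_trans (Re_le_cmod _) _; rewrite cmodC.
have -> : (mean_square psi n)%:C%C - c = (r^-1%:C%C * z - c) -
    r^-1%:C%C * (z - (\int[theta]_(w in A n) cmod (mu (fun s => psi (s - w))) ^+ 2)%:C%C).
  by rewrite mulrBr -rmorphM /= -/(mean_square psi n); ring.
apply: le_lt_trans (cmodB _ _) _; rewrite [X in _ < X]splitr ltr_leD//.
rewrite cmodM cmodR ger0_norm ?invr_ge0 ?(ltW r0)// mulrC ler_pdivrMr//.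
apply: le_trans H2 _; apply: le_trans (ler_wpM2l _ (ltW tBr)) _; first exact: sqr_ge0.
have -> : C ^+ 2 * (e / (2 * C ^+ 2) * r) = e / 2 * r; last by [].
by field; rewrite gt_eqF.
Qed.

Let defect (phi : G -> R[i]) t s :=
  convolution_fun mu phi s - translate t (convolution_fun mu phi) s.

(** The convolution evaluates [phi] at [w - s], so the function translated under [mu] is the
    reflection of [phi]. *)
Let defectE phi t w : Cc phi -> defect phi t w =
  mu (fun s => phi (- (s - w)) - phi (- (s - w + t))).
Proof.
move=> cphi; rewrite /defect /translate /convolution_fun.
rewrite -(radonB hG mu_radon (Cc_subl hG w cphi) (Cc_subl hG (w - t) cphi)).
congr mu; apply/funext => s; have -> : - (s - w + t) = w - t - s; last by rewrite opprB.
by rewrite opprD opprB addrAC.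
Qed.

(** With [f = |mu * psi| <= 2 * C], the mean of [f ^+ 2] is at most [2 * C] times that of [f];
    conversely [f <= e / 2 + f ^+ 2 / (2 * e)]. The constant is independent of [t] because
    [translates_bounded] is uniform over translates. *)
Lemma besicovitch_mean_square (phi : G -> R[i]) : Cc phi -> exists2 M : R, 0 < M &
  forall t, let psi x := phi (- x) - phi (- (x + t)) in
    let D := complex.Re (gamma (convolution theta psi (tilde psi))) in
    forall e : R, 0 < e ->
    (D < e ^+ 2 -> (besicovitch theta A (defect phi t) < e%:E)%E) /\
    ((besicovitch theta A (defect phi t) < e%:E)%E -> D <= M * e).
Proof.
move=> cphi; have cphi' : Cc (fun x => phi (- x)).
  by have := Cc_subl hG 0 cphi; under eq_fun do rewrite sub0r.
have [C C0 HC] := translates_bounded hG lcG mu_radon mu_bounded cphi'.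
exists (2 * C) => [|t psi D e e0]; first by rewrite mulr_gt0.
have c2 : Cc (fun x => phi (- (x + t))) by exact: (Cc_addr hG t cphi').
have cpsi : Cc psi by exact: (CcB hG cphi' c2).
have Dcvg := mean_square_cvg cpsi; rewrite -/D in Dcvg.
have dE w : defect phi t w = mu (fun s => psi (s - w)) by rewrite defectE.
have cd : continuous (fun w => mu (fun s => psi (s - w))) by exact: cont_convolution_sub.
have cmod1_le : cmod (1 : R[i]) <= 1 by rewrite cmod1.
have HC1 w : cmod (mu (fun s => phi (- (s - w)))) <= C.
  have := HC w (fun=> 1) (@ccont_cst R G 1) (fun _ => cmod1_le).
  by have -> : (fun s => 1 * phi (- (s - w))) = fun s => phi (- (s - w))
    by apply/funext => s; rewrite mul1r.
have dC w : cmod (mu (fun s => psi (s - w))) <= 2 * C.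
  rewrite /psi (radonB hG mu_radon (Cc_subr hG w cphi') (Cc_subr hG w c2)).
  have := HC1 w; have := HC1 (w - t).
  have -> : (fun s => phi (- (s - (w - t)))) = fun s => phi (- (s - w + t)).
    by apply/funext => s; congr (phi (- _)); rewrite opprB addrA addrAC.
  by have := cmodB (mu (fun s => phi (- (s - w)))) (mu (fun s => phi (- (s - w + t)))); lra.
pose f w := cmod (mu (fun s => psi (s - w))).
have cf : continuous f by exact: (cont_cmod cd).
have f0 w : 0 <= f w by exact: cmod_ge0.
pose a n := (fine (theta (A n)))^-1 * \int[theta]_(w in A n) f w.
have mf n : measurable_fun (A n : set (borel G)) f by exact: cont_measurable.
have cf2 : continuous (fun w => f w ^+ 2) by move=> w; apply: cvgM; exact: cf.
have mf2 n : measurable_fun (A n : set (borel G)) (fun w => f w ^+ 2) by exact: cont_measurable.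
have mA := van_hove_measurable; have tA := van_hove_lty; have rA := van_hove_fine_gt0.
have fI n : theta.-integrable (A n) (EFin \o f).
  by apply: (@bounded_integrable _ _ _ _ _ _ (2 * C)) => // x _; rewrite ger0_norm// dC.
have f2I n : theta.-integrable (A n) (EFin \o (fun w => f w ^+ 2)).
  apply: (@bounded_integrable _ _ _ _ _ _ ((2 * C) ^+ 2)) => // x _.
  by rewrite ger0_norm ?sqr_ge0// lerXn2r ?nnegrE ?mulr_ge0 ?(ltW C0)// dC.
have bE : besicovitch theta A (defect phi t) = limn_esup (fun n => (a n)%:E).
  congr limn_esup; apply/funext => n; rewrite /a EFinM; congr (_ * _)%E.
  rewrite /Rintegral fineK; last exact: (integrable_fin_num (mA n) (fI n)).
  by apply: eq_integral => w _; rewrite dE.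
have b_le n : mean_square psi n <= 2 * C * a n.
  rewrite /mean_square /a mulrCA ler_wpM2l ?invr_ge0 ?(ltW (rA n))//.
  rewrite -RintegralZl//; apply: le_Rintegral => // [|w _].
    exact: (integrableZl (mA n) (2 * C) (fI n)).
  by rewrite expr2; apply: ler_wpM2r (f0 w) _ _ (dC w).
(* Pointwise this is [(f - e) ^+ 2 >= 0]. *)
have a_le n : a n <= e / 2 + (2 * e)^-1 * mean_square psi n.
  rewrite /mean_square /a mulrCA -[e / 2](mulKf (lt0r_neq0 (rA n))) -mulrDr.
  rewrite ler_wpM2l ?invr_ge0 ?(ltW (rA n))// mulrC -Rintegral_cst// -RintegralZl//.
  have i1 := integrableZl (mA n) (2 * e)^-1 (f2I n).
  have i2 : theta.-integrable (A n) (EFin \o (fun _ => e / 2)).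
    by apply: (@bounded_integrable _ _ _ _ _ _ `|e / 2|).
  rewrite -RintegralD//; apply: le_Rintegral => // [|w _].
    exact: (integrableD (mA n) i2 i1).
  rewrite -subr_ge0 (_ : _ - _ = (2 * e)^-1 * (f w - e) ^+ 2).
    by rewrite mulr_ge0 ?sqr_ge0// invr_ge0 mulr_ge0 ?(ltW e0).
  rewrite -/(f w); move: (f w) => x; by field; rewrite gt_eqF.
rewrite bE; split=> [De|/limn_esup_ltW ae].
  (* The midpoint of [D] and [e ^+ 2] keeps the inequality strict after the limit superior. *)
  apply: (@le_lt_trans _ _ ((e / 2 + (2 * e)^-1 * ((D + e ^+ 2) / 2))%:E)); last first.
    have eE : e / 2 + (2 * e)^-1 * e ^+ 2 = e by field; rewrite gt_eqF.
    rewrite lte_fin -[X in _ < X]eE ltrD2l ltr_pM2l ?invr_gt0 ?mulr_gt0//; lra.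
  apply: limn_esup_leW.
  have : \forall n \near \oo, mean_square psi n < (D + e ^+ 2) / 2.
    by apply: (cvgr_lt D Dcvg); lra.
  apply: filterS => n Hn; rewrite lee_fin; apply: le_trans (a_le n) _.
  by rewrite lerD2l ler_wpM2l ?invr_ge0 ?mulr_ge0 ?(ltW e0)// ltW.
apply: (cvgr_to_le Dcvg); apply: filterS ae => n; rewrite lte_fin => ae.
by apply: le_trans (b_le n) _; rewrite ler_wpM2l ?mulr_ge0 ?(ltW C0)// ltW.
Qed.

End MeanSquare.

(** * Characters and the spectral defect *)

Section DualGroup.
Context {R : realType} {G : topologicalZmodType}.
Implicit Types (chi : dual R G).

Lemma dual_charP chi : [/\ continuous (dual_val chi),
  forall x y, dual_val chi (x + y) = dual_val chi x * dual_val chi y &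
  forall x, cmod (dual_val chi x) = 1].
Proof.
have /= [c1 c2 c3] : character (dual_val chi) by exact: set_valP.
split=> // x; apply: (@complexI R); rewrite rmorph1 -(c3 x).
by rewrite normE.
Qed.

Lemma dual_cont chi : continuous (dual_val chi).
Proof. by have [] := dual_charP chi. Qed.

Lemma dualD chi x y : dual_val chi (x + y) = dual_val chi x * dual_val chi y.
Proof. by have [] := dual_charP chi. Qed.

Lemma dual_cmod chi x : cmod (dual_val chi x) = 1.
Proof. by have [] := dual_charP chi. Qed.

Lemma dual_neq0 chi x : dual_val chi x != 0.
Proof. by apply/eqP => h; have := dual_cmod chi x; rewrite h cmod0 => /eqP; rewrite eq_sym oner_eq0. Qed.

Lemma dual0 chi : dual_val chi 0 = 1.
Proof.
have := dualD chi 0 0; rewrite addr0 => /esym h.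
by apply: (mulfI (dual_neq0 chi 0)); rewrite mulr1.
Qed.

Lemma dual_mul_conjc chi x : dual_val chi x * conjc (dual_val chi x) = 1.
Proof. by rewrite mul_conjc_cmod dual_cmod expr1n. Qed.

Lemma dualN chi x : dual_val chi (- x) = conjc (dual_val chi x).
Proof.
apply: (mulfI (dual_neq0 chi x)); rewrite dual_mul_conjc -dualD subrr.
exact: dual0.
Qed.

Lemma dual_inj chi chi' : dual_val chi = dual_val chi' -> chi = chi'.
Proof. exact: val_inj. Qed.

(** Towards a continuous limit, compact-open convergence is uniform convergence on compact sets. *)
Lemma dual_unif_nbhs chi0 (K : set G) (e : R) : compact K -> 0 < e ->
  \forall chi \near chi0, forall x, K x -> cmod (dual_val chi x - dual_val chi0 x) < e.
Proof.
move=> cK e0.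
have H1 : {compact-open, (@dual_val R G @ nbhs chi0) --> dual_val chi0}.
  exact: (@initial_continuous (dual R G) {compact-open, G -> R[i]} set_val).
have FF : Filter (@dual_val R G @ nbhs chi0) by typeclasses eauto.
have H2 := (compact_open_fam_compactP (@dual_cont chi0) FF).1 H1.
have H3 := (fam_cvgP _ _ FF).1 H2 K cK.
pose E := [set xy : R[i] * R[i] | ball xy.1 e%:C%C xy.2].
have entE : entourage E.
  by rewrite -entourage_ballE; exists e%:C%C => //=; rewrite ltcR.
have nH : nbhs (dual_val chi0 : {uniform` K -> R[i]}) [set h | forall y, K y -> E (dual_val chi0 y, h y)].
  apply/uniform_nbhs; by exists E; split; [exact: entE|exact: subset_refl].
have H : \forall chi \near chi0, forall y, K y -> E (dual_val chi0 y, dual_val chi y).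
  exact: (H3 _ nH).
apply: filterS H => chi H x Kx; have := H x Kx.
by rewrite /E /ball /= normE ltcR cmodC.
Qed.

Lemma dual_eval_cont (x : G) : continuous (fun chi => dual_val chi x).
Proof.
apply/ccontP => chi e e0.
apply: filterS (dual_unif_nbhs chi (@compact_set1 _ x) e0) => chi'; exact.
Qed.

Lemma dual_hausdorff : hausdorff_space (dual R G).
Proof.
move=> chi chi' H; apply: dual_inj; apply/funext => x.
apply/eqP; rewrite -subr_eq0; apply/eqP/cmod_eq0/eqP.
rewrite eq_le cmod_ge0 andbT; apply: (@ge0_epsilon_le _ _ _ 2) => e e0; rewrite add0r.
have [psi [/= H1 H2]] := H _ _ (dual_unif_nbhs chi (@compact_set1 _ x) e0)
  (dual_unif_nbhs chi' (@compact_set1 _ x) e0).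
have := cmodD (dual_val chi x - dual_val psi x) (dual_val psi x - dual_val chi' x).
rewrite addrA subrK; have := H1 x erefl; have := H2 x erefl; rewrite (cmodC _ (dual_val chi x)).
lra.
Qed.

(** On a compact neighbourhood [V] of 0, characters near [chi0] are uniformly close to it, so
    evaluation is jointly continuous at [(chi0, 0)]. Compactness of [Kh] makes the neighbourhood of
    0 uniform. *)
Lemma dual_equicont (lcG : locally_compact [set: G]) (Kh : set (dual R G)) (e : R) :
  compact Kh -> 0 < e ->
  \forall w \near (0 : G), forall chi, Kh chi -> cmod (dual_val chi w - 1) < e.
Proof.
move=> /compact_near_coveringP cK e0.
apply: (cK G (nbhs (0 : G)) (fun w chi => cmod (dual_val chi w - 1) < e)).
move=> chi0 _; have [V nV cV] := compact_nbhs lcG (0 : G).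
have e2 : 0 < e / 2 by rewrite divr_gt0.
exists ([set chi | forall x, V x -> cmod (dual_val chi x - dual_val chi0 x) < e / 2],
  V `&` [set w | cmod (dual_val chi0 w - 1) < e / 2]) => /=.
  split; first exact: dual_unif_nbhs.
  apply: filterI => //; rewrite -(dual0 chi0).
  by have /ccontP := @dual_cont chi0; apply.
move=> [chi w] /= [H [Vw Hw]]; have := H w Vw.
have := cmodD (dual_val chi w - dual_val chi0 w) (dual_val chi0 w - 1).
by rewrite addrA subrK; lra.
Qed.

End DualGroup.

Section Fourier.
Context {R : realType} {G : topologicalZmodType}.
Hypotheses (hG : hausdorff_space G) (lcG : locally_compact [set: G])
  (scG : sigma_compact G).
Variable theta : {measure set (borel G) -> \bar R}.
Hypothesis theta_haar : haar_measure theta.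
Implicit Types (chi : dual R G) (phi : G -> R[i]).

Lemma Cc_dualM phi chi : Cc phi -> Cc (fun t => dual_val chi t * phi t).
Proof.
move=> cphi; have := CcM hG cphi (@dual_cont R G chi).
by under eq_fun do rewrite mulrC.
Qed.

Lemma inverse_fourier_bounded phi : Cc phi -> exists2 M : R, 0 < M &
  forall chi, cmod (inverse_fourier theta phi chi) <= M.
Proof.
move=> cphi; have [N N0 phiN] := Cc_bounded cphi.
exists (2 * N * fine (theta (supp phi)) + 1) => [|chi].
  by rewrite ltr_wpDl// !mulr_ge0// fine_ge0.
apply: (@le_trans _ _ (2 * N * fine (theta (supp phi)))); last by rewrite lerDl.
apply: (cint_bound hG theta_haar (Cc_dualM chi cphi) cphi.2).
  by move=> x /Cc0 ->; rewrite mulr0.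
by move=> x _; rewrite cmodM dual_cmod mul1r.
Qed.

Lemma inverse_fourier_cont phi : Cc phi -> continuous (inverse_fourier theta phi).
Proof.
move=> cphi; have [N N0 phiN] := Cc_bounded cphi.
apply/ccontP => chi e e0; pose q := 2 * N * fine (theta (supp phi)).
have q0 : 0 <= q by rewrite !mulr_ge0// fine_ge0.
have e1 : 0 < e / (q + 1) by rewrite divr_gt0// ltr_wpDl.
apply: filterS (dual_unif_nbhs chi cphi.2 e1) => chi' H.
rewrite /inverse_fourier -(cintB hG theta_haar (Cc_dualM chi' cphi) (Cc_dualM chi cphi)).
apply: (@le_lt_trans _ _ (2 * (N * (e / (q + 1))) * fine (theta (supp phi)))).
  apply: (cint_bound hG theta_haar (CcB hG (Cc_dualM chi' cphi) (Cc_dualM chi cphi)) cphi.2).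
    by move=> x /Cc0 ->; rewrite !mulr0 subrr.
  move=> x sx; rewrite -mulrBl cmodM mulrC ler_pM ?cmod_ge0// ltW//.
  exact: H.
have -> : 2 * (N * (e / (q + 1))) * fine (theta (supp phi)) = e * (q / (q + 1)).
  by rewrite /q; ring.
rewrite -[ltRHS]mulr1 ltr_pM2l// ltr_pdivrMr ?ltr_wpDl// mul1r; lra.
Qed.

Lemma inverse_fourier_diff phi t chi : Cc phi ->
  inverse_fourier theta (fun x => phi x - phi (x + t)) chi =
  (1 - dual_val chi (- t)) * inverse_fourier theta phi chi.
Proof.
move=> cphi; have c1 := Cc_dualM chi cphi.
have c2 := Cc_dualM chi (Cc_addr hG t cphi).
rewrite /inverse_fourier mulrBl mul1r -(cintZ hG theta_haar (dual_val chi (- t)) c1).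
rewrite -(cint_shift hG theta_haar t (CcZ hG (dual_val chi (- t)) c1)).
have c3 := Cc_addl hG t (CcZ hG (dual_val chi (- t)) c1).
rewrite -(cintB hG theta_haar c1 c3).
congr cintegral; apply/funext => x.
by rewrite mulrA -dualD addrA addNr add0r [t + x]addrC mulrBr.
Qed.

(** Modulating a real function of positive integral by the conjugate of [chi] moves its integral to
    the frequency [chi]. *)
Lemma inverse_fourier_neq0 chi : exists2 phi, Cc phi & inverse_fourier theta phi chi != 0.
Proof.
have [f cf If] := haar_pos_fun hG lcG scG theta_haar.
exists (fun x => (f x)%:C%C * conjc (dual_val chi x)).
  exact: (CcM hG cf (ccontJ (@dual_cont R G chi))).
apply/eqP => /(congr1 (@complex.Re R)) /=.
rewrite (_ : (fun t => _) = f) => [h|]; first by rewrite h ltxx in If.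
by apply/funext => x; rewrite mulrCA dual_mul_conjc mulr1.
Qed.

Lemma dual_defect chi t : cmod (1 - dual_val chi (- t)) = cmod (1 - dual_val chi t).
Proof. by rewrite dualN -cmodJ conjCB conjcK -(rmorph1 (real_complex R)) conjCR. Qed.

End Fourier.

Section SpectralDefect.
Context {R : realType} {G : topologicalZmodType}.
Hypotheses (hG : hausdorff_space G) (lcG : locally_compact [set: G])
  (scG : sigma_compact G).
Variable theta : {measure set (borel G) -> \bar R}.
Hypothesis theta_haar : haar_measure theta.
Variables (mu : (G -> R[i]) -> R[i]) (A : nat -> set G) (gamma : (G -> R[i]) -> R[i]).
Hypotheses (mu_radon : complex_radon_measure mu) (mu_bounded : translation_bounded mu)
  (A_vh : van_hove theta A) (gammaP : autocorrelation theta A mu gamma).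
Variable nu : {measure set (borel (dual R G)) -> \bar R}.
Hypothesis nuP : fourier_transform theta gamma nu.

Definition weight (phi : G -> R[i]) (chi : dual R G) : R :=
  cmod (inverse_fourier theta phi chi) ^+ 2.

Definition spectral_defect (phi : G -> R[i]) (t : G) : R :=
  \int[nu]_(chi in setT) (cmod (1 - dual_val chi t) ^+ 2 * weight phi chi).

Lemma relatively_denseS (P Q : set G) : P `<=` Q -> relatively_dense P -> relatively_dense Q.
Proof.
move=> PQ [K cK PK]; exists K => //; apply/seteqP; split=> // x _.
have : sumset P K x by rewrite PK.
by case=> p /PQ Qp [k Kk <-]; exists p => //; exists k.
Qed.

Lemma spectral_defectE phi t : Cc phi ->
  let psi x := phi x - phi (x + t) in
  complex.Re (gamma (convolution theta psi (tilde psi))) = spectral_defect phi t.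
Proof.
move=> cphi psi; have cpsi : Cc psi by exact: (CcB hG cphi (Cc_addr hG t cphi)).
have [_ <-] := nuP.2 _ cpsi; apply: eq_Rintegral => chi _.
by rewrite (inverse_fourier_diff hG theta_haar t chi cphi) cmodM exprMn dual_defect.
Qed.

Lemma mean_almost_periodicP : mean_almost_periodic theta A mu <->
  forall phi, Cc phi -> forall e : R, 0 < e ->
    relatively_dense [set t | spectral_defect phi t < e].
Proof.
(* The mean square involves the reflection of the test function; reflection is a bijection of the
   test functions, so quantifying over all of them absorbs it. *)
have copp (phi : G -> R[i]) : Cc phi -> Cc (fun x => phi (- x)).
  by move=> cphi; have := Cc_subl hG 0 cphi; under eq_fun do rewrite sub0r.
have bridge phi := besicovitch_mean_square hG lcG scG theta_haar mu_radon mu_bounded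
  A_vh gammaP (phi := phi).
split=> [H phi cphi e e0|H phi cphi e e0].
  have [M M0 HM] := bridge _ (copp _ cphi).
  (* The bound on the defect is then [e / 2], strictly below [e]. *)
  have e1 : 0 < e / (2 * M) by rewrite divr_gt0// mulr_gt0.
  apply: relatively_denseS (H _ (copp _ cphi) _ e1) => t /=.
  have [_ +] := HM t _ e1 => /[apply].
  have -> : (fun x => phi (- - x) - phi (- - (x + t))) = fun x => phi x - phi (x + t).
    by apply/funext => x; rewrite !opprK.
  rewrite spectral_defectE// => /le_lt_trans; apply.
  have -> : M * (e / (2 * M)) = e / 2 by field; rewrite gt_eqF.
  lra.
have [M M0 HM] := bridge _ cphi.
have e1 : 0 < e ^+ 2 by rewrite exprn_gt0.
apply: relatively_denseS (H _ (copp _ cphi) _ e1) => t /= De.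
have [+ _] := HM t _ e0; apply.
by rewrite (@spectral_defectE (fun x => phi (- x)))//; exact: copp.
Qed.

Lemma weight_ge0 phi chi : 0 <= weight phi chi. Proof. exact: sqr_ge0. Qed.

Lemma weight_cont phi : Cc phi -> continuous (weight phi).
Proof.
move=> cphi; have c := cont_cmod (inverse_fourier_cont hG theta_haar cphi).
exact: (cont_sqr c).
Qed.

Lemma weight_bounded phi : Cc phi -> exists2 M : R, 0 < M & forall chi, weight phi chi <= M.
Proof.
move=> cphi; have [M M0 HM] := inverse_fourier_bounded hG theta_haar cphi.
exists (M ^+ 2) => [|chi]; first exact: exprn_gt0.
by rewrite /weight lerXn2r ?nnegrE ?cmod_ge0// ltW.
Qed.

Lemma weight_lty phi : Cc phi -> (\int[nu]_chi (weight phi chi)%:E < +oo)%E.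
Proof. by move=> cphi; have [] := nuP.2 _ cphi. Qed.

Lemma weight_measurable phi (D : set (borel (dual R G))) : Cc phi ->
  measurable_fun D (weight phi).
Proof. by move=> cphi; exact: (cont_measurable (weight_cont cphi)). Qed.

Lemma defect_cont t : continuous (fun chi : dual R G => cmod (1 - dual_val chi t) ^+ 2).
Proof.
have c := ccontB (@ccont_cst R (dual R G) 1) (dual_eval_cont (x := t)).
exact: (cont_sqr (cont_cmod c)).
Qed.

Lemma defect_le4 t (chi : dual R G) : cmod (1 - dual_val chi t) ^+ 2 <= 4.
Proof.
have -> : 4 = 2 ^+ 2 :> R by ring.
rewrite lerXn2r ?nnegrE ?cmod_ge0//.
by apply: le_trans (cmodB _ _) _; rewrite cmod1 dual_cmod; lra.
Qed.

Lemma integrand_measurable phi t (D : set (borel (dual R G))) : Cc phi ->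
  measurable_fun D (fun chi => cmod (1 - dual_val chi t) ^+ 2 * weight phi chi).
Proof.
move=> cphi; apply: measurable_funM; last exact: weight_measurable.
exact: (cont_measurable (defect_cont (t := t))).
Qed.

Lemma integrand_integrable phi t : Cc phi ->
  nu.-integrable setT (EFin \o fun chi => cmod (1 - dual_val chi t) ^+ 2 * weight phi chi).
Proof.
move=> cphi; apply/integrableP; split.
  by apply/measurable_EFinP; exact: integrand_measurable.
apply: (@le_lt_trans _ _ (\int[nu]_chi (4 * weight phi chi)%:E)%E).
  apply: ge0_le_integral => //.
  - by apply: measurableT_comp => //; apply/measurable_EFinP; exact: integrand_measurable.
  - by apply/measurable_EFinP; apply: measurable_funM => //; exact: weight_measurable.
  - move=> chi _; have w0 := weight_ge0 phi chi.
    rewrite /= lee_fin (ger0_norm (mulr_ge0 (sqr_ge0 _) w0)).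
    exact: (ler_wpM2r w0 (defect_le4 t chi)).
under eq_integral do rewrite EFinM.
rewrite ge0_integralZl//; [|by apply/measurable_EFinP; exact: weight_measurable|].
  by rewrite lte_mul_pinfty// weight_lty.
by move=> chi _; rewrite lee_fin weight_ge0.
Qed.

End SpectralDefect.

(** * Pure point measures have almost periods *)

Section RealIntegrals.
Context d {X : measurableType d} {R : realType} {nu : {measure set X -> \bar R}}.
Implicit Types (D E : set X) (f g : X -> R).

Lemma Rintegral_subset D E f : measurable D -> measurable E -> D `<=` E ->
  nu.-integrable E (EFin \o f) -> (forall x, E x -> 0 <= f x) ->
  \int[nu]_(x in D) f x <= \int[nu]_(x in E) f x.
Proof.
move=> mD mE DE fE f0; have mED : measurable (E `\` D) by exact: measurableD.
have -> : \int[nu]_(x in E) f x = \int[nu]_(x in D) f x + \int[nu]_(x in E `\` D) f x.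
  rewrite -Rintegral_setU ?setDUK//; apply/disj_setPS => x [Dx [_]]; exact.
by rewrite lerDl; apply: Rintegral_ge0 => x [Ex _]; exact: f0.
Qed.

Lemma Rintegral_cvg0 D (f : nat -> X -> R) g : measurable D ->
  (forall n, measurable_fun D (f n)) -> nu.-integrable D (EFin \o g) ->
  (forall n x, D x -> `|f n x| <= g x) ->
  {ae nu, forall x, D x -> f n x @[n --> \oo] --> 0} ->
  \int[nu]_(x in D) f n x @[n --> \oo] --> 0.
Proof.
move=> mD mf ig fg f0.
have [|||||_ _] := @dominated_convergence _ X R nu D mD (fun n => EFin \o f n) (cst 0%E) (EFin \o g).
- by move=> n; apply/measurable_EFinP; exact: mf.
- exact: measurable_cst.
- apply: filterS f0 => x H Dx; apply: cvg_EFin; last exact: H.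
  by near=> n.
- exact: ig.
- by apply: aeW => x n Dx; rewrite /= lee_fin fg.
by rewrite integral0 => /fine_cvg.
Unshelve. all: by end_near. Qed.

End RealIntegrals.

Section AlmostPeriods.
Context {R : realType} {G : topologicalZmodType}.

Lemma circle_cells (e : R) : 0 < e -> exists (F : finType) (c : R[i] -> F),
  forall z w, cmod z <= 1 -> cmod w <= 1 -> c z = c w -> cmod (z - w) < e.
Proof.
(* A grid of mesh [1/N]: points of one cell differ by less than [1/N] in each coordinate, hence by
   less than [2/N < e]. *)
move=> e0; have [N [N0 Ne]] : exists N : nat, (0 < N)%N /\ 2 / e < N%:R.
  exists (Num.truncn (2 / e)).+1; split=> //.
  exact: truncnS_gt.
have NR : 0 < N%:R :> R by rewrite ltr0n.
(* Coordinates lie in [[-1, 1]], so the index runs from 0 to [2 * N] inclusive. *)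
pose q (x : R) : 'I_(2 * N).+1 := inord (Num.truncn ((x + 1) * N%:R)).
have qP x y : `|x| <= 1 -> `|y| <= 1 -> q x = q y -> `|x - y| < N%:R^-1.
  have val_q (z : R) : `|z| <= 1 -> nat_of_ord (q z) = Num.truncn ((z + 1) * N%:R).
    rewrite ler_norml => /andP[z1 z2]; rewrite /q inordK// ltnS.
    rewrite -(@ler_nat R) natrM; apply: (@le_trans _ _ ((z + 1) * N%:R)).
      by rewrite truncn_le// mulr_ge0 ?ler0n//; lra.
    by rewrite ler_wpM2r ?ler0n//; lra.
  move=> hx hy /(congr1 (@nat_of_ord _)); rewrite (val_q x hx) (val_q y hy) => E.
  have b (z : R) : `|z| <= 1 -> 0 <= (z + 1) * N%:R.
    by rewrite ler_norml => /andP[z1 z2]; rewrite mulr_ge0 ?ler0n//; lra.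
  have lx := truncn_itv (b x hx); have ly := truncn_itv (b y hy).
  move: lx ly; rewrite E => /andP[x1 x2] /andP[y1 y2].
  rewrite -natr1 in x2 y2.
  have : `|(x + 1) * N%:R - (y + 1) * N%:R| < 1.
    by rewrite ltr_norml; apply/andP; split; lra.
  rewrite -mulrBl normrM (ger0_norm (ltW NR)) -ltr_pdivlMr// div1r.
  by congr (`|_| < _); ring.
exists ('I_(2 * N).+1 * 'I_(2 * N).+1)%type, (fun z => (q (complex.Re z), q (complex.Im z))).
move=> z w z1 w1 [/qP h1 /qP h2].
have {}h1 := h1 (le_trans (Re_le_cmod z) z1) (le_trans (Re_le_cmod w) w1).
have {}h2 := h2 (le_trans (Im_le_cmod z) z1) (le_trans (Im_le_cmod w) w1).
apply: le_lt_trans (cmod_le_ReIm _) _; rewrite !raddfB /=.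
apply: lt_trans (ltrD h1 h2) _.
have -> : N%:R^-1 + N%:R^-1 = 2 / N%:R :> R by rewrite mulrDl mul1r.
rewrite ltr_pdivrMr//; by move: Ne; rewrite ltr_pdivrMr// mulrC.
Qed.

Lemma character_cells (s : seq (dual R G)) (e : R) : 0 < e ->
  exists (F : finType) (c : G -> F), forall t t' chi, c t = c t' -> chi \in s ->
    cmod (dual_val chi t - dual_val chi t') < e.
Proof.
move=> e0; have [F0 [c0 H0]] := circle_cells e0.
elim: s => [|chi s [F [c H]]]; first by exists unit, (fun=> tt).
exists (F * F0)%type, (fun t => (c t, c0 (dual_val chi t))) => t t' psi [ct c0t].
rewrite inE => /orP[/eqP ->|]; last exact: H.
by apply: H0 => //; rewrite dual_cmod.
Qed.

(* Pigeonhole: choosing one [t] in each nonempty cell gives a finite set of shifts. *)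
Lemma finite_almost_periods (s : seq (dual R G)) (e : R) : 0 < e ->
  relatively_dense [set t : G | forall chi, chi \in s -> cmod (1 - dual_val chi t) < e].
Proof.
move=> e0; have [F [c Hc]] := character_cells s e0.
(* On an empty cell [get] returns an arbitrary default; below, [r] is used on the cell of a given
   [t], where it is a true representative. *)
pose r (y : F) : G := get [set t | c t = y].
exists [set r y | y in [set: F]].
  by apply: finite_compact; apply: finite_image; exact: finite_finset.
apply/seteqP; split=> // t _.
have rt : c (r (c t)) = c t by apply: (@getPex _ [set u | c u = c t]); exists t.
exists (t - r (c t)); last by exists (r (c t)); [exists (c t)|rewrite subrK].
move=> chi chis; have := Hc _ _ chi rt chis.
rewrite -[X in _ -> X < _]mulr1 -(dual_cmod chi (r (c t))) -cmodM mulrBl mul1r -dualD subrK.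
exact.
Qed.

End AlmostPeriods.

Section PurePointImpliesAlmostPeriodic.
Context {R : realType} {G : topologicalZmodType}.
Hypothesis hG : hausdorff_space G.
Variable theta : {measure set (borel G) -> \bar R}.
Hypothesis theta_haar : haar_measure theta.
Variables (gamma : (G -> R[i]) -> R[i]).
Variable nu : {measure set (borel (dual R G)) -> \bar R}.
Hypothesis nuP : fourier_transform theta gamma nu.
Variable phi : G -> R[i].
Hypothesis cphi : Cc phi.

Let W := weight theta phi.

Lemma weight_integrable (D : set (borel (dual R G))) : measurable D ->
  nu.-integrable D (EFin \o W).
Proof.
move=> mD; apply: (@integrableS _ _ _ _ setT) => //; apply/integrableP; split.
  by apply/measurable_EFinP; exact: weight_measurable.
have := weight_lty nuP cphi; apply: le_lt_trans; apply: ge0_le_integral => //.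
- by apply: measurableT_comp => //; apply/measurable_EFinP; exact: weight_measurable.
- by apply/measurable_EFinP; exact: weight_measurable.
- by move=> chi _; rewrite /= ger0_norm// weight_ge0.
Qed.

(** These sets are open, and by Markov's inequality of finite measure. Inner regularity thus applies
    inside them although [nu] may be infinite. *)
Let U n : set (dual R G) := [set chi | n.+1%:R^-1 < W chi].

Let oU n : open (U n).
Proof.
have cW := weight_cont hG theta_haar cphi.
exact: (open_comp (fun chi _ => cW chi) (@open_gt R n.+1%:R^-1)).
Qed.

Let mU n : measurable (U n : set (borel (dual R G))).
Proof. exact: (borel_open (oU n)). Qed.

Let Un_lty n : (nu (U n) < +oo)%E.
Proof.
have n0 : 0 < n.+1%:R^-1 :> R by rewrite invr_gt0.
have : ((n.+1%:R^-1)%:E * nu (U n) <= \int[nu]_chi (W chi)%:E)%E.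
  rewrite -integral_cst//; apply: (@le_trans _ _ (\int[nu]_(chi in U n) (W chi)%:E)%E).
    apply: ge0_le_integral => //.
    - by move=> chi _; rewrite lee_fin ltW.
    - by apply/measurable_EFinP; exact: weight_measurable.
    - by move=> chi Uc; rewrite lee_fin ltW.
  apply: ge0_subset_integral => //.
    by apply/measurable_EFinP; exact: weight_measurable.
  by move=> chi _; rewrite lee_fin weight_ge0.
move=> /le_lt_trans /(_ (weight_lty nuP cphi)).
have : (0 <= nu (U n))%E by exact: measure_ge0.
case: (nu (U n)) => [r _ _|_|//]; first exact: ltry.
by rewrite gt0_muley ?lte_fin.
Qed.

(** Dominated convergence with majorant [W]: where [W] is positive the restriction to the complement
    of [U n] is eventually 0, and where [W] vanishes it is always 0. *)
Lemma weight_tail (e : R) : 0 < e -> exists n, \int[nu]_(chi in ~` U n) W chi < e.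
Proof.
move=> e0; pose f n chi := \1_(~` U n) chi * W chi : R.
have mC n : measurable (~` U n : set (borel (dual R G))) by exact: measurableC.
have fE n : \int[nu]_(chi in ~` U n) W chi = \int[nu]_(chi in setT) f n chi.
  rewrite (@Rintegral_support _ R (borel (dual R G)) nu (~` U n) (f n)).
    by apply: eq_Rintegral => chi Uc; rewrite /f indicE Uc mul1r.
  by move=> chi nU; rewrite /f indicE memNset// mul0r.
have : \int[nu]_(chi in setT) f n chi @[n --> \oo] --> 0.
  apply: (@Rintegral_cvg0 _ (borel (dual R G)) R nu setT f W) => //.
  - move=> n; apply: measurable_funM; first exact: measurable_indic.
    exact: weight_measurable.
  - exact: weight_integrable.
  - move=> n chi _; have W0 := weight_ge0 theta phi chi.
    rewrite /f normrM (ger0_norm W0) indicE; case: (_ \in _); rewrite ?normr1 ?mul1r//.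
    by rewrite normr0 mul0r.
  - apply: aeW => chi _; have := weight_ge0 theta phi chi; rewrite -/(W chi) le_eqVlt.
    move=> /orP[/eqP W0|W0].
      by rewrite /f -W0; under eq_fun do rewrite mulr0; exact: cvg_cst.
    apply: (@cvg_near_cst _ _ (0 : R)).
    have := near_infty_natSinv_lt (PosNum W0); apply: filterS => n Hn.
    by apply/eqP; rewrite /f indicE memNset ?mul0r//; apply.
move=> /cvgrPdist_lt /(_ e e0) [n _ Hn]; exists n; rewrite fE.
have := Hn n (leqnn n); rewrite sub0r normrN => /(le_lt_trans (ler_norm _)); exact.
Qed.

(** Three losses of [e / 3]: outside [U n], from [U n] to a compact [K], and from [K] to finitely
    many atoms. The last two are measured in mass and multiplied by the bound [M] of [W]. The
    passage through [K] is needed because [pure_point] speaks of relatively compact sets. *)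
Lemma pure_point_tail (e : R) : pure_point nu -> 0 < e ->
  exists F : set (dual R G), finite_set F /\ \int[nu]_(chi in ~` F) W chi < e.
Proof.
move=> ppnu e0; have hD := @dual_hausdorff R G.
have [M M0 WM] := weight_bounded hG theta_haar cphi; rewrite -/W in WM.
have e3 : 0 < e / 3 by rewrite divr_gt0.
have [n Hn] := weight_tail e3.
have e4 : 0 < e / 3 / M by rewrite divr_gt0.
have finU := Un_lty n.
have nuUE : nu (U n) \is a fin_num by rewrite ge0_fin_numE.
have [K [cK KU HK]] : exists K : set (dual R G), [/\ compact K, K `<=` U n &
    (nu (U n) - (e / 3 / M)%:E < nu K)%E].
  have := nuUE; rewrite (radon_inner nuP.1 (oU n)) => /(ub_ereal_sup_adherent e4).
  by move=> [_ [K [cK KU] <-] HK]; exists K.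
have mK := borel_compact hD cK.
have nuKU : (nu K <= nu (U n))%E by apply: le_measure; rewrite ?inE.
have pK : precompact K by rewrite precompact_closed//; exact: compact_closed.
have finK : nu K \is a fin_num by rewrite ge0_fin_numE// (le_lt_trans nuKU).
have [F [finF FK] HF] : exists2 F : set (dual R G), finite_set F /\ F `<=` K &
    (nu K - (e / 3 / M)%:E < \sum_(x \in F) nu [set x])%E.
  have := finK; rewrite (ppnu K mK pK) => /(ub_ereal_sup_adherent e4).
  by move=> [_ [F FK <-] HF]; exists F.
have mF : measurable (F : set (borel (dual R G))) by exact: borel_finite.
have nuF : (\sum_(x \in F) nu [set x])%E = nu F by exact: measure_finite.
exists F; split=> //.
have FU : F `<=` U n by exact: subset_trans KU.
have nuFU : (nu F <= nu (U n))%E by apply: le_measure; rewrite ?inE.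
have finF' : nu F \is a fin_num by rewrite ge0_fin_numE// (le_lt_trans nuFU).
have mUF : measurable (U n `\` F : set (borel (dual R G))) by exact: measurableD.
have HUF : fine (nu (U n `\` F)) < 2 * (e / 3 / M).
  rewrite measureD// (setIidr FU) fineB//.
  move: HK HF; rewrite nuF -(fineK nuUE) -(fineK finK) -(fineK finF').
  rewrite -!EFinB !lte_fin /=; lra.
have mC : measurable (~` U n : set (borel (dual R G))) by exact: measurableC.
have FE : ~` F = (~` U n) `|` (U n `\` F).
  apply/seteqP; split=> [x nF|x [nU|[]]//].
    by have [Ux|nU] := pselect (U n x); [right|left].
  by move=> /FU.
rewrite FE Rintegral_setU//; last 2 first.
- by apply: weight_integrable; exact: measurableU.
- by apply/disj_setPS => x [nU [/nU]].
have : \int[nu]_(x in U n `\` F) W x <= M * fine (nu (U n `\` F)).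
  apply: le_trans (ler_norm _) _; apply: bounded_Rintegral => //.
  - by apply: le_lt_trans finU; apply: le_measure; rewrite ?inE//; exact: subDsetl.
  - exact: weight_measurable.
  - by move=> x _; rewrite ger0_norm ?weight_ge0.
have : M * fine (nu (U n `\` F)) < M * (2 * (e / 3 / M)) by rewrite ltr_pM2l.
have -> : M * (2 * (e / 3 / M)) = 2 * e / 3 by field; rewrite gt_eqF.
lra.
Qed.

Lemma pure_point_relatively_dense (e : R) : pure_point nu -> 0 < e ->
  relatively_dense [set t | spectral_defect theta nu phi t < e].
Proof.
(* One fifth is spent on [F]; off [F] the bound [|1 - chi(t)|^2 <= 4] multiplies a tail below
   [e / 5]. *)
move=> ppnu e0; have e5 : 0 < e / 5 by rewrite divr_gt0.
have hD := @dual_hausdorff R G.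
have [F [/finite_seqP[s sF] HF]] := pure_point_tail ppnu e5.
pose I := \int[nu]_(chi in setT) W chi.
have I0 : 0 <= I by apply: Rintegral_ge0 => chi _; exact: weight_ge0.
(* The minimum with 1 bounds the square [|1 - chi(t)|^2] by [|1 - chi(t)|], hence by
   [e / 5 / (I + 1)]. *)
have d0 : 0 < Num.min 1 (e / 5 / (I + 1)) by rewrite lt_min ltr01 divr_gt0// ltr_wpDl.
apply: relatively_denseS (finite_almost_periods s d0) => t /= Ht.
have mF : measurable (F : set (borel (dual R G))).
  by apply: (borel_finite hD); rewrite sF; exact: finite_seq.
have mFC : measurable (~` F : set (borel (dual R G))) by exact: measurableC.
have iT := integrand_integrable hG theta_haar nuP t cphi.
have FT : setT = F `|` ~` F by rewrite setUCr.
rewrite /spectral_defect {1}FT Rintegral_setU//; last 2 first.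
- by rewrite -FT.
- by apply/disj_setPS => x [Fx].
have iF D : measurable D -> nu.-integrable D (EFin \o fun chi : borel (dual R G) =>
    cmod (1 - dual_val chi t) ^+ 2 * weight theta phi chi).
  by move=> mD; apply: integrableS iT.
have W0 := weight_ge0 theta phi.
have E1 : \int[nu]_(chi in F) (cmod (1 - dual_val chi t) ^+ 2 * weight theta phi chi) <= e / 5.
  apply: (@le_trans _ _ (\int[nu]_(chi in F) (e / 5 / (I + 1) * W chi))).
    apply: le_Rintegral => //; [exact: iF| |].
      exact: (integrableZl mF (e / 5 / (I + 1)) (weight_integrable mF)).
    move=> chi; rewrite sF => /Ht; rewrite lt_min => /andP[h1 h2].
    apply: ler_wpM2r (W0 chi) _ _ _; apply: le_trans (ltW h2).
    by rewrite expr2 ler_piMr ?cmod_ge0// ltW.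
  rewrite RintegralZl//; last exact: weight_integrable.
  apply: (@le_trans _ _ (e / 5 / (I + 1) * I)).
    rewrite ler_wpM2l//; first by rewrite divr_ge0// ?(ltW e5)// addr_ge0.
    apply: Rintegral_subset => //; first exact: weight_integrable.
  rewrite mulrAC ler_pdivrMr ?ltr_wpDl// ler_wpM2l ?(ltW e5)//; lra.
have E2 : \int[nu]_(chi in ~` F) (cmod (1 - dual_val chi t) ^+ 2 * weight theta phi chi) <=
    4 * (\int[nu]_(chi in ~` F) W chi).
  rewrite -RintegralZl//; last exact: weight_integrable.
  apply: le_Rintegral => //; [exact: iF| |].
    exact: (integrableZl mFC 4 (weight_integrable mFC)).
  by move=> chi _; exact: (ler_wpM2r (W0 chi) (defect_le4 t chi)).
lra.
Qed.

End PurePointImpliesAlmostPeriodic.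

(** * Wiener's lemma and the converse *)

Section CharacterAverages.
Context {R : realType} {G : topologicalZmodType}.
Variable theta : {measure set (borel G) -> \bar R}.
Hypothesis theta_haar : haar_measure theta.
Variable A : nat -> set G.
Hypothesis A_vh : van_hove theta A.

(** Invariance moves the shift to the domain. The symmetric difference of [A n] and [s + A n] lies
    in the van Hove boundary: points entering use the element [s] of the compact set, points leaving
    use [- s]. *)
Lemma shift_average (h : G -> R) (s : G) n : continuous h -> (forall t, `|h t| <= 1) ->
  (theta (van_hove_boundary [set s; (- s)%R] (A n)) < +oo)%E ->
  `|\int[theta]_(t in A n) h (s + t) - \int[theta]_(t in A n) h t| <=
    fine (theta (van_hove_boundary [set s; (- s)%R] (A n))).
Proof.
set B := van_hove_boundary _ _ => ch h1 tB.
have mA := van_hove_measurable A_vh n; have tA := van_hove_lty theta_haar A_vh n.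
have mB : measurable (B : set (borel G)) by exact: van_hove_boundary_measurable.
pose A' := [set t | A n (- s + t)].
have mA' : measurable (A' : set (borel G)).
  exact: (borel_open (open_addl (- s) (van_hove_open A_vh n))).
have tA' : (theta A' < +oo)%E by rewrite (haar_preimage theta_haar (- s) mA).
pose f1 t := \1_A' t * h t; pose f2 t := \1_(A n) t * h t.
have mf (D : set G) : measurable (D : set (borel G)) ->
    measurable_fun setT ((fun t => \1_D t * h t) : borel G -> R).
  by move=> mD; apply: measurable_funM; [exact: measurable_indic|exact: cont_measurable].
have fE (D : set G) (k : G -> R) : \int[theta]_(t in setT) (\1_D t * k t) = \int[theta]_(t in D) k t.
  rewrite (@Rintegral_support _ R (borel G) theta D); last by move=> t nD; rewrite indic_notin ?mul0r.
  by apply: eq_Rintegral => t Dt; rewrite indicE Dt mul1r.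
have fI (D : set G) (k : G -> R) : continuous k -> (forall t, `|k t| <= 1) ->
    measurable (D : set (borel G)) -> (theta D < +oo)%E ->
    theta.-integrable setT (EFin \o (fun t => \1_D t * k t)).
  move=> ck k1 mD tD.
  have : theta.-integrable D (EFin \o k).
    apply: (@bounded_integrable _ _ (borel G) theta D k 1) => //.
    exact: cont_measurable.
  move=> /(integrable_mkcond _ mD); congr (_.-integrable _ _).
  apply/funext => t; rewrite patchE /= indicE; case: ifPn; rewrite ?mul1r ?mul0r//.
have E1 : \int[theta]_(t in A n) h (s + t) = \int[theta]_(t in A') h t.
  have chs : continuous (fun t => h (s + t)).
    by move=> t; apply: continuous_comp; [exact: cont_addl|exact: ch].
  rewrite -[RHS]fE -(haar_shift_integral theta_haar (t := s) (mf _ mA')).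
    rewrite -[LHS]fE; apply: eq_Rintegral => t _; congr (_ * _).
    by rewrite !indicE; congr (nat_of_bool _)%:R; apply/idP/idP => /set_mem Ht;
      apply/mem_set; move: Ht; rewrite /A' /= addrA addNr add0r.
  have -> : (fun t => \1_A' (s + t) * h (s + t)) = fun t => \1_(A n) t * h (s + t).
    apply/funext => t; congr (_ * _); rewrite !indicE; congr (nat_of_bool _)%:R.
    by apply/idP/idP => /set_mem Ht; apply/mem_set; move: Ht; rewrite /A' /= addrA addNr add0r.
  exact: fI.
rewrite E1 -fE -[X in _ - X]fE -RintegralB//; [|exact: fI|exact: fI].
rewrite (@Rintegral_support _ R (borel G) theta B); last first.
  move=> t nB; have [A't|nA'] := pselect (A' t); have [At|nA] := pselect (A n t).
  - by rewrite !indicE !mem_set// subrr.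
  - case: nB; left; split; apply: subset_closure => //.
    by exists (- s + t) => //; exists s; [left|rewrite addrC addrA subrr add0r].
  - case: nB; right; split; apply: subset_closure => //.
    exists (- s + t) => //.
    by exists s; [exists (- s); [right|rewrite opprK]|rewrite addrC addrA subrr add0r].
  - by rewrite !indic_notin// !mul0r subrr.
rewrite -[leRHS]mul1r; apply: bounded_Rintegral => //.
  by apply: measurable_funB; apply: measurable_funS (mf _ _) => //.
move=> t _; rewrite !indicE; case: (_ \in _); case: (_ \in _);
  by rewrite ?mul1r ?mul0r ?subrr ?subr0 ?sub0r ?normrN ?normr0.
Qed.

(** The real part of [chi] times the conjugate of [chi'] at [t], in coordinates: the two characters
    separate, and double integrals over the dual stay real. *)
Definition character_pair (t : G) (chi chi' : dual R G) : R :=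
  complex.Re (dual_val chi t) * complex.Re (dual_val chi' t) +
  complex.Im (dual_val chi t) * complex.Im (dual_val chi' t).

Lemma character_pairE t chi chi' :
  character_pair t chi chi' = complex.Re (dual_val chi t * conjc (dual_val chi' t)).
Proof.
rewrite /character_pair; case: (dual_val chi t) => a b; case: (dual_val chi' t) => c e /=.
by rewrite mulrN opprK.
Qed.

Lemma character_pair_le1 t chi chi' : `|character_pair t chi chi'| <= 1.
Proof.
by rewrite character_pairE (le_trans (Re_le_cmod _))// cmodM cmodJ !dual_cmod mulr1.
Qed.

Lemma character_pair_dist t t' chi chi' : `|character_pair t chi chi' - character_pair t' chi chi'| <=
  cmod (dual_val chi (t - t') - 1) + cmod (dual_val chi' (t - t') - 1).
Proof.
rewrite !character_pairE -raddfB; apply: le_trans (Re_le_cmod _) _.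
have d (psi : dual R G) : cmod (dual_val psi t - dual_val psi t') = cmod (dual_val psi (t - t') - 1).
  rewrite -[RHS]mulr1 -(dual_cmod psi t') -cmodM mulrBl mul1r -dualD subrK.
  by [].
rewrite -!d.
have -> : dual_val chi t * conjc (dual_val chi' t) - dual_val chi t' * conjc (dual_val chi' t') =
  (dual_val chi t - dual_val chi t') * conjc (dual_val chi' t) +
  dual_val chi t' * conjc (dual_val chi' t - dual_val chi' t') by rewrite conjCB; ring.
by rewrite (le_trans (cmodD _ _))// !cmodM !cmodJ !dual_cmod mulr1 mul1r.
Qed.

Lemma character_pair_cont chi chi' x : continuous (fun t => character_pair (t - x) chi chi').
Proof.
have -> : (fun t => character_pair (t - x) chi chi') =
    (fun t => complex.Re (dual_val chi t * conjc (dual_val chi' t))) \o (fun t => t - x).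
  by apply/funext => t; rewrite /= character_pairE.
move=> t; apply: continuous_comp; first exact: cont_addr.
exact: (cont_Re (ccontM (@dual_cont R G chi) (ccontJ (@dual_cont R G chi')))).
Qed.

(* A translation by [s] multiplies the average by the value at [s] of the
   nontrivial character [chi / chi'], but changes it by [o(1)]. *)
Lemma character_average chi chi' x : chi != chi' ->
  (fine (theta (A n)))^-1 * (\int[theta]_(t in A n) character_pair (t - x) chi chi')
    @[n --> \oo] --> 0.
Proof.
move=> neq; pose om0 t := dual_val chi t * conjc (dual_val chi' t).
have [s zs] : exists s, om0 s != 1.
  apply: contrapT => H; move/eqP: neq; apply; apply: dual_inj; apply/funext => t.
  have : om0 t = 1 by apply/eqP; apply: contrapT => /negP h; apply: H; exists t.
  rewrite /om0 => /(congr1 (fun z => z * dual_val chi' t)).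
  by rewrite -mulrA [conjc _ * _]mulrC dual_mul_conjc mulr1 mul1r.
pose z0 := om0 s; have c0 : 0 < cmod (z0 - 1).
  by rewrite lt_neqAle cmod_ge0 andbT eq_sym; apply: contra_neq zs => /cmod_eq0/eqP;
    rewrite subr_eq0 => /eqP.
pose om t := om0 (t - x).
have omc : continuous om.
  have -> : om = om0 \o (fun t => t - x) by [].
  move=> t; apply: continuous_comp; first exact: cont_addr.
  exact: (ccontM (@dual_cont R G chi) (ccontJ (@dual_cont R G chi'))).
have om1 t : cmod (om t) = 1 by rewrite /om /om0 cmodM cmodJ !dual_cmod mulr1.
have omD t : om (s + t) = z0 * om t.
  by rewrite /om /z0 /om0 -addrA !dualD conjCM; ring.
have pE t : character_pair (t - x) chi chi' = complex.Re (om t) by rewrite character_pairE.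
have cQ : compact ([set s; (- s)%R] : set G) by apply: compactU; exact: compact_set1.
apply/cvgrPdist_lt => e e0.
(* Real and imaginary parts each change by at most [b] under the shift, so
   [|z0 - 1| * |J| <= 2 * b]; this choice then gives [|J| < e * theta (A n)]. *)
have e1 : 0 < e * cmod (z0 - 1) / 2 by rewrite divr_gt0// mulr_gt0.
apply: filterS (van_hove_boundary_small theta_haar A_vh cQ e1) => n [tB tBe].
have rA := van_hove_fine_gt0 theta_haar A_vh n.
have mA := van_hove_measurable A_vh n; have tA := van_hove_lty theta_haar A_vh n.
set b := fine _ in tBe.
have cR := cont_Re omc; have cI := cont_Im omc.
have R1 t : `|complex.Re (om t)| <= 1 by rewrite -(om1 t) Re_le_cmod.
have I1 t : `|complex.Im (om t)| <= 1 by rewrite -(om1 t) Im_le_cmod.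
have bR := shift_average cR R1 tB; have bI := shift_average cI I1 tB.
have iR : theta.-integrable (A n) (EFin \o (fun t => complex.Re (om t))).
  apply: (@bounded_integrable _ _ (borel G) theta (A n) _ 1) => //; exact: cont_measurable.
have iI : theta.-integrable (A n) (EFin \o (fun t => complex.Im (om t))).
  apply: (@bounded_integrable _ _ (borel G) theta (A n) _ 1) => //; exact: cont_measurable.
have iZ (r : R) (k : G -> R) : theta.-integrable (A n) (EFin \o k) ->
    theta.-integrable (A n) (EFin \o (fun t => r * k t)).
  by move=> ik; exact: (integrableZl mA r ik).
pose J := Complex (\int[theta]_(t in A n) complex.Re (om t)) (\int[theta]_(t in A n) complex.Im (om t)).
have ER : \int[theta]_(t in A n) complex.Re (om (s + t)) = complex.Re (z0 * J).
  have -> : (fun t => complex.Re (om (s + t))) =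
      fun t => complex.Re z0 * complex.Re (om t) - complex.Im z0 * complex.Im (om t).
    by apply/funext => t; rewrite omD; case: (z0) => ? ?; case: (om t).
  rewrite RintegralB//; [|exact: iZ|exact: iZ].
  by rewrite !RintegralZl// /J; case: (z0).
have EI : \int[theta]_(t in A n) complex.Im (om (s + t)) = complex.Im (z0 * J).
  have -> : (fun t => complex.Im (om (s + t))) =
      fun t => complex.Re z0 * complex.Im (om t) + complex.Im z0 * complex.Re (om t).
    by apply/funext => t; rewrite omD; case: (z0) => ? ?; case: (om t).
  rewrite RintegralD//; [|exact: iZ|exact: iZ].
  by rewrite !RintegralZl// /J; case: (z0).
have HJ : cmod (z0 - 1) * cmod J <= 2 * b.
  have HR : complex.Re (z0 * J - J) = complex.Re (z0 * J) - complex.Re J by exact: raddfB.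
  have HI : complex.Im (z0 * J - J) = complex.Im (z0 * J) - complex.Im J by exact: raddfB.
  rewrite -cmodM mulrBl mul1r; apply: le_trans (cmod_le_ReIm _) _.
  rewrite HR HI -ER -EI mulr_natl mulr2n; exact: lerD bR bI.
under eq_Rintegral do rewrite pE.
rewrite sub0r normrN normrM gtr0_norm ?invr_gt0// mulrC ltr_pdivrMr//.
apply: le_lt_trans (Re_le_cmod J) _.
rewrite -(ltr_pM2l c0); apply: le_lt_trans HJ _.
rewrite mulrA [_ * e]mulrC; lra.
Qed.

End CharacterAverages.

Section Wiener.
Context {R : realType} {G : topologicalZmodType}.
Hypothesis lcG : locally_compact [set: G].
Variable theta : {measure set (borel G) -> \bar R}.
Hypothesis theta_haar : haar_measure theta.
Variable A : nat -> set G.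
Hypothesis A_vh : van_hove theta A.
Variable nu : {measure set (borel (dual R G)) -> \bar R}.
Variables (C Kh : set (dual R G)).
Hypotheses (mC : measurable (C : set (borel (dual R G)))) (cK : compact Kh)
  (CK : C `<=` Kh) (nC : (nu C < +oo)%E)
  (C_atomless : forall chi, C chi -> nu [set chi] = 0%E).

Let c := fine (nu C).
Let c0 : 0 <= c. Proof. exact: fine_ge0. Qed.

(** [SR] and [SI] are the real and imaginary parts of the Fourier transform S of [nu] restricted to
    [C]. *)
Let SR t := \int[nu]_(chi in C) complex.Re (dual_val chi t).
Let SI t := \int[nu]_(chi in C) complex.Im (dual_val chi t).

Let mRe t : measurable_fun (C : set (borel (dual R G))) (fun chi => complex.Re (dual_val chi t)).
Proof. exact: (cont_measurable (cont_Re (dual_eval_cont (x := t)))). Qed.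

Let mIm t : measurable_fun (C : set (borel (dual R G))) (fun chi => complex.Im (dual_val chi t)).
Proof. exact: (cont_measurable (cont_Im (dual_eval_cont (x := t)))). Qed.

Let Re1 (chi : dual R G) t : `|complex.Re (dual_val chi t)| <= 1.
Proof. by rewrite -(dual_cmod chi t) Re_le_cmod. Qed.

Let Im1 (chi : dual R G) t : `|complex.Im (dual_val chi t)| <= 1.
Proof. by rewrite -(dual_cmod chi t) Im_le_cmod. Qed.

Let iRe t : nu.-integrable C (EFin \o (fun chi => complex.Re (dual_val chi t))).
Proof. by apply: (@bounded_integrable _ _ (borel (dual R G)) nu C _ 1). Qed.

Let iIm t : nu.-integrable C (EFin \o (fun chi => complex.Im (dual_val chi t))).
Proof. by apply: (@bounded_integrable _ _ (borel (dual R G)) nu C _ 1). Qed.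

(** This is the real part of [S(t)] times the conjugate of [chi'(t)], so that a further integration
    over [chi'] gives [|S(t)|^2]. Holding [chi'] fixed lets the two integrals over the dual be
    exchanged with the mean one at a time. *)
Let rho t chi' := \int[nu]_(chi in C) character_pair t chi chi'.

Let rhoE t chi' : rho t chi' =
  SR t * complex.Re (dual_val chi' t) + SI t * complex.Im (dual_val chi' t).
Proof.
rewrite /rho /character_pair RintegralD//; last 2 first.
- by have := integrableZl mC (complex.Re (dual_val chi' t)) (iRe t);
    congr (_.-integrable _ _); apply/funext => chi; rewrite /= -EFinM mulrC.
- by have := integrableZl mC (complex.Im (dual_val chi' t)) (iIm t);
    congr (_.-integrable _ _); apply/funext => chi; rewrite /= -EFinM mulrC.
by rewrite !RintegralZr.
Qed.

Let rho_int t : \int[nu]_(chi' in C) rho t chi' = SR t ^+ 2 + SI t ^+ 2.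
Proof.
under eq_Rintegral do rewrite rhoE.
rewrite RintegralD//; last 2 first.
- exact: (integrableZl mC (SR t) (iRe t)).
- exact: (integrableZl mC (SI t) (iIm t)).
by rewrite !RintegralZl// -!expr2.
Qed.

Let mpair t chi' : measurable_fun (C : set (borel (dual R G)))
  (fun chi => character_pair t chi chi').
Proof.
by apply: measurable_funD; apply: measurable_funM => //; exact: measurable_cst.
Qed.

Let rho_le t chi' : `|rho t chi'| <= c.
Proof.
rewrite -[leRHS]mul1r; apply: bounded_Rintegral => // chi _.
exact: character_pair_le1.
Qed.

Let rho_unif t t' chi' (e : R) : 0 <= e -> cmod (dual_val chi' (t - t') - 1) <= e ->
  (forall chi, C chi -> cmod (dual_val chi (t - t') - 1) <= e) ->
  `|rho t chi' - rho t' chi'| <= 2 * e * c.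
Proof.
move=> e0 h' h; apply: (@Rintegral_dist _ _ (borel (dual R G)) nu C _ _ 1) => //.
- by move=> chi _; exact: character_pair_le1.
- by move=> chi _; exact: character_pair_le1.
move=> chi Cc; apply: le_trans (character_pair_dist _ _ _ _) _.
by have := h chi Cc; lra.
Qed.

Let near_dual (e : R) : 0 < e ->
  \forall w \near (0 : G), forall chi, Kh chi -> cmod (dual_val chi w - 1) < e.
Proof. exact: dual_equicont. Qed.

Let cont_of_unif (f : G -> R) (b : R) : 0 <= b ->
  (forall e : R, 0 < e -> \forall w \near (0 : G), forall t, `|f (t + w) - f t| <= b * e) ->
  continuous f.
Proof.
move=> b0 H t; apply/cvgrPdist_lt => e e0; apply/near_addE.
have e1 : 0 < e / (b + 1) by rewrite divr_gt0// ltr_wpDl.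
apply: filterS (H _ e1) => w /(_ t); rewrite distrC => /le_lt_trans; apply.
rewrite mulrCA -[ltRHS]mulr1 ltr_pM2l// ltr_pdivrMr ?ltr_wpDl// mul1r; lra.
Qed.

Let SR_cont : continuous SR.
Proof.
apply: (@cont_of_unif _ c c0) => e e0; apply: filterS (near_dual e0) => w H t.
rewrite mulrC; apply: (@Rintegral_dist _ _ (borel (dual R G)) nu C _ _ 1) => // chi Cc.
rewrite -raddfB; apply: le_trans (Re_le_cmod _) _.
rewrite dualD -[X in _ - X]mulr1 -mulrBr cmodM dual_cmod mul1r ltW//.
by apply: H; exact: CK.
Qed.

Let SI_cont : continuous SI.
Proof.
apply: (@cont_of_unif _ c c0) => e e0; apply: filterS (near_dual e0) => w H t.
rewrite mulrC; apply: (@Rintegral_dist _ _ (borel (dual R G)) nu C _ _ 1) => // chi Cc.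
rewrite -raddfB; apply: le_trans (Im_le_cmod _) _.
rewrite dualD -[X in _ - X]mulr1 -mulrBr cmodM dual_cmod mul1r ltW//.
by apply: H; exact: CK.
Qed.

Let shiftc (f : G -> R) x : continuous f -> continuous (fun t => f (t - x)).
Proof. by move=> cf t; apply: continuous_comp; [exact: cont_addr|exact: cf]. Qed.

Let rho_cont chi' x : continuous (fun t => rho (t - x) chi').
Proof.
under eq_fun do rewrite rhoE.
apply: (@shiftc (fun t => SR t * complex.Re (dual_val chi' t) +
  SI t * complex.Im (dual_val chi' t))) => t; apply: cvgD; apply: cvgM.
- exact: SR_cont.
- exact: (cont_Re (@dual_cont R G chi')).
- exact: SI_cont.
- exact: (cont_Im (@dual_cont R G chi')).
Qed.

Let pair_near (e : R) : 0 < e -> exists2 W : set G, nbhs (0 : G) W &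
  forall t t' x chi, W (t - t') -> C chi -> cmod (dual_val chi (t - x - (t' - x)) - 1) <= e.
Proof.
move=> e0; exists [set w | forall chi, Kh chi -> cmod (dual_val chi w - 1) < e].
  exact: near_dual.
move=> t t' x chi H Cc; have -> : t - x - (t' - x) = t - t'.
  by rewrite opprB addrA subrK.
by rewrite ltW//; apply: H; exact: CK.
Qed.

Let mA n : measurable (A n : set (borel G)). Proof. exact: (van_hove_measurable A_vh n). Qed.
Let tA n : (theta (A n) < +oo)%E. Proof. exact: (van_hove_lty theta_haar A_vh n). Qed.
Let cA n : compact (closure (A n)).
Proof. by have := van_hove_precompact A_vh n; rewrite precompactE. Qed.

Let avg n (f : G -> R) := (fine (theta (A n)))^-1 * \int[theta]_(t in A n) f t.

Let avg_le n f (M : R) : continuous f -> (forall t, `|f t| <= M) -> `|avg n f| <= M.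
Proof.
move=> cf fM; have r0 := van_hove_fine_gt0 theta_haar A_vh n.
rewrite /avg normrM gtr0_norm ?invr_gt0// ler_pdivrMl// mulrC.
by apply: bounded_Rintegral => //; exact: cont_measurable.
Qed.

(** After the exchange, the averages of [character_pair] tend to 0 for every [chi] other than
    [chi']. The exceptional point is null because [C] has no atoms, and dominated convergence
    applies with bound 1. *)
Let avg_rho_cvg chi' x : C chi' -> avg n (fun t => rho (t - x) chi') @[n --> \oo] --> 0.
Proof.
move=> Cchi'; pose H t chi := character_pair (t - x) chi chi'.
have Hunif (e : R) : 0 < e -> exists2 W : set G, nbhs (0 : G) W &
    forall t t' chi, W (t - t') -> C chi -> `|H t chi - H t' chi| <= e.
  move=> e0; have e2 : 0 < e / 2 by rewrite divr_gt0.
  have [W nW HW] := pair_near e2; exists W => // t t' chi Wt Cc.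
  apply: le_trans (character_pair_dist _ _ _ _) _; rewrite [leRHS]splitr.
  by apply: lerD; apply: HW.
have swap1 n : measurable_fun (C : set (borel (dual R G)))
    (fun chi => \int[theta]_(t in A n) H t chi) /\
  \int[nu]_(chi in C) \int[theta]_(t in A n) H t chi =
    \int[theta]_(t in A n) rho (t - x) chi'.
  split.
    apply: (@swap_measurable R G theta _ (borel (dual R G)) nu (A n) (closure (A n)) C H 1) => //.
    - exact: subset_closure.
    - by move=> t chi _ _; exact: character_pair_le1.
    - by move=> t _; exact: mpair.
    - by move=> chi _; apply: cont_measurable; exact: character_pair_cont.
    - by move=> e /Hunif[W nW HW]; exists W => // t t' chi _ _; exact: HW.
  apply: (@swap_integrals R G theta _ (borel (dual R G)) nu (A n) (closure (A n)) C H 1) => //.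
  - exact: subset_closure.
  - by move=> t chi _ _; exact: character_pair_le1.
  - by move=> t _; exact: mpair.
  - by move=> chi _; apply: cont_measurable; exact: character_pair_cont.
  - by move=> e /Hunif[W nW HW]; exists W => // t t' chi _ _; exact: HW.
  - by apply: cont_measurable; exact: rho_cont.
have HA n chi : `|avg n (H ^~ chi)| <= 1.
  by apply: avg_le; [exact: character_pair_cont|move=> t; exact: character_pair_le1].
have mavg n : measurable_fun (C : set (borel (dual R G))) (fun chi => avg n (H ^~ chi)).
  by apply: measurable_funM; [exact: measurable_cst|exact: (swap1 n).1].
have -> : (fun n => avg n (fun t => rho (t - x) chi')) =
    fun n => \int[nu]_(chi in C) avg n (H ^~ chi).
  apply/funext => n; rewrite /avg RintegralZl//; first by rewrite (swap1 n).2.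
  apply: (@bounded_integrable _ _ (borel (dual R G)) nu C _ (1 * fine (theta (A n)))) => //.
    exact: (swap1 n).1.
  move=> chi _; apply: bounded_Rintegral => // [|t _].
    by apply: cont_measurable; exact: character_pair_cont.
  exact: character_pair_le1.
apply: (@Rintegral_cvg0 _ (borel (dual R G)) R nu C _ (fun=> 1)) => //.
  by apply: (@bounded_integrable _ _ (borel (dual R G)) nu C _ `|1|).
exists [set chi']; split.
- by apply: borel_set1; exact: dual_hausdorff.
- exact: C_atomless.
move=> chi /= nH; apply: contrapT => /eqP ne; apply: nH => _.
exact: (character_average theta_haar A_vh x ne).
Qed.

(* Wiener's lemma, for the translates of the Fourier transform of [nu] on [C]. *)
Lemma wiener x : avg n (fun t => SR (t - x) ^+ 2 + SI (t - x) ^+ 2) @[n --> \oo] --> 0.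
Proof.
pose H t chi' := rho (t - x) chi'.
have mH t : measurable_fun (C : set (borel (dual R G))) (H t).
  rewrite /H; under eq_fun do rewrite rhoE.
  by apply: measurable_funD; apply: measurable_funM => //; exact: measurable_cst.
have Hunif (e : R) : 0 < e -> exists2 W : set G, nbhs (0 : G) W &
    forall t t' chi, W (t - t') -> C chi -> `|H t chi - H t' chi| <= e.
  move=> e0; have e2 : 0 < e / (2 * c + 1) by rewrite divr_gt0// ltr_wpDl// mulr_ge0.
  have [W nW HW] := pair_near e2; exists W => // t t' chi Wt Cc.
  have := @rho_unif (t - x) (t' - x) chi _ (ltW e2) (HW _ _ _ _ Wt Cc)
    (fun chi0 Cc0 => HW _ _ _ chi0 Wt Cc0).
  move=> /le_trans; apply.
  rewrite -mulrA mulrCA -[leRHS]mulr1 -mulrA ler_wpM2l ?(ltW e0)//.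
  rewrite mulrC ler_pdivrMr ?ltr_wpDl ?mulr_ge0//; lra.
have csq : continuous (fun t => SR (t - x) ^+ 2 + SI (t - x) ^+ 2).
  apply: (@shiftc (fun t => SR t ^+ 2 + SI t ^+ 2)) => t.
  by apply: cvgD; apply: cvgM; [exact: SR_cont|exact: SR_cont|exact: SI_cont|exact: SI_cont].
have swap1 n : measurable_fun (C : set (borel (dual R G)))
    (fun chi => \int[theta]_(t in A n) H t chi) /\
  \int[nu]_(chi in C) \int[theta]_(t in A n) H t chi =
    \int[theta]_(t in A n) (SR (t - x) ^+ 2 + SI (t - x) ^+ 2).
  split.
    apply: (@swap_measurable R G theta _ (borel (dual R G)) nu (A n) (closure (A n)) C H c) => //.
    - exact: subset_closure.
    - by move=> t chi _ _; exact: rho_le.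
    - by move=> chi _; apply: cont_measurable; exact: rho_cont.
    - by move=> e /Hunif[W nW HW]; exists W => // t t' chi _ _; exact: HW.
  under [RHS]eq_Rintegral do rewrite -rho_int.
  apply: (@swap_integrals R G theta _ (borel (dual R G)) nu (A n) (closure (A n)) C H c) => //.
  - exact: subset_closure.
  - by move=> t chi _ _; exact: rho_le.
  - by move=> chi _; apply: cont_measurable; exact: rho_cont.
  - by move=> e /Hunif[W nW HW]; exists W => // t t' chi _ _; exact: HW.
  - by rewrite /H; under eq_fun do rewrite rho_int; exact: cont_measurable.
have -> : (fun n => avg n (fun t => SR (t - x) ^+ 2 + SI (t - x) ^+ 2)) =
    fun n => \int[nu]_(chi in C) avg n (H ^~ chi).
  apply/funext => n; rewrite /avg RintegralZl//; first by rewrite (swap1 n).2.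
  apply: (@bounded_integrable _ _ (borel (dual R G)) nu C _ (c * fine (theta (A n)))) => //.
    exact: (swap1 n).1.
  move=> chi _; apply: bounded_Rintegral => // [|t _]; last exact: rho_le.
  by apply: cont_measurable; exact: rho_cont.
apply: (@Rintegral_cvg0 _ (borel (dual R G)) R nu C _ (fun=> c)) => //.
- by move=> n; apply: measurable_funM; [exact: measurable_cst|exact: (swap1 n).1].
- by apply: (@bounded_integrable _ _ (borel (dual R G)) nu C _ `|c|).
- by move=> n chi _; apply: avg_le; [exact: rho_cont|move=> t; exact: rho_le].
- by apply: aeW => chi Cchi; exact: avg_rho_cvg.
Qed.

(** As [|chi(t)| = 1], the integrand is [2 - 2 Re chi(t)]; a small integral forces [SR t] to be
    close to the total mass [c]. *)
Lemma defect_integral t :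
  \int[nu]_(chi in C) cmod (1 - dual_val chi t) ^+ 2 = 2 * c - 2 * SR t.
Proof.
transitivity (\int[nu]_(chi in C) (2 - 2 * complex.Re (dual_val chi t))).
  apply: eq_Rintegral => chi _; rewrite sqr_cmod; have := sqr_cmod (dual_val chi t).
  rewrite dual_cmod expr1n; case: (dual_val chi t) => a b /=; rewrite sub0r sqrrN; lra.
rewrite RintegralB//; last 2 first.
- by apply: (@bounded_integrable _ _ (borel (dual R G)) nu C _ `|2|).
- exact: (integrableZl mC 2 (iRe t)).
by rewrite Rintegral_cst// RintegralZl.
Qed.

Lemma atomless_null : (forall e : R, 0 < e -> relatively_dense
    [set t : G | \int[nu]_(chi in C) cmod (1 - dual_val chi t) ^+ 2 < e]) ->
  nu C = 0%E.
Proof.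
move=> dense; have finC : nu C \is a fin_num by rewrite ge0_fin_numE.
rewrite -(fineK finC) -/c; congr (_%:E); apply/eqP; rewrite eq_le c0 andbT leNgt.
(* An integral below [c / 2] gives [SR p > 3 c / 4]; replacing [k] in [K] by a nearby [x] in [ts]
   loses at most [c / 4]. *)
apply/negP => cp; have c2 : 0 < c / 2 by rewrite divr_gt0.
have [K cKc PK] := dense _ c2.
have q0 : (0 : R) < 4^-1 by rewrite invr_gt0.
have [ts Hts] := compact_shift_cover cKc (near_dual q0).
have lower t : exists2 x, x \in ts & c / 2 <= SR (t - x).
  have : sumset [set t | \int[nu]_(chi in C) cmod (1 - dual_val chi t) ^+ 2 < c / 2] K t.
    by rewrite PK.
  case=> p /= Dp [k Kk <-]; have [x xts Hx] := Hts k Kk.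
  exists x => //; rewrite -addrA; move: Dp; rewrite defect_integral => Dp.
  have : `|SR (p + (k - x)) - SR p| <= 4^-1 * c.
    apply: (@Rintegral_dist _ _ (borel (dual R G)) nu C _ _ 1) => // chi Cc.
    rewrite -raddfB; apply: le_trans (Re_le_cmod _) _.
    rewrite dualD -[X in _ - X]mulr1 -mulrBr cmodM dual_cmod mul1r ltW//.
    by apply: Hx; exact: CK.
  rewrite ler_norml => /andP[h _]; lra.
(* At every [t] some summand is at least [(c / 2) ^+ 2], yet each summand has mean 0. *)
pose F t := \sum_(x <- ts) (SR (t - x) ^+ 2 + SI (t - x) ^+ 2).
have F_ge t : (c / 2) ^+ 2 <= F t.
  have [x xts hx] := lower t; rewrite /F (big_rem x)//=.
  have h1 : (c / 2) ^+ 2 <= SR (t - x) ^+ 2.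
    by rewrite lerXn2r ?nnegrE ?(ltW c2)// (le_trans (ltW c2)).
  have h2 := sqr_ge0 (SI (t - x)).
  have : 0 <= \sum_(y <- rem x ts) (SR (t - y) ^+ 2 + SI (t - y) ^+ 2).
    by apply: sumr_ge0 => y _; rewrite addr_ge0 ?sqr_ge0.
  lra.
have csq x : continuous (fun t => SR (t - x) ^+ 2 + SI (t - x) ^+ 2).
  apply: (@shiftc (fun t => SR t ^+ 2 + SI t ^+ 2)) => t.
  by apply: cvgD; apply: cvgM; [exact: SR_cont|exact: SR_cont|exact: SI_cont|exact: SI_cont].
have S_le t : SR t ^+ 2 + SI t ^+ 2 <= 2 * c ^+ 2.
  have hR : `|SR t| <= c by rewrite -[leRHS]mul1r; apply: bounded_Rintegral.
  have hI : `|SI t| <= c by rewrite -[leRHS]mul1r; apply: bounded_Rintegral.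
  have sq (y : R) : `|y| <= c -> y ^+ 2 <= c ^+ 2.
    by move=> h; rewrite -real_normK ?num_real// lerXn2r ?nnegrE.
  by have := sq _ hR; have := sq _ hI; lra.
have avgF n : avg n F = \sum_(x <- ts) avg n (fun t => SR (t - x) ^+ 2 + SI (t - x) ^+ 2).
  rewrite /avg -mulr_sumr; congr (_ * _).
  have [|_ ->] := @Rintegral_sum_seq _ _ (borel G) theta (A n) _ ts
    (fun x t => SR (t - x) ^+ 2 + SI (t - x) ^+ 2) (mA n) => // x _.
  apply: (@bounded_integrable _ _ (borel G) theta (A n) _ (2 * c ^+ 2)) => //.
    exact: (cont_measurable (csq x)).
  by move=> t _; rewrite ger0_norm ?addr_ge0 ?sqr_ge0.
have avgF0 : avg n F @[n --> \oo] --> 0.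
  under eq_fun do rewrite avgF.
  elim: (ts) => [|x s IH]; first by under eq_fun do rewrite big_nil; exact: cvg_cst.
  under eq_fun do rewrite big_cons.
  have H := cvgD (wiener x) IH; rewrite addr0 in H; exact: H.
have avg_ge n : (c / 2) ^+ 2 <= avg n F.
  have r0 := van_hove_fine_gt0 theta_haar A_vh n.
  rewrite /avg ler_pdivlMl// mulrC -Rintegral_cst//.
  have cF : continuous F.
    rewrite /F; elim: (ts) => [|x s IH].
      by under eq_fun do rewrite big_nil; move=> t; exact: cvg_cst.
    under eq_fun do rewrite big_cons.
    by move=> t; apply: cvgD; [exact: csq|exact: IH].
  have FM t : `|F t| <= \sum_(x <- ts) (2 * c ^+ 2).
    rewrite ger0_norm; first by apply: ler_sum => x _; exact: S_le.
    by apply: sumr_ge0 => x _; rewrite addr_ge0 ?sqr_ge0.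
  apply: le_Rintegral => //.
    by apply: (@bounded_integrable _ _ (borel G) theta (A n) _ `|(c / 2) ^+ 2|).
  apply: (@bounded_integrable _ _ (borel G) theta (A n) _ _ (mA n) (tA n) _ (fun t _ => FM t)).
  exact: cont_measurable.
have : (c / 2) ^+ 2 <= 0 by apply: (cvgr_to_ge avgF0); exact: nearW.
by rewrite leNgt exprn_gt0.
Qed.

End Wiener.

(** * From relatively dense almost periods to pure point spectrum *)

Section AlmostPeriodicImpliesPurePoint.
Context {R : realType} {G : topologicalZmodType}.
Hypotheses (hG : hausdorff_space G) (lcG : locally_compact [set: G])
  (scG : sigma_compact G).
Variable theta : {measure set (borel G) -> \bar R}.
Hypothesis theta_haar : haar_measure theta.
Variable A : nat -> set G.
Hypothesis A_vh : van_hove theta A.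
Variable gamma : (G -> R[i]) -> R[i].
Variable nu : {measure set (borel (dual R G)) -> \bar R}.
Hypothesis nuP : fourier_transform theta gamma nu.
Hypothesis dense : forall phi, Cc phi -> forall e : R, 0 < e ->
  relatively_dense [set t | spectral_defect theta nu phi t < e].

Let hD := @dual_hausdorff R G.

(** Where the weight is at least [delta], the spectral defect dominates [delta] times the unweighted
    integral over [C], so the almost periods of [phi] at level [delta * e] satisfy the hypothesis of
    [atomless_null]. *)
Let atomless_above (C Kh : set (dual R G)) phi (delta : R) :
  measurable (C : set (borel (dual R G))) -> compact Kh -> C `<=` Kh ->
  (forall chi, C chi -> nu [set chi] = 0%E) -> Cc phi -> 0 < delta ->
  (forall chi, C chi -> delta <= weight theta phi chi) -> nu C = 0%E.
Proof.
move=> mC cK CK C0 cphi d0 dW.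
have nC : (nu C < +oo)%E.
  apply: le_lt_trans (radon_compact nuP.1 cK).
  by apply: le_measure; rewrite ?inE//; exact: borel_compact.
apply: (atomless_null lcG theta_haar A_vh mC cK CK nC C0) => e e0.
apply: relatively_denseS (dense cphi (mulr_gt0 d0 e0)) => t /= De.
have iT := integrand_integrable hG theta_haar nuP t cphi.
have iC : nu.-integrable C (EFin \o (fun chi : dual R G => cmod (1 - dual_val chi t) ^+ 2)).
  apply: (@bounded_integrable _ _ (borel (dual R G)) nu C _ 4) => //.
    exact: (cont_measurable (defect_cont (t := t))).
  by move=> chi _; rewrite ger0_norm ?sqr_ge0// defect_le4.
rewrite -(ltr_pM2l d0); apply: le_lt_trans De; rewrite -RintegralZl//.
apply: (@le_trans _ _ (\int[nu]_(chi in C) (cmod (1 - dual_val chi t) ^+ 2 * weight theta phi chi))).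
  apply: le_Rintegral => //.
  - exact: (integrableZl mC delta iC).
  - exact: (integrableS measurableT mC _ iT).
  - by move=> chi /dW h; rewrite mulrC ler_wpM2l ?sqr_ge0.
apply: Rintegral_subset => // chi _.
exact: (mulr_ge0 (sqr_ge0 _) (weight_ge0 _ _ _)).
Qed.

Lemma atomless_precompact_null (C Kh : set (dual R G)) :
  measurable (C : set (borel (dual R G))) -> compact Kh -> C `<=` Kh ->
  (forall chi, C chi -> nu [set chi] = 0%E) -> nu C = 0%E.
Proof.
move=> mC cK CK C0.
have /choice[f Hf] (chi : dual R G) : exists phi, Cc phi /\ 0 < weight theta phi chi.
  have [phi cphi h] := inverse_fourier_neq0 hG lcG scG theta_haar chi.
  exists phi; split=> //; rewrite /weight exprn_gt0// lt_neqAle cmod_ge0 andbT eq_sym.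
  by apply: contra_neq h; exact: cmod_eq0.
pose O chi := [set psi | weight theta (f chi) chi / 2 < weight theta (f chi) psi].
have oO chi : open (O chi).
  have cW := weight_cont hG theta_haar (Hf chi).1.
  exact: (open_comp (fun psi _ => cW psi) (@open_gt R (weight theta (f chi) chi / 2))).
have := cK; rewrite compact_cover => /(_ (dual R G) setT O (fun i _ => oO i)) [|D _ KD].
  move=> chi _; exists chi => //; rewrite /O /=; have := (Hf chi).2; lra.
have N chi : nu (C `&` O chi) = 0%E.
  have [cphi W0] := Hf chi.
  apply: (@atomless_above _ Kh (f chi) (weight theta (f chi) chi / 2)) => //.
  - by apply: measurableI => //; exact: (borel_open (oO chi)).
  - by move=> x [/CK].
  - by move=> x [/C0].
  - by rewrite divr_gt0.
  - by move=> x [_ /ltW].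
pose s := finmap.enum_fset D.
have mN chi : measurable (C `&` O chi : set (borel (dual R G))).
  by apply: measurableI => //; exact: (borel_open (oO chi)).
suff : nu.-negligible C by move=> /negligibleP; exact.
(* Beyond the length of [s] the default character is repeated; this is harmless, since [N] holds for
   every character. *)
apply: (@negligibleS _ _ _ nu (\bigcup_n (C `&` O (nth point s n)))).
  move=> chi Cchi; have [i iD Oi] := KD _ (CK _ Cchi).
  exists (index i s) => //; rewrite nth_index//; exact: iD.
apply: negligible_bigcup => n; apply/negligibleP; [exact: mN|exact: N].
Qed.


Let m1 (chi : dual R G) : measurable ([set chi] : set (borel (dual R G))).
Proof. exact: borel_set1. Qed.

(** Finite sets [F n] nearly attaining the sum [s] over the atoms of [B] give a countable, hence
    measurable, set [At] of mass at most [s]. A point of [B] outside [At] has mass 0, so the rest of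
    [B] has no atoms and is null. *)
Lemma relatively_dense_pure_point : pure_point nu.
Proof.
move=> B mB; rewrite precompactE => cB.
have BK : B `<=` closure B by exact: subset_closure.
have nB : (nu B < +oo)%E.
  apply: le_lt_trans (radon_compact nuP.1 cB).
  by apply: le_measure; rewrite ?inE//; exact: borel_compact.
set s := (\esum_(x in B) nu [set x])%E.
have Fs F : finite_set F -> F `<=` B -> (nu F <= s)%E.
  by move=> finF FB; apply: ereal_sup_ubound; exists F => //; exact: measure_finite.
have sB : (s <= nu B)%E.
  apply: ub_ereal_sup => _ [F [finF FB] <-]; rewrite measure_finite//.
  by apply: le_measure; rewrite ?inE//; exact: borel_finite.
have sfin : s \is a fin_num.
  by rewrite ge0_fin_numE ?(le_lt_trans sB)//; apply: esum_ge0.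
have /choice[F HF] (n : nat) : exists F, [/\ finite_set F, F `<=` B &
    (s - (n.+1%:R^-1)%:E < nu F)%E].
  have n0 : 0 < n.+1%:R^-1 :> R by rewrite invr_gt0.
  have [_ [F [finF FB] <-] h] := ub_ereal_sup_adherent n0 sfin.
  by exists F; split=> //; rewrite -measure_finite.
pose At : set (dual R G) := \bigcup_n F n.
have mF n : measurable (F n : set (borel (dual R G))) by apply: borel_finite => //; have [] := HF n.
have mAt : measurable (At : set (borel (dual R G))) by exact: bigcupT_measurable.
have AtB : At `<=` B by move=> x [n _]; have [_ + _] := HF n; exact.
have mBA : measurable (B `\` At : set (borel (dual R G))) by exact: measurableD.
have BA0 : nu (B `\` At) = 0%E.
  apply: (atomless_precompact_null mBA cB); first by move=> x [/BK].
  move=> x [Bx nAx]; apply/eqP; rewrite eq_le measure_ge0 andbT.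
  apply/lee_addgt0Pr => e e0; rewrite add0e.
  have [n _ Hn] := near_infty_natSinv_lt (PosNum e0).
  have [finF FB h] := HF n.
  (* Adding [x] to [F n] cannot push the mass beyond [s], so [x] has mass below [1/(n+1)]. *)
  have := Fs (x |` F n); rewrite finite_setU => /(_ (conj (finite_set1 x) finF)).
  have xFB : x |` F n `<=` B by move=> y [->//|/FB].
  move=> /(_ xFB); rewrite measureU//; last first.
    by apply/seteqP; split=> // y [/= -> Fx]; apply: nAx; exists n.
  have fF : nu (F n) \is a fin_num.
    by rewrite ge0_fin_numE// (le_lt_trans (Fs _ finF FB))// ltey_eq sfin.
  move: h (Hn n (leqnn n)) => /=; case: (nu [set x]) => [r||]; last by move=> _ _ _; exact: leNye.
    rewrite -(fineK fF) -(fineK sfin) -EFinB -EFinD !lte_fin !lee_fin.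
    move: (fine s) (fine (nu (F n))) (n.+1%:R^-1 : R) => a b k h1 h2 h3; lra.
  by rewrite -(fineK fF) -(fineK sfin) /= leye_eq.
(* The [F n] need not increase; their partial unions do, stay finite, and allow continuity from
   below. *)
pose H n := \big[setU/set0]_(i < n.+1) F i.
have HE : \bigcup_n H n = At by exact: bigcup_bigsetU_bigcup.
have finH n : finite_set (H n).
  rewrite /H -bigcup_mkord; apply: bigcup_finite => [|i _]; first exact: finite_II.
  by have [] := HF i.
have Ats : (nu At <= s)%E.
  have := @nondecreasing_cvg_mu _ _ _ nu H (fun n => borel_finite hD (finH n)).
  rewrite HE => /(_ mAt).
  have hH : {homo H : n m / (n <= m)%N >-> (n <= m)%O}.
    by move=> n m nm; apply/subsetPset; apply: subset_bigsetU; rewrite ltnS.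
  move=> /(_ hH) c; apply: (cvge_to_le c); apply: nearW => n /=.
  by apply: Fs => // x Hx; apply: AtB; rewrite -HE; exists n.
apply/eqP; rewrite eq_le sB andbT; apply: le_trans Ats.
have -> : B = At `|` (B `\` At) :> set (dual R G) by rewrite setDUK.
by rewrite measureU//; [have := BA0 => /= ->; rewrite adde0|exact: setDIK].
Qed.

End AlmostPeriodicImpliesPurePoint.

Theorem theorem3p18 (R : realType) (G : topologicalZmodType)
    (G_hausdorff : hausdorff_space G)
    (G_locally_compact : locally_compact [set: G])
    (G_sigma_compact : sigma_compact G)
    (theta : {measure set (borel G) -> \bar R}) (theta_haar : haar_measure theta)
    (mu : (G -> R[i]) -> R[i]) (mu_radon : complex_radon_measure mu)
    (mu_bounded : translation_bounded mu)
    (A : nat -> set G) (A_van_hove : van_hove theta A)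
    (gamma : (G -> R[i]) -> R[i]) (gamma_autocorr : autocorrelation theta A mu gamma)
    (gammahat : {measure set (borel (dual R G)) -> \bar R})
    (gammahat_fourier : fourier_transform theta gamma gammahat) :
  pure_point gammahat <-> mean_almost_periodic theta A mu.
Proof.
have mapP := mean_almost_periodicP G_hausdorff G_locally_compact G_sigma_compact
  theta_haar mu_radon mu_bounded A_van_hove gamma_autocorr gammahat_fourier.
split=> [pp|/mapP dense]; last first.
  exact: (relatively_dense_pure_point G_hausdorff G_locally_compact G_sigma_compact
    theta_haar A_van_hove gammahat_fourier dense).
apply/mapP => phi cphi e e0.
exact: (pure_point_relatively_dense G_hausdorff theta_haar gammahat_fourier cphi pp e0).
Qed.
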